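(* Let $C_2$ be the cyclic group of order $2$ and $D_8$ the dihedral group of order $8$. Then: $\mathcal{GT}_1(PSL_2(\mathbb{F}_4))$ is trivial; $\mathcal{GT}_1(PSL_2(\mathbb{F}_7))\cong C_2^3\times D_8^2$; $\mathcal{GT}_1(PSL_2(\mathbb{F}_9))\cong C_2^{12}\times D_8$; $\mathcal{GT}_1(PSL_2(\mathbb{F}_8))$ is trivial; $\mathcal{GT}_1(PSL_2(\mathbb{F}_{11}))\cong C_2^{27}\times D_8^{7}$; $\mathcal{GT}_1(PSL_2(\mathbb{F}_{13}))\cong C_2^{54}\times D_8^{17}$; $\mathcal{GT}_1(PSL_2(\mathbb{F}_{17}))\cong C_2^{104}\times D_8^{50}$; $\mathcal{GT}_1(PSL_2(\mathbb{F}_{19}))\cong C_2^{133}\times D_8^{74}$; $\mathcal{GT}_1(PSL_2(\mathbb{F}_{16}))$ is trivial.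
   Context: For a finite group $G$, let $F_2=\langle x,y\rangle$ be the free group on two generators, and let $N_G$ be the intersection of all normal subgroups $N$ of $F_2$ with $F_2/N\cong G$. Put $\overline{G}=F_2/N_G$, a finite group; the images of $x,y$ in $\overline{G}$ are still denoted $x,y$. There are automorphisms $\theta,\delta$ of $\overline{G}$ with $\theta(x)=y$, $\theta(y)=x$ and $\delta(x)=y^{-1}x^{-1}$, $\delta(y)=y$. The group $\mathcal{GT}_1(G)$ is the image in $\mathrm{Out}(\overline{G})$ of the subgroup of all $\varphi\in\mathrm{Aut}(\overline{G})$ such that (1) $\varphi(x)$ is conjugate to $x$ in $\overline{G}$, and (2) the class of $\varphi$ in $\mathrm{Out}(\overline{G})$ commutes with the classes of $\theta$ and of $\delta$. *)

(* Defs.v *)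
From HB Require Import structures.
From mathcomp Require Import all_boot all_order all_algebra all_fingroup.
From mathcomp Require Import all_solvable generic_quotient.
From mathcomp Require Import boolp.

Set Implicit Arguments.
Unset Strict Implicit.
Unset Printing Implicit Defensive.

Local Open Scope quotient_scope.
Local Open Scope group_scope.

(* The free group on two generators, as the group of reduced words.  A letter
   is a pair (generator, sign): (false, false) is x, (true, false) is y, and
   sign true marks an inverse. *)

Definition letter : Type := (bool * bool)%type.
Definition linv (a : letter) : letter := (a.1, ~~ a.2).

Definition reduced : pred (seq letter) := sorted [rel a b | a != linv b].

Record free2 := Free2 { word :> seq letter; wordP : reduced word }.

HB.instance Definition _ := [isSub for word].
HB.instance Definition _ := [Countable of free2 by <:].

Lemma linvK : involutive linv.
Proof. by case=> a b; rewrite /linv /= negbK. Qed.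

Definition push (a : letter) (w : seq letter) : seq letter :=
  if w is b :: w' then if a == linv b then w' else a :: w else [:: a].

Definition concat (u w : seq letter) : seq letter := foldr push w u.

Lemma push_reduced a w : reduced w -> reduced (push a w).
Proof.
case: w => //= b w; case: ifP => [_ /path_sorted //| /= ab bw].
by rewrite ab.
Qed.

Lemma concat_reduced u w : reduced w -> reduced (concat u w).
Proof. by move=> rw; elim: u => //= a u IHu; apply: push_reduced. Qed.

Lemma pushK a w : reduced w -> push (linv a) (push a w) = w.
Proof.
case: w => [|b w] /=; first by rewrite eqxx.
case: (eqVneq a (linv b)) => [->|neq_ab] bw /=; last by rewrite eqxx.
by rewrite linvK; case: w bw => //= c w /andP[/negbTE-> _].
Qed.

Lemma pushVK a w : reduced w -> push a (push (linv a) w) = w.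
Proof. by move=> rw; rewrite -{1}(linvK a) pushK. Qed.

Lemma concat_push a z w : reduced z -> reduced w ->
  concat (push a z) w = push a (concat z w).
Proof.
case: z => //= b z rz rw; case: eqP => //= ->.
by rewrite pushK ?concat_reduced.
Qed.

Lemma concatA u v w : reduced v -> reduced w ->
  concat (concat u v) w = concat u (concat v w).
Proof.
move=> rv rw; elim: u => //= a u IHu.
by rewrite concat_push ?concat_reduced ?IHu.
Qed.

Lemma reduced_behead a w : reduced (a :: w) -> reduced w.
Proof. exact: path_sorted. Qed.

Lemma concat0 w : reduced w -> concat w [::] = w.
Proof.
elim: w => //= a w IHw raw; rewrite IHw ?(reduced_behead raw) //.
by case: w raw {IHw} => //= b w /andP[/negbTE-> _].
Qed.

Definition winv (w : seq letter) : seq letter := rev (map linv w).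

Lemma winv_reduced w : reduced w -> reduced (winv w).
Proof.
rewrite /reduced /winv rev_sorted sorted_map.
rewrite (eq_sorted (e' := [rel a b | a != linv b])) // => a b /=.
by rewrite linvK eq_sym.
Qed.

Lemma winvK : involutive winv.
Proof. by move=> w; rewrite /winv map_rev revK mapK //; apply: linvK. Qed.

Lemma concatK u w : reduced w -> concat (winv u) (concat u w) = w.
Proof.
move=> rw; elim: u => //= a u IHu.
by rewrite /winv /= rev_cons /concat foldr_rcons pushK ?concat_reduced.
Qed.

Definition free2_one : free2 := @Free2 [::] isT.
Definition free2_mul (u v : free2) : free2 :=
  Free2 (concat_reduced u (wordP v)).
Definition free2_inv (u : free2) : free2 := Free2 (winv_reduced (wordP u)).

Lemma free2_mulA : associative free2_mul.
Proof.
by move=> u v w; apply: val_inj; rewrite /= concatA ?(wordP v) ?(wordP w).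
Qed.

Lemma free2_mul1 : left_id free2_one free2_mul.
Proof. by move=> u; apply: val_inj. Qed.

Lemma free2_mulr1 : right_id free2_one free2_mul.
Proof. by move=> u; apply: val_inj; rewrite /= concat0 ?(wordP u). Qed.

Lemma free2_mulV : left_inverse free2_one free2_inv free2_mul.
Proof.
move=> u; apply: val_inj; rewrite /= -[X in concat _ X](concat0 (wordP u)).
exact: concatK.
Qed.

Lemma free2_mulVr : right_inverse free2_one free2_inv free2_mul.
Proof.
move=> u; have inv2 : free2_inv (free2_inv u) = u.
  by apply: val_inj; apply: winvK.
by rewrite -{1}inv2 free2_mulV.
Qed.

HB.instance Definition _ := isGroup.Build free2
  free2_mulA free2_mul1 free2_mulr1 free2_mulV free2_mulVr.

Definition free2_x : free2 := @Free2 [:: (false, false)] isT.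
Definition free2_y : free2 := @Free2 [:: (true, false)] isT.

Section Eval.
Variables (T : groupType) (g h : T).

Definition eval_letter (a : letter) : T :=
  let z := if a.1 then h else g in if a.2 then z^-1 else z.

Definition eval (w : free2) : T := \prod_(a <- word w) eval_letter a.

Lemma eval_letterV a : eval_letter (linv a) = (eval_letter a)^-1.
Proof. by case: a => a [] //=; rewrite /eval_letter /= invgK. Qed.

Lemma evalM : {morph eval : u v / u * v}.
Proof.
move=> [u ru] [v rv]; rewrite /eval /= /concat.
elim: u {ru} => [|a u IHu] /=; first by rewrite big_nil mul1g.
rewrite big_cons -mulgA -IHu.
case: (foldr _ _ u) => [|b w] /=; first by rewrite big_seq1 big_nil mulg1.
case: eqP => [->|_]; last by rewrite big_cons.
by rewrite big_cons eval_letterV mulKg.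
Qed.

Lemma eval_x : eval free2_x = g. Proof. by rewrite /eval big_seq1. Qed.
Lemma eval_y : eval free2_y = h. Proof. by rewrite /eval big_seq1. Qed.

End Eval.

Lemma gmorph1 (S T : groupType) (f : S -> T) :
  {morph f : u v / u * v} -> f 1 = 1.
Proof. by move=> fM; apply: (@mulgI _ (f 1)); rewrite -fM !mulg1. Qed.

Lemma gmorphV (S T : groupType) (f : S -> T) :
  {morph f : u v / u * v} -> {morph f : u / u^-1}.
Proof.
move=> fM u; apply: (@mulgI _ (f u)).
by rewrite -fM !mulgV (gmorph1 fM).
Qed.

Lemma free2_cons a w (r : reduced (a :: w)) :
  Free2 r = eval_letter free2_x free2_y a * Free2 (reduced_behead r).
Proof.
apply: val_inj; case: w r => [|b w] r; first by case: a r => [[] []] r.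
have /= /andP[/negbTE ab _] := r.
by case: a ab r => [[] []] ab r; rewrite /= -[in RHS]/(linv _) /= ab.
Qed.

Lemma eval_unique (T : groupType) (f : free2 -> T) :
  {morph f : u v / u * v} -> f =1 eval (f free2_x) (f free2_y).
Proof.
move=> fM [w]; elim: w => [|a w IHw] r.
  by rewrite /eval big_nil -(gmorph1 fM); congr f; apply: val_inj.
rewrite free2_cons fM evalM IHw; congr (_ * _).
by case: a r => [[] []] r; rewrite /eval_letter /= ?(gmorphV fM)
  ?(gmorphV (@evalM _ _ _)) ?eval_x ?eval_y.
Qed.

(* groupType includes infinite groups, for which the library has neither normal
   subgroups nor quotients. *)
Record normal_subgroup (F : groupType) := NormalSubgroup {
  nsub :> {pred F};
  nsub_group : group_closed nsub;
  nsub_conj : forall u v : F, u \in nsub -> u ^ v \in nsub }.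

Section Quotient.
Variables (F : groupType) (N : normal_subgroup F).

Definition coset_rel : rel F := fun u v => u^-1 * v \in nsub N.

Lemma coset_rel_refl : reflexive coset_rel.
Proof. by move=> u; rewrite /coset_rel mulVg; case: (nsub_group N). Qed.

Lemma coset_rel_sym : symmetric coset_rel.
Proof.
have NV := group_closedV (nsub_group N).
by move=> u v; apply/idP/idP => /NV; rewrite invgM invgK.
Qed.

Lemma coset_rel_trans : transitive coset_rel.
Proof.
have NM := group_closedM (nsub_group N).
by move=> v u w uv vw; rewrite /coset_rel -(mulVKg v w) mulgA; apply: NM.
Qed.

Canonical coset_equiv :=
  EquivRel coset_rel coset_rel_refl coset_rel_sym coset_rel_trans.

Definition quo : Type := {eq_quot coset_rel}.

HB.instance Definition _ := Choice.on quo.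
HB.instance Definition _ := EqQuotient.on quo.

Definition quo_pi (u : F) : quo := \pi_quo u.

Lemma quo_piP u v : reflect (quo_pi u = quo_pi v) (u^-1 * v \in nsub N).
Proof. exact: eqmodP. Qed.

Lemma quo_piK (q : quo) : quo_pi (repr q) = q.
Proof. exact: reprK. Qed.

Definition quo_one : quo := quo_pi 1.
Definition quo_mul (p q : quo) : quo := quo_pi (repr p * repr q).
Definition quo_inv (p : quo) : quo := quo_pi (repr p)^-1.

Lemma quo_piM_sub u v : quo_pi (u * v) = quo_mul (quo_pi u) (quo_pi v).
Proof.
have NM := group_closedM (nsub_group N).
have /quo_piP Nu : quo_pi u = quo_pi (repr (quo_pi u)) by rewrite quo_piK.
have /quo_piP Nv : quo_pi v = quo_pi (repr (quo_pi v)) by rewrite quo_piK.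
apply/quo_piP; set u' := repr _; set v' := repr _.
have -> : (u * v)^-1 * (u' * v') = (u^-1 * u') ^ v * (v^-1 * v').
  by rewrite conjgE invgM -!mulgA mulVKg.
by apply: NM => //; apply: nsub_conj.
Qed.

Lemma quo_piV_sub u : quo_pi u^-1 = quo_inv (quo_pi u).
Proof.
have /quo_piP Nu : quo_pi (repr (quo_pi u)) = quo_pi u by rewrite quo_piK.
apply/quo_piP; set u' := repr _.
by have := nsub_conj u^-1 Nu; rewrite conjgE mulgK.
Qed.

Lemma quo_mulA : associative quo_mul.
Proof.
move=> p q r; rewrite -(quo_piK p) -(quo_piK q) -(quo_piK r).
by rewrite -!quo_piM_sub mulgA.
Qed.

Lemma quo_mul1 : left_id quo_one quo_mul.
Proof. by move=> p; rewrite -(quo_piK p) -quo_piM_sub mul1g. Qed.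

Lemma quo_mulr1 : right_id quo_one quo_mul.
Proof. by move=> p; rewrite -(quo_piK p) -quo_piM_sub mulg1. Qed.

Lemma quo_mulV : left_inverse quo_one quo_inv quo_mul.
Proof.
by move=> p; rewrite -(quo_piK p) -quo_piV_sub -quo_piM_sub mulVg.
Qed.

Lemma quo_mulVr : right_inverse quo_one quo_inv quo_mul.
Proof.
by move=> p; rewrite -(quo_piK p) -quo_piV_sub -quo_piM_sub mulgV.
Qed.

HB.instance Definition _ := isGroup.Build quo
  quo_mulA quo_mul1 quo_mulr1 quo_mulV quo_mulVr.

Lemma quo_piM : {morph quo_pi : u v / u * v}.
Proof. exact: quo_piM_sub. Qed.

End Quotient.

Definition isomorphic_to (Q : groupType) (gT : finGroupType) (G : {group gT}) :
    Prop :=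
  exists f : Q -> gT, [/\ {morph f : p q / p * q}, injective f
                        & forall g, g \in G <-> exists q, f q = g].

Section Kernel.
Variables (gT : finGroupType) (G : {group gT}).

(* Membership in N must be boolean; asbool reflects the quantification over
   all normal subgroups classically. *)
Definition NG_pred : {pred free2} := fun w =>
  `[< forall N : normal_subgroup free2, isomorphic_to (quo N) G ->
        w \in nsub N >].

Lemma NG_group : group_closed NG_pred.
Proof.
split; first by apply/asboolP => N _; case: (nsub_group N).
move=> u v /asboolP NGu /asboolP NGv; apply/asboolP => N isoN.
by case: (nsub_group N) => _; apply; [apply: NGu | apply: NGv].
Qed.

Lemma NG_conj u v : u \in NG_pred -> u ^ v \in NG_pred.
Proof.
by move=> /asboolP NGu; apply/asboolP => N isoN; apply/nsub_conj/NGu.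
Qed.

Definition NG : normal_subgroup free2 := NormalSubgroup NG_group NG_conj.

Definition Gbar : Type := quo NG.

HB.instance Definition _ := Group.on Gbar.

Definition barpi (w : free2) : Gbar := quo_pi NG w.

Lemma barpiM : {morph barpi : u v / u * v}.
Proof. exact: quo_piM. Qed.

Definition bar_repr (q : Gbar) : free2 := repr (q : quo NG).

Lemma barpiK q : barpi (bar_repr q) = q.
Proof. exact: quo_piK. Qed.

(* Embedding in a finite power of G, to get finiteness. *)
Definition bar_embed (q : Gbar) : {ffun gT * gT -> gT} :=
  [ffun gh => if <<[set gh.1; gh.2]>>%G == G
              then eval gh.1 gh.2 (bar_repr q) else 1].

Lemma eval_mem (g h : gT) w : eval g h w \in <<[set g; h]>>.
Proof.
rewrite /eval; apply: group_prod => -[[] []] _; rewrite /eval_letter /=;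
  by rewrite ?groupV mem_gen // !inE eqxx ?orbT.
Qed.

Lemma bar_embed_inj : injective bar_embed.
Proof.
move=> p q /ffunP epq; rewrite -(barpiK p) -(barpiK q); apply/quo_piP.
apply/asboolP => N [f [fM f_inj fG]]; apply/quo_piP/f_inj.
pose fN w := f (quo_pi N w).
have fNM : {morph fN : u v / u * v} by move=> u v; rewrite /fN quo_piM fM.
have genG : <<[set fN free2_x; fN free2_y]>>%G == G.
  rewrite -val_eqE /= eqEsubset gen_subG; apply/andP; split.
    by apply/subsetP => g /set2P[->|->]; apply/fG; [exists (quo_pi N free2_x)
      | exists (quo_pi N free2_y)].
  apply/subsetP => g /fG[r <-]; rewrite -(quo_piK r) -/(fN _).
  by rewrite (eval_unique fNM) eval_mem.
have := epq (fN free2_x, fN free2_y); rewrite !ffunE /= genG.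
by rewrite -!(eval_unique fNM).
Qed.

Definition bar_unembed (e : {ffun gT * gT -> gT}) : option Gbar :=
  if pselect (exists q, bar_embed q = e) is left ex then Some (projT1 (cid ex))
  else None.

Lemma bar_embedK : pcancel bar_embed bar_unembed.
Proof.
move=> q; rewrite /bar_unembed; case: pselect => [ex|]; last by case; exists q.
by congr Some; apply: bar_embed_inj; case: cid.
Qed.

HB.instance Definition _ : isCountable Gbar := PCanIsCountable bar_embedK.
HB.instance Definition _ : isFinite Gbar := PCanIsFinite bar_embedK.

Definition bar_x : Gbar := barpi free2_x.
Definition bar_y : Gbar := barpi free2_y.

End Kernel.

(* N_G is characteristic, so automorphisms of the free group descend to Gbar. *)
Section Descent.
Variables (f f' : free2 -> free2).
Hypotheses (fM : {morph f : u v / u * v}) (fK : cancel f' f).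

Section Preim.
Variable N : normal_subgroup free2.

Definition preim_pred : {pred free2} := fun w => f w \in nsub N.

Lemma preimE u : (u \in preim_pred) = (f u \in nsub N).
Proof. by []. Qed.

Lemma preim_group : group_closed preim_pred.
Proof.
split; first by rewrite preimE (gmorph1 fM); case: (nsub_group N).
move=> u v; rewrite !preimE fM (gmorphV fM).
by case: (nsub_group N) => _; apply.
Qed.

Lemma preim_conj u v : u \in preim_pred -> u ^ v \in preim_pred.
Proof.
rewrite !preimE !conjgE !fM (gmorphV fM) -!conjgE; exact: nsub_conj.
Qed.

Definition preim_nsub := NormalSubgroup preim_group preim_conj.

Lemma preim_iso (gT : finGroupType) (G : {group gT}) :
  isomorphic_to (quo N) G -> isomorphic_to (quo preim_nsub) G.
Proof.
case=> k [kM k_inj kG].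
pose j (q : quo preim_nsub) := quo_pi N (f (repr q)).
have jE u : j (quo_pi preim_nsub u) = quo_pi N (f u).
  apply/quo_piP; rewrite -(gmorphV fM) -fM.
  have /quo_piP // : quo_pi preim_nsub (repr (quo_pi preim_nsub u)) =
    quo_pi preim_nsub u by rewrite quo_piK.
exists (k \o j); split.
- move=> p q; rewrite -(quo_piK p) -(quo_piK q) -quo_piM /= !jE fM.
  by rewrite quo_piM kM.
- move=> p q /k_inj; rewrite -(quo_piK p) -(quo_piK q) !jE => /quo_piP.
  by rewrite -(gmorphV fM) -fM => Npq; apply/quo_piP.
- move=> g; rewrite kG; split=> [[q <-]|[q <-]]; last by exists (j q).
  by exists (quo_pi preim_nsub (f' (repr q))); rewrite /= jE fK quo_piK.
Qed.

End Preim.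

Variables (gT : finGroupType) (G : {group gT}).

Definition descend (q : Gbar G) : Gbar G := barpi G (f (bar_repr q)).

Lemma descend_pi w : descend (barpi G w) = barpi G (f w).
Proof.
apply/quo_piP; rewrite -(gmorphV fM) -fM; apply/asboolP => N isoN.
have /quo_piP/asboolP : barpi G (bar_repr (barpi G w)) = barpi G w.
  by rewrite barpiK.
by move/(_ (preim_nsub N)); apply; apply: preim_iso.
Qed.

Lemma descend_inj : injective descend.
Proof.
have surj q : exists p, descend p == q.
  by exists (barpi G (f' (bar_repr q))); rewrite descend_pi fK barpiK.
pose s q := xchoose (surj q).
have sK : cancel s descend by move=> q; apply/eqP/(xchooseP (surj q)).
exact: can_inj (canF_sym sK).
Qed.

Definition descend_perm : {perm Gbar G} := perm descend_inj.

Lemma descend_permE w : descend_perm (barpi G w) = barpi G (f w).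
Proof. by rewrite permE descend_pi. Qed.

Lemma descend_Aut : descend_perm \in Aut [set: Gbar G].
Proof.
rewrite inE; apply/andP; split; first by apply/subsetP => q; rewrite inE.
apply/morphicP => p q _ _; rewrite -(barpiK p) -(barpiK q) -barpiM.
by rewrite !descend_permE fM barpiM.
Qed.

End Descent.

Definition theta_free : free2 -> free2 := eval free2_y free2_x.

Definition delta_free : free2 -> free2 :=
  eval (free2_y^-1 * free2_x^-1) free2_y.

Definition delta_free_inv : free2 -> free2 :=
  eval (free2_x^-1 * free2_y^-1) free2_y.

Lemma free2_endo_id (f : free2 -> free2) : {morph f : u v / u * v} ->
  f free2_x = free2_x -> f free2_y = free2_y -> f =1 id.
Proof.
move=> fM fx fy w; rewrite (eval_unique fM) fx fy.
by rewrite -(@eval_unique _ id).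
Qed.

Lemma theta_freeK : cancel theta_free theta_free.
Proof.
apply: (@free2_endo_id (theta_free \o theta_free)) => [u v||] /=;
  by rewrite /theta_free ?evalM ?eval_x ?eval_y ?eval_x.
Qed.

Lemma delta_freeK : cancel delta_free_inv delta_free.
Proof.
apply: (@free2_endo_id (delta_free \o delta_free_inv)) => [u v||] /=;
  rewrite /delta_free /delta_free_inv ?evalM ?eval_x ?eval_y ?eval_y //.
rewrite evalM !(gmorphV (@evalM _ _ _)) eval_x eval_y.
by rewrite invgM !invgK mulgK.
Qed.

Definition Inn (gT : finGroupType) (G : {group gT}) : {group {perm gT}} :=
  (conj_aut G @* G)%G.

Definition Out (gT : finGroupType) (G : {group gT}) :
  {group coset_of (Inn G)} := (Aut G / Inn G)%G.

Lemma Aut_norm_Inn (gT : finGroupType) (G : {group gT}) :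
  Aut G \subset 'N(Inn G).
Proof.
apply/subsetP => phi AutGphi; rewrite inE; apply/subsetP => _ /imsetP[c Ic ->].
have /morphimP[u _ Gu ->] := Ic.
have phi_im g : g \in G -> phi g \in G by move=> Gg; rewrite Aut_closed.
have -> : conj_aut G u ^ phi = conj_aut G (phi u).
  apply: (@eq_Aut _ G).
  - by rewrite groupJ // (subsetP (Aut_conj_aut G G)) // mem_morphim
      ?(subsetP (normG G)).
  - by rewrite (subsetP (Aut_conj_aut G G)) // mem_morphim
      ?(subsetP (normG G)) ?phi_im.
  move=> g Gg.
  have Gg' : phi^-1 g \in G by rewrite Aut_closed ?groupV.
  rewrite conjgE !permM !conj_autE ?phi_im //.
  have := morphJ (autm_morphism AutGphi) Gg' Gu.
  by rewrite /= !autmE permKV.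
by rewrite mem_morphim ?(subsetP (normG G)) ?phi_im.
Qed.

Section GT1.
Variables (gT : finGroupType) (G : {group gT}).

Local Notation A := (Aut [set: Gbar G]).
Local Notation I := (Inn [set: Gbar G]%G).

Definition theta : {perm Gbar G} :=
  descend_perm (@evalM _ _ _) theta_freeK G.
Definition delta : {perm Gbar G} :=
  descend_perm (@evalM _ _ _) delta_freeK G.

Lemma theta_Aut : theta \in A. Proof. exact: descend_Aut. Qed.
Lemma theta_x : theta (bar_x G) = bar_y G.
Proof. by rewrite descend_permE eval_x. Qed.
Lemma theta_y : theta (bar_y G) = bar_x G.
Proof. by rewrite descend_permE eval_y. Qed.

Lemma delta_Aut : delta \in A. Proof. exact: descend_Aut. Qed.
Lemma delta_x : delta (bar_x G) = (bar_y G)^-1 * (bar_x G)^-1.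
Proof.
by rewrite descend_permE eval_x barpiM !(gmorphV (@barpiM _ _)).
Qed.
Lemma delta_y : delta (bar_y G) = bar_y G.
Proof. by rewrite descend_permE eval_y. Qed.

Definition GT1_aut : {set {perm Gbar G}} :=
  [set phi in A | [&& phi (bar_x G) \in bar_x G ^: [set: Gbar G],
     coset I phi * coset I theta == coset I theta * coset I phi
   & coset I phi * coset I delta == coset I delta * coset I phi]].

Lemma GT1_aut_group : group_set GT1_aut.
Proof.
have NI := subsetP (Aut_norm_Inn [set: Gbar G]%G).
apply/group_setP; split=> [|phi psi].
  by rewrite inE group1 perm1 class_refl !morph1 !mulg1 !mul1g !eqxx.
case/setIdP=> Aphi /and3P[/imsetP[u _ phix] /eqP phit /eqP phid].
case/setIdP=> Apsi /and3P[/imsetP[v _ psix] /eqP psit /eqP psid].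
apply/setIdP; split; first exact: groupM.
rewrite morphM ?NI //.
rewrite -!mulgA psit psid !mulgA phit phid !eqxx !andbT permM phix.
have := morphJ (autm_morphism Apsi) (in_setT (bar_x G)) (in_setT u).
by rewrite /= !autmE => ->; rewrite psix -conjgM memJ_class ?inE.
Qed.

Canonical GT1_aut_gp := Group GT1_aut_group.

Definition GT1 : {group coset_of I} := (GT1_aut / I)%G.

Lemma GT1_sub_Out : GT1 \subset Out [set: Gbar G]%G.
Proof. by apply: quotientS; apply/subsetP => phi; rewrite inE => /andP[]. Qed.

End GT1.

Definition SL2 (F : finFieldType) : {set {'GL_2[F]}} :=
  [set u | (\det (GLval u) == 1)%R].

Lemma SL2_group (F : finFieldType) : group_set (SL2 F).
Proof.
apply/group_setP; split=> [|u v]; first by rewrite inE GL_1E det1.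
by rewrite !inE GL_ME => /eqP u1 /eqP v1; rewrite det_mulmx u1 v1 GRing.mulr1.
Qed.

Canonical SL2_gp (F : finFieldType) := Group (SL2_group F).

Definition PSL2 (F : finFieldType) : {group coset_of 'Z(SL2 F)} :=
  (SL2 F / 'Z(SL2 F))%G.

(* 'Z_2 carries the additive group law. *)
Definition C2D8 (a b : nat) : finGroupType :=
  ({dffun forall _ : 'I_a, 'Z_2} * {dffun forall _ : 'I_b, 'D_8})%type.

(* Main.v *)
(* For a nonabelian simple group G, a Goursat argument makes Gbar a power of G
   whose factors are the Aut G-orbits of generating pairs. Hence Out(Gbar) is the
   group of permutations of the G-classes of generating pairs that commute with
   Aut G, and GT1 G consists of those that moreover commute with the moves
   (x, y) |-> (y, x), (x, y) |-> (y^-1 x^-1, y) and preserve the class of x.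

   For G = PSL2(F), generating pairs are determined up to PGL2(F) by the traces
   of lifts of x, y, x y, which such a permutation preserves up to sign. In even
   characteristic PGL2 = PSL2, so that GT1 G = 1. In odd characteristic the classes
   come in twos exchanged by diag(nonsquare, 1), and an ambiguity of signs makes the
   fibres of the classes (x, y, x y) have up to four elements; GT1 G acts on
   a fibre with four elements through two independent shifts or through a dihedral
   group of order 8. The count is made by checking tables of generating pairs. *)

(* Only certificates are trusted: the search that produces tables and labels is plain code, and
   [check_table] and [check_labels] are proved sound. No classification of the subgroups of PSL2
   enters. A triple of traces is accepted as generating when words in the pair take values in one
   group of transvections, with parameters spanning the field; it is rejected when the pair is
   reducible or stabilizes a finite set that misses an element. Nor is Aut G known beforehand: an
   automorphism is determined by the image of one generating pair, and relations single out the
   possible images. The commuting permutations are bounded from above by invariants, since such a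
   permutation preserves which words in the moves fix a point; they are bounded from below by an
   explicit action of [C2D8 a b]. The group D8 enters as the centralizer of a fixed-point-free
   involution on four points; where the moves induce all the shifts of a fibre, only these shifts
   commute with them. *)
Require Import Defs.
From Stdlib Require List.
From Stdlib Require Import NArith FMapPositive.
From HB Require Import structures.
From mathcomp Require Import all_boot all_order all_algebra all_fingroup.
From mathcomp Require Import all_solvable all_field generic_quotient boolp.
From mathcomp Require Import ring zify.
Set Implicit Arguments.
Unset Strict Implicit.
Unset Printing Implicit Defensive.
Import GRing.Theory.

(** * Generating pairs and automorphisms of the relatively free group *)

Local Open Scope group_scope.

Section Evaluation.
Variables (gT : finGroupType) (G : {group gT}).
Implicit Types (e f : gT * gT) (q : Gbar G) (phi : {perm Gbar G}).

Definition generating e := <<[set e.1; e.2]>> == G.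

Definition pconj e (g : gT) := (e.1 ^ g, e.2 ^ g).

Definition paut (a : gT -> gT) e := (a e.1, a e.2).

Lemma eval_generates e g :
  g \in <<[set e.1; e.2]>> -> exists w, eval e.1 e.2 w = g.
Proof.
pose A := [set g | `[< exists w, eval e.1 e.2 w = g >]].
have gA : group_set A.
  apply/group_setP; split; first by rewrite inE; apply/asboolP; exists 1;
    rewrite (gmorph1 (@evalM _ _ _)).
  move=> a b; rewrite !inE => /asboolP[u <-] /asboolP[v <-].
  by apply/asboolP; exists (u * v); rewrite evalM.
have sA : <<[set e.1; e.2]>> \subset Group gA.
  rewrite gen_subG; apply/subsetP => a /set2P[] ->; rewrite inE; apply/asboolP.
    by exists free2_x; rewrite eval_x.
  by exists free2_y; rewrite eval_y.
by move/(subsetP sA); rewrite inE => /asboolP.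
Qed.

Lemma generating_mem e : generating e -> (e.1 \in G) * (e.2 \in G).
Proof. by move=> /eqP <-; split; rewrite mem_gen // !inE eqxx ?orbT. Qed.

Section Kernel.
Variable e : gT * gT.

Definition evker_pred : {pred free2} := fun w => eval e.1 e.2 w == 1.

Lemma evkerE w : (w \in evker_pred) = (eval e.1 e.2 w == 1).
Proof. by []. Qed.

Lemma evker_group : group_closed evker_pred.
Proof.
split; first by rewrite evkerE (gmorph1 (@evalM _ _ _)).
move=> u v; rewrite !evkerE evalM (gmorphV (@evalM _ _ _)) => /eqP-> /eqP->.
by rewrite mul1g invg1.
Qed.

Lemma evker_conj u v : u \in evker_pred -> u ^ v \in evker_pred.
Proof.
rewrite !evkerE conjgE !evalM (gmorphV (@evalM _ _ _)) => /eqP->.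
by rewrite mul1g mulVg.
Qed.

Definition evker := NormalSubgroup evker_group evker_conj.

(** So the kernel is one of the subgroups intersected in N_G, and evaluation at a generating pair
    factors through [Gbar G]. *)
Lemma evker_quo : generating e -> isomorphic_to (quo evker) G.
Proof.
move=> ge; pose k (q : quo evker) := eval e.1 e.2 (repr q).
have kE u : k (quo_pi evker u) = eval e.1 e.2 u.
  have /quo_piP : quo_pi evker (repr (quo_pi evker u)) = quo_pi evker u.
    by rewrite quo_piK.
  rewrite evkerE evalM (gmorphV (@evalM _ _ _)) -eq_mulVg1; exact/eqP.
exists k; split.
- by move=> p q; rewrite -(quo_piK p) -(quo_piK q) -quo_piM !kE evalM.
- move=> p q; rewrite -(quo_piK p) -(quo_piK q) !kE => epq; apply/quo_piP.
  by rewrite evkerE evalM (gmorphV (@evalM _ _ _)) epq mulVg.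
- move=> g; rewrite -(eqP ge); split=> [/eval_generates[w <-]|[q <-]].
    by exists (quo_pi evker w).
  exact: eval_mem.
Qed.

End Kernel.

(** Generating pairs stand for the surjections of [Gbar G] onto G; for them the value does not
    depend on the representative. *)
Definition ev e q : gT := eval e.1 e.2 (bar_repr q).

Lemma ev_pi e w : generating e -> ev e (barpi G w) = eval e.1 e.2 w.
Proof.
move=> ge; have /quo_piP/asboolP : barpi G (bar_repr (barpi G w)) = barpi G w.
  by rewrite barpiK.
move/(_ (evker e) (evker_quo ge)).
rewrite evkerE evalM (gmorphV (@evalM _ _ _)) -eq_mulVg1; exact/eqP.
Qed.

Lemma evM e : generating e -> {morph ev e : p q / p * q}.
Proof.
by move=> ge p q; rewrite -(barpiK p) -(barpiK q) -barpiM !ev_pi // evalM.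
Qed.

Lemma ev1 e : generating e -> ev e 1 = 1.
Proof. by move=> ge; apply: gmorph1 (evM ge). Qed.

Lemma evV e q : generating e -> ev e q^-1 = (ev e q)^-1.
Proof. by move=> ge; apply: gmorphV (evM ge) q. Qed.

Lemma evJ e p q : generating e -> ev e (p ^ q) = ev e p ^ ev e q.
Proof. by move=> ge; rewrite !conjgE !evM ?evV. Qed.

Lemma ev_x e : generating e -> ev e (bar_x G) = e.1.
Proof. by move=> ge; rewrite ev_pi ?eval_x. Qed.

Lemma ev_y e : generating e -> ev e (bar_y G) = e.2.
Proof. by move=> ge; rewrite ev_pi ?eval_y. Qed.

Lemma ev_mem e q : generating e -> ev e q \in G.
Proof. by move=> /eqP <-; apply: eval_mem. Qed.

Lemma ev_surj e g : generating e -> g \in G -> exists q, ev e q = g.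
Proof.
move=> ge; rewrite -(eqP ge) => /eval_generates[w <-].
by exists (barpi G w); rewrite ev_pi.
Qed.

Lemma ev_inj p q : (forall e, generating e -> ev e p = ev e q) -> p = q.
Proof.
move=> epq; apply: bar_embed_inj; apply/ffunP => e; rewrite !ffunE.
by case: ifP => // ge; apply: epq.
Qed.

Lemma ev_unique e (k : Gbar G -> gT) : generating e ->
  {morph k : p q / p * q} -> k (bar_x G) = e.1 -> k (bar_y G) = e.2 ->
  k =1 ev e.
Proof.
move=> ge kM kx ky q; rewrite -(barpiK q) ev_pi // -kx -ky.
pose j w := k (barpi G w); rewrite -[LHS]/(j _) (@eval_unique _ j) //.
by move=> u v; rewrite /j barpiM kM.
Qed.

Lemma generating_ev e (k : Gbar G -> gT) : {morph k : p q / p * q} ->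
  k @: setT =i G -> k (bar_x G) = e.1 -> k (bar_y G) = e.2 -> generating e.
Proof.
move=> kM kG kx ky; rewrite /generating eqEsubset gen_subG; apply/andP; split.
  by apply/subsetP => g /set2P[] ->; rewrite -?kx -?ky -kG imset_f.
apply/subsetP => g; rewrite -kG => /imsetP[q _ ->]; rewrite -(barpiK q).
pose j w := k (barpi G w); rewrite -[k _]/(j _) (@eval_unique _ j).
  by rewrite /j kx ky eval_mem.
by move=> u v; rewrite /j barpiM kM.
Qed.

Lemma ev_im e : generating e -> ev e @: setT =i G.
Proof.
move=> ge g; apply/imsetP/idP => [[q _ ->]|/(ev_surj ge)[q <-]].
  exact: ev_mem.
by exists q.
Qed.

Lemma gbar_autM phi : phi \in Aut [set: Gbar G] -> {morph phi : p q / p * q}.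
Proof.
by move=> Aphi p q; have := morphM (autm_morphism Aphi) (in_setT p) (in_setT q).
Qed.

Lemma autGM a : a \in Aut G -> {in G &, {morph a : g h / g * h}}.
Proof. by move=> Aa g h Gg Gh; have := morphM (autm_morphism Aa) Gg Gh. Qed.

Lemma autG_im a : a \in Aut G -> a @: G = G.
Proof. by move=> Aa; have := im_autm Aa; rewrite morphimEdom. Qed.

(** Precomposition: this is the pair that belongs to the surjection [ev e \o phi]. *)
Definition pull phi e := (ev e (phi (bar_x G)), ev e (phi (bar_y G))).

Lemma pull_generating phi e :
  phi \in Aut [set: Gbar G] -> generating e -> generating (pull phi e).
Proof.
move=> Aphi ge; apply: (@generating_ev _ (ev e \o phi)) => //.
  by move=> p q; rewrite /= gbar_autM // evM.
move=> g; rewrite -(ev_im ge); apply/imsetP/imsetP => -[q _ ->].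
  by exists (phi q).
by exists (phi^-1 q); rewrite //= permKV.
Qed.

Lemma ev_pull phi e q : phi \in Aut [set: Gbar G] -> generating e ->
  ev (pull phi e) q = ev e (phi q).
Proof.
move=> Aphi ge; apply/esym/(@ev_unique (pull phi e) (ev e \o phi)) => //.
  exact: pull_generating.
by move=> p r; rewrite /= gbar_autM // evM.
Qed.

Lemma paut_generating a e : a \in Aut G -> generating e ->
  generating (paut a e).
Proof.
move=> Aa ge; apply: (@generating_ev _ (a \o ev e)); rewrite /= ?ev_x ?ev_y //.
  by move=> p q; rewrite /= evM // autGM ?ev_mem.
move=> g; rewrite -[in RHS](autG_im Aa); apply/imsetP/imsetP => -[q].
  by move=> _ ->; exists (ev e q); rewrite ?ev_mem.
by move=> /(ev_surj ge)[r <-] ->; exists r.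
Qed.

Lemma ev_paut a e q : a \in Aut G -> generating e ->
  ev (paut a e) q = a (ev e q).
Proof.
move=> Aa ge; apply/esym/(@ev_unique _ (a \o ev e)); rewrite /= ?ev_x ?ev_y //.
  exact: paut_generating.
by move=> p r; rewrite /= evM // autGM ?ev_mem.
Qed.

Lemma pconj_paut e g : generating e -> g \in G ->
  pconj e g = paut (conj_aut G g) e.
Proof.
move=> ge Gg; have [G1 G2] := generating_mem ge.
by rewrite /paut !conj_autE.
Qed.

Lemma conj_aut_Aut g : g \in G -> conj_aut G g \in Aut G.
Proof.
move=> Gg; apply: (subsetP (Aut_conj_aut G G)); apply: mem_morphim => //.
exact: (subsetP (normG G)).
Qed.

Lemma pconj_generating e g : generating e -> g \in G ->
  generating (pconj e g).
Proof.
by move=> ge Gg; rewrite pconj_paut // paut_generating ?conj_aut_Aut.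
Qed.

Lemma ev_pconj e g q : generating e -> g \in G ->
  ev (pconj e g) q = ev e q ^ g.
Proof.
move=> ge Gg; rewrite pconj_paut // ev_paut ?conj_aut_Aut //.
by rewrite conj_autE ?ev_mem.
Qed.

Lemma pull_paut phi a e : phi \in Aut [set: Gbar G] -> a \in Aut G ->
  generating e -> pull phi (paut a e) = paut a (pull phi e).
Proof. by move=> Aphi Aa ge; rewrite /pull !ev_paut. Qed.

Lemma pull_pconj phi e g : phi \in Aut [set: Gbar G] -> g \in G ->
  generating e -> pull phi (pconj e g) = pconj (pull phi e) g.
Proof. by move=> Aphi Gg ge; rewrite /pull !ev_pconj. Qed.

Lemma pullM phi psi e : phi \in Aut [set: Gbar G] ->
  psi \in Aut [set: Gbar G] -> generating e ->
  pull (phi * psi) e = pull phi (pull psi e).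
Proof. by move=> Aphi Apsi ge; rewrite /pull !permM !(@ev_pull psi). Qed.

Lemma pconjM e g h : pconj e (g * h) = pconj (pconj e g) h.
Proof. by rewrite /pconj !conjgM. Qed.

Lemma pconj1 e : pconj e 1 = e.
Proof. by case: e => a b; rewrite /pconj !conjg1. Qed.

Lemma pconjK g : cancel (pconj ^~ g) (pconj ^~ g^-1).
Proof. by move=> e; rewrite -pconjM mulgV pconj1. Qed.

Lemma paut_pconj a e g : a \in Aut G -> generating e -> g \in G ->
  paut a (pconj e g) = pconj (paut a e) (a g).
Proof.
move=> Aa ge Gg; have [G1 G2] := generating_mem ge.
by have aJ := morphJ (autm_morphism Aa); rewrite /paut /pconj -!aJ.
Qed.

End Evaluation.

(* A Goursat argument: generating pairs that are inequivalent under Aut G have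
   incomparable kernels, so Gbar surjects onto the corresponding power of G. *)
Section Goursat.
Variables (gT : finGroupType) (G : {group gT}).
Hypotheses (simpleG : simple G) (nabG : ~~ abelian G).
Implicit Types (e f : gT * gT) (q : Gbar G).

Definition auteq e f := [exists a in Aut G, paut a e == f].

Lemma auteqP e f : reflect (exists2 a, a \in Aut G & paut a e = f) (auteq e f).
Proof. by apply: (iffP exists_inP) => -[a Aa /eqP]; exists a => //; apply/eqP. Qed.

Lemma auteq_refl e : auteq e e.
Proof.
by apply/auteqP; exists 1; rewrite ?group1 // /paut !perm1; case: e.
Qed.

Lemma auteq_sym e f : auteq e f -> auteq f e.
Proof.
case/auteqP=> a Aa <-; apply/auteqP; exists a^-1; first by rewrite groupV.
by rewrite /paut !permK; case: e.
Qed.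

Lemma auteq_trans e f h : auteq e f -> auteq f h -> auteq e h.
Proof.
case/auteqP=> a Aa <- /auteqP[b Ab <-]; apply/auteqP; exists (a * b).
  exact: groupM.
by rewrite /paut !permM.
Qed.

(** [ev e] factors through [ev f] by an endomorphism of G, which is onto and hence, G being finite,
    an automorphism. *)
Lemma evker_auteq e f : generating G e -> generating G f ->
  (forall q, ev f q = 1 -> ev e q = 1) -> auteq f e.
Proof.
move=> ge gf fe.
pose me := Morphism (in2W (evM ge) : {in [set: Gbar G] &, {morph ev e : p q / p * q}}).
pose mf := Morphism (in2W (evM gf) : {in [set: Gbar G] &, {morph ev f : p q / p * q}}).
have sK : 'ker mf \subset 'ker me.
  apply/subsetP => q /morphpreP[_ /set1P Kq].
  by apply/morphpreP; split; rewrite ?inE //= fe.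
pose k := factm sK (subxx _).
have kE q : k (ev f q) = ev e q by apply: (factmE sK); rewrite inE.
have imf : mf @* setT = G by apply/setP => g; rewrite morphimEdom ev_im.
have ime : me @* setT = G by apply/setP => g; rewrite morphimEdom ev_im.
have kM : {in G &, {morph k : g h / g * h}}.
  move=> g h /(ev_surj gf)[p <-] /(ev_surj gf)[q <-].
  by rewrite -evM // !kE evM.
pose mk := Morphism kM.
have imk : mk @* G = G.
  apply/setP => g; rewrite morphimEdom -[in RHS](ev_im ge).
  apply/imsetP/imsetP => -[h].
    by move/(ev_surj gf)=> [q <-] ->; exists q; rewrite ?kE.
  by move=> _ ->; exists (ev f h); rewrite ?ev_mem ?kE.
have injk : 'injm mk by rewrite -card_im_injm imk.
apply/auteqP; exists (aut injk imk); first exact: Aut_aut.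
have [G1 G2] := generating_mem gf.
rewrite /paut !autE //= -(ev_x gf) -(ev_y gf) !kE ev_x ?ev_y //.
by case: (e).
Qed.

Lemma center_simple1 : 'Z(G) = 1.
Proof.
have /simpleP[_ /(_ 'Z(G)%G (center_normal G))[]] // := simpleG.
by move=> ZG; case/negP: nabG; rewrite -ZG center_abelian.
Qed.

(** The values at [e] of the elements killed by [f :: s] form a normal subgroup N. If N were
    trivial, take [q0] killed by [f] and [q] killed by [s]: their commutator is killed by both, so
    [ev e q0] would commute with every [ev e q], hence be central and trivial. *)
Lemma goursat_one e (s : seq (gT * gT)) : generating G e ->
  (forall f, f \in s -> generating G f /\ ~~ auteq f e) ->
  forall g, g \in G ->
  exists q, ev e q = g /\ forall f, f \in s -> ev f q = 1.
Proof.
move=> ge; elim: s => [_ g /(ev_surj ge)[q <-]|f s IHs fs]; first by exists q.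
have {}IHs : forall g, g \in G ->
    exists q, ev e q = g /\ forall f, f \in s -> ev f q = 1.
  by apply: IHs => h sh; apply: fs; rewrite inE sh orbT.
have [gf nfe] := fs f (mem_head f s).
have gs h : h \in f :: s -> generating G h by case/fs.
pose N := [set g in G | `[< exists q, ev e q = g /\
                           forall h, h \in f :: s -> ev h q = 1 >]].
have gN : group_set N.
  apply/group_setP; split.
    rewrite inE group1; apply/asboolP; exists 1; split; first exact: ev1.
    by move=> h /gs/ev1.
  move=> a b /setIdP[Ga /asboolP[p [<- p1]]] /setIdP[Gb /asboolP[q [<- q1]]].
  rewrite inE groupM ?ev_mem //; apply/asboolP; exists (p * q).
  by split; [rewrite evM | move=> h sh; rewrite evM ?gs // p1 ?q1 ?mulg1].
have nN : Group gN <| G.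
  apply/andP; split; first by apply/subsetP => g /setIdP[].
  apply/subsetP => g Gg; rewrite inE; apply/subsetP => _ /imsetP[a Na ->].
  have /setIdP[Ga /asboolP[p [<- p1]]] := Na.
  have [r <-] := ev_surj ge Gg.
  rewrite inE groupJ ?ev_mem //; apply/asboolP; exists (p ^ r).
  by split; [rewrite evJ | move=> h sh; rewrite evJ ?gs // p1 ?conj1g].
have /simpleP[_ /(_ _ nN)[N1|NG]] := simpleG; last first.
  move=> g Gg; have : g \in Group gN by rewrite NG.
  by case/setIdP=> _ /asboolP.
(* Otherwise the kernels would be nested and [evker_auteq] would make the pairs equivalent. *)
have [q0 [fq0 eq0]] : exists q : Gbar G, ev f q = 1 /\ ev e q != 1.
  apply: contrapT => nq; case/negP: nfe; apply: (evker_auteq ge gf) => q fq.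
  by apply/eqP/negPn/negP => eq; apply: nq; exists q.
case/negP: eq0; apply/eqP/set1P; suff : ev e q0 \in 'Z(G) by rewrite center_simple1.
apply/centerP; split=> [|g Gg]; first exact: ev_mem.
have [q [eq sq]] := IHs g Gg; apply/commgP/eqP/set1P.
suff : [~ ev e q0, g] \in Group gN by rewrite N1.
rewrite inE; apply/andP; split; first by rewrite groupR ?ev_mem.
apply/asboolP; exists [~ q0, q]; split; first by rewrite !commgEl evM ?evV ?evJ ?eq.
move=> h; rewrite inE => /predU1P[->|sh].
  by rewrite commgEl evM // evV // evJ // fq0 conj1g invg1 mulg1.
by rewrite commgEr evM ?gs ?inE ?sh ?orbT // evJ ?evV ?gs ?inE ?sh ?orbT //
  sq // invg1 conj1g mulg1.
Qed.

(** [pick] depends only on the set it searches, so equivalent generating pairs get the same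
    representative. *)
Definition orbit_rep e := odflt e [pick f | generating G f && auteq e f].

Lemma orbit_repP e : generating G e ->
  generating G (orbit_rep e) /\ auteq e (orbit_rep e).
Proof.
move=> ge; rewrite /orbit_rep; case: pickP => [f /andP[]|/(_ e)] //=.
by rewrite ge auteq_refl.
Qed.

Lemma orbit_rep_eq e f : generating G e -> auteq e f ->
  orbit_rep e = orbit_rep f.
Proof.
move=> ge ef; rewrite /orbit_rep.
have E : (fun h => generating G h && auteq e h) =1
         (fun h => generating G h && auteq f h).
  move=> h; congr (_ && _); apply/idP/idP; last exact: auteq_trans.
  by apply: auteq_trans; apply: auteq_sym.
rewrite -(eq_pick E); case: pickP => //= /(_ e).
by rewrite ge auteq_refl.
Qed.

Definition is_rep e := generating G e && (orbit_rep e == e).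

Lemma orbit_rep_is_rep e : generating G e -> is_rep (orbit_rep e).
Proof.
move=> ge; have [gr er] := orbit_repP ge.
by rewrite /is_rep gr -(orbit_rep_eq ge er) eqxx.
Qed.

Lemma goursat (c : gT * gT -> gT) : (forall e, c e \in G) ->
  exists q : Gbar G, forall e, is_rep e -> ev e q = c e.
Proof.
move=> Gc.
suff [q Hq] : exists q : Gbar G, forall e, e \in enum is_rep -> ev e q = c e.
  by exists q => e re; apply: Hq; rewrite mem_enum.
have : forall e, e \in enum is_rep -> is_rep e by move=> e; rewrite mem_enum.
elim: (enum _) (enum_uniq is_rep) => [|e s IHs] /=; first by exists 1.
case/andP=> nse /IHs{}IHs rs.
have re h : h \in s -> is_rep h by move=> sh; apply: rs; rewrite inE sh orbT.
have [p Hp] := IHs re.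
have /andP[ge /eqP ee] := rs e (mem_head _ _).
(* The factor [r] corrects the value at [e] and is invisible to the pairs already treated. *)
have [f sf||r [er sr]] := goursat_one (s := s) ge _ (g := (ev e p)^-1 * c e).
- have /andP[gf /eqP ff] := re f sf; split=> //; apply/negP => fe.
  by case/negP: nse; rewrite -ee -(orbit_rep_eq gf fe) ff.
- by rewrite groupM ?groupV ?ev_mem.
exists (p * r) => f; rewrite inE => /predU1P[->|sf].
  by rewrite evM // er mulKVg.
by have /andP[gf _] := re f sf; rewrite evM // sr // mulg1 Hp.
Qed.

Lemma goursat_inj (p q : Gbar G) :
  (forall e, is_rep e -> ev e p = ev e q) -> p = q.
Proof.
move=> epq; apply: ev_inj => e ge.
have [gr /auteqP[a Aa ea]] := orbit_repP ge.
apply: (@perm_inj _ a); rewrite -!(ev_paut _ Aa ge) ea.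
exact/epq/orbit_rep_is_rep.
Qed.

End Goursat.

Section CentralizingPerms.
Variables (X : finType) (C : eqType) (gens : seq (X -> X)) (col : X -> C).

Definition equivariant_perms : {set {perm X}} :=
  [set s : {perm X} | all (fun t => [forall x, s (t x) == t (s x)]) gens
           && [forall x, col (s x) == col x]].

Lemma equivariant_permsP (s : {perm X}) :
  reflect ((forall t, List.In t gens -> forall x, s (t x) = t (s x)) /\
           (forall x, col (s x) = col x)) (s \in equivariant_perms).
Proof.
rewrite inE; apply: (iffP andP) => -[H K]; split.
- move=> t; elim: gens H => //= u l IHl /andP[/forallP Hu /IHl{}IHl] [<-|//] x.
  exact/eqP.
- by move=> x; apply/eqP/(forallP K).
- elim: gens H => //= u l IHl H; apply/andP; split.
    by apply/forallP => x; apply/eqP/H; left.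
  by apply: IHl => t lt; apply: H; right.
- by apply/forallP => x; apply/eqP.
Qed.

Lemma equivariant_perms_group : group_set equivariant_perms.
Proof.
apply/group_setP; split.
  by apply/equivariant_permsP; split=> [t _|] x; rewrite !perm1.
move=> s u /equivariant_permsP[Hs Ks] /equivariant_permsP[Hu Ku].
apply/equivariant_permsP; split=> [t lt|] x; rewrite !permM.
  by rewrite (Hs t) // (Hu t).
by rewrite Ku Ks.
Qed.

Canonical equivariant_perms_gp := Group equivariant_perms_group.

End CentralizingPerms.

(** * Automorphisms modulo inner ones, seen on generating pairs *)

Section Pullback.
Variables (gT : finGroupType) (G : {group gT}).
Implicit Types (e f : gT * gT) (phi : {perm Gbar G}).

Definition gconj e f := exists2 g, g \in G & f = pconj e g.

Lemma gconj_refl e : gconj e e.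
Proof. by exists 1; rewrite ?group1 ?pconj1. Qed.

Lemma gconj_sym e f : gconj e f -> gconj f e.
Proof. by case=> g Gg ->; exists g^-1; rewrite ?groupV ?pconjK. Qed.

Lemma gconj_trans e f h : gconj e f -> gconj f h -> gconj e h.
Proof.
by case=> g Gg -> [k Gk ->]; exists (g * k); rewrite ?groupM ?pconjM.
Qed.

Lemma gconj_generating e f : gconj e f -> generating G e -> generating G f.
Proof. by case=> g Gg -> ge; apply: pconj_generating. Qed.

Lemma gconj_paut a e f : a \in Aut G -> generating G e -> gconj e f ->
  gconj (paut a e) (paut a f).
Proof.
move=> Aa ge [g Gg ->]; exists (a g); first by rewrite Aut_closed.
exact: (paut_pconj Aa ge Gg).
Qed.

Lemma gconj_pull phi e f : phi \in Aut [set: Gbar G] -> generating G e ->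
  gconj e f -> gconj (pull phi e) (pull phi f).
Proof. by move=> Aphi ge [g Gg ->]; exists g; rewrite ?pull_pconj. Qed.

Lemma pull1 e : generating G e -> pull (1 : {perm Gbar G}) e = e.
Proof. by move=> ge; rewrite /pull !perm1 ev_x ?ev_y //; case: (e). Qed.

Lemma gconj_pull_inv phi e f : phi \in Aut [set: Gbar G] ->
  generating G e -> generating G f -> gconj (pull phi e) (pull phi f) ->
  gconj e f.
Proof.
move=> Aphi ge gf /(gconj_pull (groupVr Aphi) (pull_generating Aphi ge)).
by rewrite -!pullM ?groupV // mulVg !pull1.
Qed.

Lemma pull_theta e : generating G e -> pull (theta G) e = (e.2, e.1).
Proof. by move=> ge; rewrite /pull theta_x theta_y ev_x ?ev_y. Qed.

Lemma pull_delta e : generating G e ->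
  pull (delta G) e = (e.2^-1 * e.1^-1, e.2).
Proof.
by move=> ge; rewrite /pull delta_x delta_y evM // !evV // ev_x ?ev_y.
Qed.

Lemma pull_conj_aut e q : generating G e ->
  pull (conj_aut [set: Gbar G] q) e = pconj e (ev e q).
Proof.
by move=> ge; rewrite /pull !conj_autE ?inE // !evJ // ev_x ?ev_y.
Qed.

Lemma Inn_sub_Aut : Inn [set: Gbar G]%G \subset Aut [set: Gbar G].
Proof. exact: Aut_conj_aut. Qed.

Lemma InnP phi : phi \in Inn [set: Gbar G]%G ->
  exists q, phi = conj_aut [set: Gbar G] q.
Proof. by case/morphimP=> q _ _ ->; exists q. Qed.

Lemma mem_Inn q : conj_aut [set: Gbar G] q \in Inn [set: Gbar G]%G.
Proof. by rewrite mem_morphim ?(subsetP (normG _)) ?inE. Qed.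

Hypotheses (simpleG : simple G) (nabG : ~~ abelian G).

(** The conjugating elements at the orbit representatives are independent coordinates, so [goursat]
    assembles them into one element of [Gbar G] that induces [phi]. *)
Lemma Inn_pull phi : phi \in Aut [set: Gbar G] ->
  (forall e, generating G e -> gconj e (pull phi e)) ->
  phi \in Inn [set: Gbar G]%G.
Proof.
move=> Aphi Hphi.
have /choice[c Hc] (e : gT * gT) : exists g, g \in G /\
    (generating G e -> pull phi e = pconj e g).
  have [ge|/negP nge] := boolP (generating G e).
    by have [g Gg ->] := Hphi e ge; exists g.
  by exists 1; rewrite group1.
have [q Hq] := goursat simpleG nabG (fun e => (Hc e).1).
suff -> : phi = conj_aut [set: Gbar G] q by apply: mem_Inn.
apply/permP => p; rewrite conj_autE ?inE //; apply: goursat_inj => e re.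
have /andP[ge _] := re.
by rewrite evJ // (Hq e re) -ev_pull // (Hc e).2 // ev_pconj // (Hc e).1.
Qed.

Lemma pull_Inn phi e : phi \in Inn [set: Gbar G]%G -> generating G e ->
  gconj e (pull phi e).
Proof.
by case/InnP=> q -> ge; rewrite pull_conj_aut //; exists (ev e q); rewrite ?ev_mem.
Qed.

(** The argument of [Inn_pull] for the first coordinate alone. *)
Lemma bar_x_conj phi : phi \in Aut [set: Gbar G] ->
  (forall e, generating G e -> (pull phi e).1 \in e.1 ^: G) ->
  phi (bar_x G) \in bar_x G ^: [set: Gbar G].
Proof.
move=> Aphi Hphi.
have /choice[c Hc] (e : gT * gT) : exists g, g \in G /\
    (generating G e -> (pull phi e).1 = e.1 ^ g).
  have [ge|/negP nge] := boolP (generating G e).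
    by have /imsetP[g Gg ->] := Hphi e ge; exists g.
  by exists 1; rewrite group1.
have [q Hq] := goursat simpleG nabG (fun e => (Hc e).1).
apply/imsetP; exists q; rewrite ?inE //; apply: goursat_inj => e re.
have /andP[ge _] := re.
by rewrite evJ // (Hq e re) ev_x // -(Hc e).2.
Qed.

Lemma bar_x_pull phi e : phi (bar_x G) \in bar_x G ^: [set: Gbar G] ->
  generating G e -> (pull phi e).1 \in e.1 ^: G.
Proof.
case/imsetP=> q _ phix ge; rewrite /pull /= phix evJ // ev_x //.
by apply: imset_f; apply: ev_mem.
Qed.

(* The automorphism is built on the representatives of the Aut G-orbits and
   forced elsewhere by equivariance. *)
Lemma lift_pull (S : gT * gT -> gT * gT) :
  (forall e, generating G e -> generating G (S e)) ->
  (forall e, generating G e -> exists2 f, generating G f & gconj (S f) e) ->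
  (forall a e, a \in Aut G -> generating G e ->
     gconj (S (paut a e)) (paut a (S e))) ->
  exists2 phi, phi \in Aut [set: Gbar G] &
    forall e, generating G e -> gconj (S e) (pull phi e).
Proof.
move=> Sg Ss SA.
(* Elsewhere the value 1 only keeps the functions inside G, as [goursat] demands. *)
pose c1 e := if generating G e then (S e).1 else 1.
pose c2 e := if generating G e then (S e).2 else 1.
have Gc1 e : c1 e \in G.
  by rewrite /c1; case: ifP => // /Sg/generating_mem[].
have Gc2 e : c2 e \in G.
  by rewrite /c2; case: ifP => // /Sg/generating_mem[].
have [ux Hx] := goursat simpleG nabG Gc1.
have [uy Hy] := goursat simpleG nabG Gc2.
pose k w := eval ux uy w.
have ek e w : is_rep G e -> ev e (k w) = eval (S e).1 (S e).2 w.
  move=> re; have /andP[ge _] := re.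
  rewrite (@eval_unique _ (fun w => ev e (k w))) => [|u v]; last first.
    by rewrite /k evalM evM.
  by rewrite /k eval_x eval_y Hx // Hy // /c1 /c2 ge.
(* At a representative [k] evaluates words at the generating pair [S e], which factors through
   [Gbar G]; representatives separate points. *)
have kE u v : barpi G u = barpi G v -> k u = k v.
  move=> uv; apply: goursat_inj => e re; have /andP[/Sg gSe _] := re.
  by rewrite !ek // -!(ev_pi _ gSe) uv.
pose h (q : Gbar G) := k (bar_repr q).
have hE w : h (barpi G w) = k w by apply: kE; rewrite barpiK.
have hM : {in [set: Gbar G] &, {morph h : p q / p * q}}.
  move=> p q _ _; rewrite -(barpiK p) -(barpiK q) -barpiM !hE.
  exact: evalM.
have evh e q : is_rep G e -> ev e (h q) = ev (S e) q.
  move=> re; have /andP[/Sg gSe _] := re.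
  by rewrite -(barpiK q) hE ek // ev_pi.
pose mh := Morphism hM.
(* By [Ss] every generating pair is conjugate to some [S f], and [f] is equivalent to a
   representative; so an element killed by all [S r] dies under every evaluation. *)
have injh : 'injm mh.
  apply/subsetP => q /morphpreP[_ /set1P /= hq]; apply/set1P; apply: ev_inj => e ge.
  have [f gf [g Gg ->]] := Ss e ge.
  have [gr /auteqP[a Aa fa]] := orbit_repP gf.
  have rr := orbit_rep_is_rep gf; set r := orbit_rep G f in gr fa rr.
  have Sr : ev (S r) q = 1 by rewrite -evh // hq ev1.
  have gSf := Sg f gf; have gSr := Sg r gr.
  suff Sf : ev (S f) q = 1 by rewrite ev_pconj // Sf conj1g ev1 ?pconj_generating.
  apply: (@perm_inj _ a); rewrite -(ev_paut _ Aa gSf) -[in RHS](ev1 gSf).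
  rewrite -(ev_paut _ Aa gSf) [in RHS]ev1 ?paut_generating //.
  have [b Gb ->] := SA a f Aa gf.
  by rewrite fa ev_pconj // Sr conj1g.
have imh : mh @* [set: Gbar G] = [set: Gbar G].
  apply/eqP; rewrite -subTset -(geq_leqif (subset_leqif_card _)) ?subsetT //.
  by rewrite card_injm ?subxx.
exists (aut injh imh) => [|e ge]; first exact: Aut_aut.
have Aphi : aut injh imh \in Aut [set: Gbar G] by apply: Aut_aut.
have [gr /auteqP[a Aa ea]] := orbit_repP ge.
have rr := orbit_rep_is_rep ge; set r := orbit_rep G e in gr ea rr.
have pr : pull (aut injh imh) r = S r.
  have gSr := Sg r gr.
  by rewrite /pull !autE ?inE //= !evh // ev_x // ev_y //; case: (S r).
have AV : a^-1 \in Aut G by rewrite groupV.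
have er : e = paut a^-1 r by rewrite -ea /paut !permK; case: (e).
rewrite er pull_paut // pr; apply: SA => //.
Qed.

End Pullback.

(** * GT1 as a group of permutations of conjugacy classes of pairs *)

Section GT1Perms.
Variables (gT : finGroupType) (G : {group gT}).
Hypotheses (simpleG : simple G) (nabG : ~~ abelian G).
Variables (I : finType) (C : eqType) (rep : I -> gT * gT).
Variables (th de : I -> I) (auts : seq (I -> I)) (col : I -> C).
(** Two hypotheses concern Aut G: [table_aut] makes automorphisms of [Gbar G] commute with the
    listed maps, and [aut_table] lets a permutation commuting with the listed maps be lifted by
    [lift_pull]. *)
Hypotheses (rep_gen : forall i, generating G (rep i))
  (rep_ex : forall e, generating G e -> exists i, gconj G (rep i) e)
  (rep_uniq : forall i j, gconj G (rep i) (rep j) -> i = j)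
  (rep_th : forall i, gconj G (rep (th i)) ((rep i).2, (rep i).1))
  (rep_de : forall i,
     gconj G (rep (de i)) ((rep i).2^-1 * (rep i).1^-1, (rep i).2))
  (aut_table : forall a, a \in Aut G -> exists2 t, List.In t auts &
     forall i, gconj G (rep (t i)) (paut a (rep i)))
  (table_aut : forall t, List.In t auts -> exists2 a, a \in Aut G &
     forall i, gconj G (rep (t i)) (paut a (rep i)))
  (colE : forall i j, (col i == col j) = ((rep j).1 \in (rep i).1 ^: G)).

Local Notation A := (Aut [set: Gbar G]).
Local Notation J := (Inn [set: Gbar G]%G).
Local Notation K := (equivariant_perms [:: th, de & auts] col).

(** The defaults here and in [idx_perm] only make the functions total; for an automorphism both
    searches succeed. *)
Let idx i (phi : {perm Gbar G}) : I :=
  odflt i [pick j | `[< gconj G (rep j) (pull phi (rep i)) >]].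

Let idxP i phi : phi \in A -> gconj G (rep (idx i phi)) (pull phi (rep i)).
Proof.
move=> Aphi; rewrite /idx; case: pickP => [j /asboolP //|none].
have [j Hj] := rep_ex (pull_generating Aphi (rep_gen i)).
by have /asboolP := none j.
Qed.

Let idx_eq i j phi : phi \in A -> gconj G (rep j) (pull phi (rep i)) ->
  idx i phi = j.
Proof.
move=> Aphi ji; apply: rep_uniq; apply: gconj_trans (idxP i Aphi) _.
exact: gconj_sym.
Qed.

Let idx_inj phi : phi \in A -> injective (idx ^~ phi).
Proof.
move=> Aphi i j /= eij; apply: rep_uniq.
apply: (gconj_pull_inv Aphi) => //; apply: gconj_trans (idxP j Aphi).
by rewrite -eij; apply/gconj_sym/idxP.
Qed.

Let idx_perm phi : {perm I} :=
  odflt 1 [pick s : {perm I} | [forall i, s i == idx i phi]].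

Let idx_permE phi i : phi \in A -> idx_perm phi i = idx i phi.
Proof.
move=> Aphi; rewrite /idx_perm; case: pickP => [s /forallP/(_ i)/eqP //|].
move/(_ (perm (idx_inj Aphi)))/forallP; case=> j.
by rewrite permE.
Qed.

(** Precomposition reverses products of permutations; the inverse restores the order. *)
Let idx_permM : {in A &, {morph (fun phi => (idx_perm phi)^-1) : p q / p * q}}.
Proof.
move=> p q Ap Aq; rewrite -invgM; congr _^-1; apply/permP => i.
rewrite permM !idx_permE ?groupM //; apply: idx_eq; first exact: groupM.
rewrite pullM //; apply: gconj_trans (idxP _ Ap) _.
exact: gconj_pull (idxP _ Aq).
Qed.

Let fm := Morphism idx_permM.

Let ker_fm : 'ker fm = J.
Proof.
apply/setP => phi; apply/idP/idP => [/morphpreP[/= Aphi /set1P]|Jphi].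
  move/eqP; rewrite eq_invg1 => /eqP P1.
  apply: Inn_pull => // e /rep_ex[i ie]; apply: gconj_trans (gconj_sym ie) _.
  apply: gconj_trans (gconj_pull Aphi (rep_gen i) ie).
  by have := idxP i Aphi; rewrite -idx_permE // P1 perm1.
have Aphi := subsetP (Inn_sub_Aut G) _ Jphi.
apply/morphpreP; split=> //; apply/set1P/eqP; rewrite eq_invg1; apply/eqP.
apply/permP => i; rewrite idx_permE // perm1; apply: idx_eq => //.
exact: pull_Inn.
Qed.

Let coset_eq phi psi : phi \in A -> psi \in A ->
  (coset J phi == coset J psi) = (fm phi == fm psi).
Proof.
move=> Ap Aq; have NJ := subsetP (Aut_norm_Inn [set: Gbar G]%G).
have AV : psi^-1 \in A by rewrite groupV.
rewrite eq_mulgV1 -morphV ?NJ // -morphM ?NJ // [RHS]eq_mulgV1 -morphV //.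
rewrite -morphM //; set c := phi * _.
have Ac : c \in A by rewrite groupM.
apply/eqP/eqP => [/(coset_idr (NJ _ Ac))|]; first by rewrite -ker_fm => /mker.
by move=> c1; apply: coset_id; rewrite -ker_fm; apply/kerP.
Qed.

Let idx_perm_pull phi f : phi \in A ->
  (forall i, gconj G (rep (f i)) (pull phi (rep i))) -> idx_perm phi =1 f.
Proof. by move=> Aphi Hf i; rewrite idx_permE //; apply: idx_eq. Qed.

Let comm_fm phi psi f : phi \in A -> psi \in A ->
  (forall i, gconj G (rep (f i)) (pull psi (rep i))) ->
  (coset J phi * coset J psi == coset J psi * coset J phi) =
  [forall i, idx_perm phi (f i) == f (idx_perm phi i)].
Proof.
move=> Ap Aq Hf; have NJ := subsetP (Aut_norm_Inn [set: Gbar G]%G).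
rewrite -!morphM ?NJ // coset_eq ?groupM // !morphM //= -!invgM.
rewrite (inj_eq invg_inj); have Pf := idx_perm_pull Aq Hf.
apply/eqP/forallP => [/permP H i|H].
  by have := H i; rewrite !permM !Pf => ->.
by apply/permP => i; rewrite !permM !Pf; apply/eqP.
Qed.

(** Commutation with the maps in [auts] is automatic because [pull] commutes with [paut]; the
    conditions on theta and delta become commutation with [th] and [de], and the one on x becomes
    preservation of [col]. *)
Let fm_GT1 phi : phi \in A -> (phi \in GT1_aut G) = (idx_perm phi \in K).
Proof.
move=> Aphi; rewrite inE Aphi /=.
rewrite (comm_fm (f := th) Aphi (theta_Aut G)); last first.
  by move=> i; rewrite pull_theta.
rewrite (comm_fm (f := de) Aphi (delta_Aut G)); last first.
  by move=> i; rewrite pull_delta.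
have colP i : (pull phi (rep i)).1 \in (rep i).1 ^: G =
              (col (idx_perm phi i) == col i).
  rewrite idx_permE // eq_sym colE.
  have [g Gg ->] := idxP i Aphi; rewrite /pconj /=.
  by rewrite (@class_transl _ _ _ _ _ (memJ_class _ Gg)).
apply/and3P/equivariant_permsP => [[phix /forallP Hth /forallP Hde]|[H Hc]].
  split=> [t|i]; last by apply/eqP; rewrite -colP bar_x_pull.
  case=> [<-|[<-|/table_aut[a Aa Ha]]] i; try exact/eqP.
  rewrite !idx_permE //; apply: idx_eq => //.
  have gt := rep_gen (t i); have gi := rep_gen i.
  apply: gconj_trans (gconj_pull Aphi _ (gconj_sym (Ha i))); last first.
    exact: paut_generating.
  rewrite pull_paut //; apply: gconj_trans (Ha _) _.
  exact: gconj_paut (idxP i Aphi).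
split; try by apply/forallP => i; apply/eqP/H; do ?[by left | right].
apply: bar_x_conj => // e /rep_ex[i ie].
have := gconj_pull Aphi (rep_gen i) ie; case: ie => g Gg -> [h Gh ->].
rewrite /= classGidl // (@class_transl _ _ _ _ _ (memJ_class _ Gh)).
by rewrite colP Hc.
Qed.

(** The permutation moves each generating pair to the representative of the image class, a map that
    is equivariant up to conjugacy; [lift_pull] applies. *)
Let K_lift s : s \in K -> exists2 phi, phi \in A & idx_perm phi = s.
Proof.
case/equivariant_permsP => Hs Hc.
pose S e := if [pick i | `[< gconj G (rep i) e >]] is Some i then rep (s i)
            else e.
have SP e : generating G e -> exists2 i, gconj G (rep i) e & S e = rep (s i).
  move=> ge; rewrite /S; case: pickP => [i /asboolP ie|none]; first by exists i.
  by have [i ie] := rep_ex ge; have /asboolP := none i.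
have SE i e : gconj G (rep i) e -> S e = rep (s i).
  move=> ie; have [j je ->] := SP _ (gconj_generating ie (rep_gen i)).
  by rewrite (rep_uniq (gconj_trans je (gconj_sym ie))).
have [|e ge|a e Aa ge|phi Aphi Hphi] := @lift_pull _ _ simpleG nabG S.
- by move=> e /SP[i _ ->].
- have [i ie] := rep_ex ge; exists (rep (s^-1 i)) => //.
  by rewrite (SE (s^-1 i)) ?permKV //; apply: gconj_refl.
- have [t lt Ht] := aut_table Aa; have [i ie] := rep_ex ge.
  rewrite (SE _ _ ie) (SE (t i)); last first.
    exact: gconj_trans (Ht i) (gconj_paut Aa (rep_gen i) ie).
  by rewrite Hs //; right; right.
exists phi => //; apply/permP => i; rewrite idx_permE //; apply: idx_eq => //.
by rewrite -(SE i _ (gconj_refl _ _)); apply: Hphi.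
Qed.

Theorem GT1_isog_perms : GT1 G \isog K.
Proof.
have sA : GT1_aut_gp G \subset A by apply/subsetP => phi /setIdP[].
have sJ : J \subset GT1_aut G.
  apply/subsetP => phi Jphi; have Aphi := subsetP (Inn_sub_Aut G) _ Jphi.
  rewrite fm_GT1 //; have P1 : fm phi = 1 by apply: mker; rewrite ker_fm.
  by move/eqP: P1; rewrite /= eq_invg1 => /eqP ->; apply: group1.
have imK : fm @* GT1_aut_gp G = K.
  apply/setP => s; apply/morphimP/idP => [[phi Aphi Gphi ->]|].
    by rewrite /= groupV -fm_GT1.
  move=> Ks; have /K_lift[phi Aphi Ps] : s^-1 \in K by rewrite groupV.
  exists phi => //; last by rewrite /= Ps invgK.
  by change (phi \in GT1_aut G); rewrite fm_GT1 // Ps groupV.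
have kJ : 'ker_(GT1_aut G) fm = J by rewrite ker_fm; apply/setIidPr.
have := first_isog_loc fm sA; by rewrite imK kJ.
Qed.
End GT1Perms.

(** * Centralizers as products of dihedral and cyclic groups *)

Definition corner := (bool * bool)%type.

Definition xorp (c p : corner) : corner := (c.1 (+) p.1, c.2 (+) p.2).

Lemma xorpK c : involutive (xorp c).
Proof. by case: c => -[] [] [[] []]. Qed.

Definition shift (c : corner) : {perm corner} := perm (inv_inj (xorpK c)).

Lemma shiftE c p : shift c p = xorp c p. Proof. exact: permE. Qed.

Lemma shiftM c d : shift (xorp c d) = shift c * shift d.
Proof.
by apply/permP => p; rewrite permM !shiftE; case: c d p => -[] [] [[] []] [[] []].
Qed.

(** The centralizer of a fixed-point-free involution on four points has at most eight elements and
    contains two involutions generating a dihedral group of order 8. *)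
Lemma square_symmetries : exists h : 'D_8 -> {perm corner},
  [/\ {morph h : x y / x * y}, injective h &
      forall t : {perm corner}, (exists x, h x = t) <->
      (forall p, t (xorp (true, false) p) = xorp (true, false) (t p))].
Proof.
pose C : {group {perm corner}} := 'C[shift (true, false)]%G.
have CP (t : {perm corner}) : reflect
    (forall p, t (xorp (true, false) p) = xorp (true, false) (t p)) (t \in C).
  apply: (iffP cent1P) => [/permP tC p|tC].
    by have := tC p; rewrite !permM !shiftE => ->.
  by apply/permP => p; rewrite !permM !shiftE tC.
pose cf (p : corner) := (p.1 (+) p.2, p.2).
have cfK : involutive cf by case=> -[] [].
pose a := shift (false, true); pose b := perm (inv_inj cfK).
have Ca : a \in C by apply/CP => p; rewrite !shiftE; case: p => -[] [].
have Cb : b \in C by apply/CP => p; rewrite !permE; case: p => -[] [].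
have inv2 (t : {perm corner}) : t != 1 -> involutive t -> #[t] = 2.
  move=> t1 tK; apply: nt_prime_order => //; apply/permP => p.
  by rewrite expgS expg1 permM tK perm1.
have oa : #[a] = 2.
  apply: inv2; last by move=> p; rewrite !shiftE xorpK.
  by apply/eqP => /permP/(_ (false, false)); rewrite shiftE perm1.
have ob : #[b] = 2.
  apply: inv2; last by move=> p; rewrite !permE cfK.
  by apply/eqP => /permP/(_ (false, true)); rewrite permE perm1.
have nab : a != b.
  by apply/eqP => /permP/(_ (false, false)); rewrite shiftE permE.
pose D := <<[set a; b]>>; have sDC : D \subset C.
  by rewrite gen_subG; apply/subsetP => t /set2P[] ->.
have cardC : (#|C| <= 8)%N.
  (* The image of one corner determines that of its partner; the other two corners go to the
     remaining pair, in one of two ways. *)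
  pose k (t : {perm corner}) := (t (false, false), (t (false, true)).1).
  have -> : 8 = #|{: corner * bool}| by rewrite !card_prod card_bool.
  apply: (@leq_card_in _ _ k) => t u /CP Ct /CP Cu [tu0 tu1].
  have snd (v : {perm corner}) :
      (forall p, v (xorp (true, false) p) = xorp (true, false) (v p)) ->
      (v (false, true)).2 = ~~ (v (false, false)).2.
    move=> Cv; have := Cv (false, false); rewrite /xorp /= => v10.
    have n0 : v (false, true) != v (false, false) by rewrite (inj_eq perm_inj).
    have n1 : v (false, true) != v (true, false) by rewrite (inj_eq perm_inj).
    move: n0 n1; rewrite v10.
    by case: (v (false, true)) (v (false, false)) => -[] [] [[] []].
  have tu2 : t (false, true) = u (false, true).
    rewrite [LHS]surjective_pairing [RHS]surjective_pairing.
    by rewrite tu1 !snd // tu0.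
  apply/permP => -[[] []]; rewrite -?tu0 //.
    by have := Ct (false, true); have := Cu (false, true); rewrite /xorp /= tu2 => -> ->.
  by have := Ct (false, false); have := Cu (false, false); rewrite /xorp /= tu0 => -> ->.
have [Da Db] : a \in D /\ b \in D by split; rewrite mem_gen // !inE eqxx ?orbT.
have order_ab : #[a * b] = 4.
  have : #[a * b] %| 4.
    rewrite order_dvdn; apply/eqP/permP => p.
    by rewrite !expgS expg0 mulg1 !permM !shiftE !permE; case: p => -[] [].
  have : ~~ (#[a * b] %| 2).
    rewrite order_dvdn; apply/eqP => /permP/(_ (false, false)).
    by rewrite !expgS expg0 mulg1 !permM !shiftE !permE.
  by case: #[_] => [|[|[|[|[|m]]]]] // _ /dvdn_leq-/(_ isT).
(* The order is a multiple of 4, at most 8, and five distinct elements are at hand. *)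
have cardD : #|D| = 8.
  have D4 : 4 %| #|D| by rewrite -order_ab; apply/order_dvdG/groupM.
  have D8 : (#|D| <= 8)%N := leq_trans (subset_leq_card sDC) cardC.
  have ne (t u : {perm corner}) p : t p != u p -> t != u.
    by apply: contraNneq => ->.
  have E := (permM, shiftE, permE, perm1).
  have : uniq [:: 1; a; b; a * b; b * a].
    rewrite /= !inE.
    rewrite (negbTE (ne (1%g : {perm corner}) a (false, false) _)) ?E //.
    rewrite (negbTE (ne (1%g : {perm corner}) b (false, true) _)) ?E //.
    rewrite (negbTE (ne (1%g : {perm corner}) (a * b) (false, false) _)) ?E //.
    rewrite (negbTE (ne (1%g : {perm corner}) (b * a) (false, false) _)) ?E //.
    rewrite (negbTE (ne a b (false, false) _)) ?E //.
    rewrite (negbTE (ne a (a * b) (false, false) _)) ?E //.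
    rewrite (negbTE (ne a (b * a) (false, true) _)) ?E //.
    rewrite (negbTE (ne b (a * b) (false, false) _)) ?E //.
    rewrite (negbTE (ne b (b * a) (false, false) _)) ?E //.
    rewrite (negbTE (ne (a * b) (b * a) (false, false) _)) ?E //.
  have sub : {subset [:: 1; a; b; a * b; b * a] <= enum D}.
    move=> t; rewrite mem_enum !inE.
    by case/or4P=> [|||/orP[]] /eqP->; rewrite ?groupM ?group1.
  move/uniq_leq_size/(_ sub).
  by rewrite -cardE; case/dvdnP: D4 D8 => -[|[|[|m]]] -> //.
have := involutions_gen_dihedral oa ob nab; rewrite -/D cardD isog_sym.
case/isogP => h injh imh; exists h; split.
- by move=> x y; rewrite morphM ?inE.
- by move=> x y; apply: (injmP injh); rewrite inE.
move=> t; split=> [[x <-]|/CP Ct].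
  have := mem_morphim h (in_setT x) (in_setT x).
  by rewrite imh => /(subsetP sDC)/CP.
have : t \in D by suff -> : D = C by []; apply/eqP; rewrite eqEcard sDC cardD.
by rewrite -[D]imh => /morphimP[x _ _ ->]; exists x.
Qed.

(* The shape of an orbit of the centralizer: a point, two points, a square on
   which it acts by two independent shifts, or a square on which it acts by
   all symmetries. The numbers name the factors of [C2D8 a b] in charge. *)
Inductive orbit_shape := Point | Pair of nat | Rect of nat & nat | Square of nat.

Definition vertex (l : orbit_shape) (p : corner) : bool :=
  match l with
  | Point => ~~ p.1 && ~~ p.2
  | Pair _ => ~~ p.2
  | _ => true
  end.

(** The shifts commuting with the group that acts on an orbit of this shape: all those of the orbit
    in the abelian cases, the centre of D8 on a square. *)
Definition central_shift (l : orbit_shape) (c : corner) : bool :=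
  vertex l c && (if l is Square _ then ~~ c.2 else true).

Section Labelling.
Variables (X : finType) (C : eqType) (gens : seq (X -> X)) (col : X -> C).
Variables (a b : nat).
Local Notation K := (equivariant_perms gens col).

Definition equivariant (t : X -> X) :=
  forall g, List.In g gens -> forall x, t (g x) = g (t x).

(** The double centralizer, which contains all words in the generators. Its elements transport what
    happens on one block to another. *)
Definition central (w : X -> X) :=
  forall t, equivariant t -> forall x, t (w x) = w (t x).

Variables (cl : X -> corner -> X) (pos : X -> corner) (loc : X -> orbit_shape).
Variables (base : X -> X) (c2 d8 : nat -> X).

(** [orbit_cl] confines the centralizer to the blocks, and the flips restrict it on base blocks to
    shifts or to D8. Conversely [gens_cl] makes the action of [C2D8 a b] on blocks equivariant.
    [base_reach] reduces everything to base blocks; [c2_loc], [d8_loc] and [loc_base] match these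
    with the factors. *)
Record labelling : Prop := Labelling {
  pos_vertex : forall x, vertex (loc x) (pos x);
  cl_pos : forall x, cl x (pos x) = x;
  pos_cl : forall x p, vertex (loc x) p -> pos (cl x p) = p;
  loc_cl : forall x p, vertex (loc x) p -> loc (cl x p) = loc x;
  cl_cl : forall x p q, vertex (loc x) p -> vertex (loc x) q ->
    cl (cl x p) q = cl x q;
  col_cl : forall x p, vertex (loc x) p -> col (cl x p) = col x;
  orbit_cl : forall s : {perm X}, s \in K ->
    forall x, exists2 p, vertex (loc x) p & s x = cl x p;
  gens_cl : forall g, List.In g gens -> forall x, loc (g x) = loc x /\
    exists2 c, central_shift (loc x) c &
      forall p, vertex (loc x) p -> g (cl x p) = cl (g x) (xorp c p);
  base_loc : forall x, loc (base x) = loc x;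
  base_reach : forall x, exists w p, [/\ central w, vertex (loc x) p
    & w (cl (base x) p) = x];
  square_flip : forall j, j < b -> exists2 w, central w &
    forall p, w (cl (d8 j) p) = cl (d8 j) (xorp (true, false) p);
  rect_flip : forall j, j < a -> if loc (c2 j) is Rect _ _ then
    forall c, exists2 w, central w &
      forall p, w (cl (c2 j) p) = cl (c2 j) (xorp c p) else True;
  c2_loc : forall j, j < a -> match loc (c2 j) with
    | Pair k => k = j | Rect k l => k = j \/ l = j | _ => False end;
  d8_loc : forall j, j < b -> loc (d8 j) = Square j;
  loc_base : forall x, match loc x with
    | Point => True
    | Pair j => j < a /\ base x = c2 j
    | Rect j k => [/\ j < a, k < a, j <> k, base x = c2 j & base x = c2 k]
    | Square j => j < b /\ base x = d8 j end }.

Hypothesis L : labelling.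

Let G := C2D8 a b.

Definition bit (f : G) (j : nat) : bool :=
  if insub j is Some k then odd (f.1 k : 'Z_2) else false.

Definition dih (f : G) (j : nat) : 'D_8 :=
  if insub j is Some k then f.2 k else 1.

Let bitM (f g : G) j : bit (f * g) j = bit f j (+) bit g j.
Proof.
rewrite /bit; case: insub => //= k; rewrite mulg_ffun.
by case: (f.1 k) (g.1 k) => -[|[|[]]] // ? [[|[|[]]]].
Qed.

Let dihM (f g : G) j : dih (f * g) j = dih f j * dih g j.
Proof.
rewrite /dih; case: insub => [k|]; last by rewrite mulg1.
by rewrite mulg_ffun.
Qed.

Section Action.
Variable h : 'D_8 -> {perm corner}.
Hypothesis hM : {morph h : x y / x * y}.
Hypothesis h_inj : injective h.
Hypothesis hP : forall t : {perm corner}, (exists x, h x = t) <->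
      (forall p, t (xorp (true, false) p) = xorp (true, false) (t p)).

Let move_vertex (f : G) (l : orbit_shape) : {perm corner} :=
  match l with
  | Point => 1
  | Pair j => shift (bit f j, false)
  | Rect j k => shift (bit f j, bit f k)
  | Square j => h (dih f j)
  end.

Let moveM f g l : move_vertex (f * g) l = move_vertex f l * move_vertex g l.
Proof.
case: l => [|j|j k|j] /=; rewrite ?mulg1 ?bitM -?shiftM ?dihM ?hM //.
Qed.

Let move_valid f l p : vertex l p -> vertex l (move_vertex f l p).
Proof.
by case: l => [|j|j k|j] //=; rewrite ?perm1 ?shiftE //=; case: p => -[] [].
Qed.

Let move_shift f l c p :
  central_shift l c ->
  move_vertex f l (xorp c p) = xorp c (move_vertex f l p).
Proof.
have S d : shift d (xorp c p) = xorp c (shift d p).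
  by rewrite !shiftE /xorp /= !addbA ![_ (+) c.1]addbC ![_ (+) c.2]addbC.
case: l => [|j|j k|j] /=; rewrite /central_shift ?perm1 //=.
have xor0 q : xorp (false, false) q = q by case: q.
case: c {S} => -[] [] //= _; last by rewrite !xor0.
have [] := hP (h (dih f j)) => + _; apply; by exists (dih f j).
Qed.

Let act f x := cl x (move_vertex f (loc x) (pos x)).

Let actM f g x : act (f * g) x = act g (act f x).
Proof.
have vx := move_valid f (pos_vertex L x).
rewrite /act (loc_cl L) // (pos_cl L) // (cl_cl L) //.
  by rewrite moveM permM.
exact: move_valid.
Qed.

Let move1 l : move_vertex 1 l = 1.
Proof. by apply: (mulgI (move_vertex 1 l)); rewrite -moveM !mulg1. Qed.

Let act1 x : act 1 x = x.
Proof. by rewrite /act move1 perm1 cl_pos. Qed.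

Let act_inj f : injective (act f).
Proof.
by apply: (can_inj (g := act f^-1)) => x; rewrite -actM mulgV act1.
Qed.

Let actp f := perm (@act_inj f).

Let actpM : {in [set: G] &, {morph actp : f g / f * g}}.
Proof. by move=> f g _ _; apply/permP => x; rewrite permM !permE actM. Qed.

Let act_equivariant f : equivariant (act f).
Proof.
move=> g lg x; have [lgx [c sc Hc]] := gens_cl L lg x.
have vx := pos_vertex L x; have /andP[vc _] := sc.
have -> : g (act f x) = cl (g x) (xorp c (move_vertex f (loc x) (pos x))).
  by rewrite /act Hc // move_valid.
have gx : g x = cl (g x) (xorp c (pos x)) by rewrite -Hc // cl_pos.
have vg : vertex (loc (g x)) (xorp c (pos x)).
  rewrite lgx; move: (pos x) vx vc => p; case: (loc x) => [|k|k l|k] //.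
    by case: c p {sc Hc gx} => -[] [] [[] []].
  by case: c p {sc Hc gx} => -[] [] [[] []].
have pg : pos (g x) = xorp c (pos x) by rewrite {1}gx (pos_cl L).
by rewrite /act pg lgx (move_shift f _ sc).
Qed.

Let actp_K f : actp f \in K.
Proof.
apply/equivariant_permsP; split=> [g lg|] x; rewrite !permE.
  exact: act_equivariant.
by rewrite /act (col_cl L) // move_valid // (pos_vertex L).
Qed.

Let mact := Morphism actpM.

Let inj_mact : 'injm mact.
Proof.
apply/subsetP => f /morphpreP[_ /set1P /permP f1]; apply/set1P.
have fix_vertex x p : vertex (loc x) p -> move_vertex f (loc x) p = p.
  move=> vp; have := f1 (cl x p); rewrite permE perm1 /act.
  rewrite (loc_cl L) // (pos_cl L) // (cl_cl L) ?move_valid // => e.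
  by have := congr1 pos e; rewrite !(pos_cl L) ?move_valid.
have bit0 j : j < a -> bit f j = false.
  move=> ja; have := c2_loc L ja; have := fix_vertex (c2 j) (false, false).
  case: (loc (c2 j)) => //= [k|k l]; rewrite shiftE => /(_ isT)[]; rewrite !addbF.
    by move=> <- ->.
  by move=> fk fl [] <-.
have dih1 j : j < b -> dih f j = 1.
  move=> jb; have := fix_vertex (d8 j); rewrite (d8_loc L jb) /= => hj.
  apply: h_inj; transitivity (1 : {perm corner}).
    by apply/permP => p; rewrite hj ?perm1.
  by apply: (mulgI (h 1)); rewrite -hM !mulg1.
rewrite [f]surjective_pairing; congr pair; apply/ffunP => j.
  rewrite oneg_ffun; have := bit0 j (ltn_ord j); rewrite /bit valK.
  by case: (f.1 j) => -[|[|[]]] // i _; apply: val_inj.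
by rewrite oneg_ffun; have := dih1 j (ltn_ord j); rewrite /dih valK.
Qed.

Let im_mact : mact @* [set: G] = K.
Proof.
apply/eqP; rewrite eqEsubset; apply/andP; split.
  by apply/subsetP => _ /morphimP[f _ _ ->]; apply: actp_K.
apply/subsetP => s Ks; have [sE sC] := equivariant_permsP _ _ _ Ks.
(* This is [s] on the block of [x], in coordinates. *)
pose t x p := pos (s (cl x p)).
have st x p : vertex (loc x) p -> vertex (loc x) (t x p) /\ s (cl x p) = cl x (t x p).
  move=> vp; have [q] := orbit_cl L Ks (cl x p).
  rewrite (loc_cl L) // => vq e; rewrite /t e (cl_cl L) // (pos_cl L) //.
have t_inj x p q : vertex (loc x) p -> vertex (loc x) q -> t x p = t x q -> p = q.
  move=> vp vq e; have [_ ep] := st x p vp; have [_ eq] := st x q vq.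
  have /perm_inj/(congr1 pos) : s (cl x p) = s (cl x q) by rewrite ep eq e.
  by rewrite !(pos_cl L).
have t_central x c w : central w -> vertex (loc x) c ->
    (forall p, vertex (loc x) p -> vertex (loc x) (xorp c p)) ->
    (forall p, w (cl x p) = cl x (xorp c p)) ->
    forall p, vertex (loc x) p -> t x (xorp c p) = xorp c (t x p).
  move=> cw vc vcp Hw p vp; have [vt e] := st x p vp.
  by rewrite {1}/t -Hw cw // e Hw (pos_cl L) // vcp.
have /choice[f2 Hf2] (j : 'I_b) : exists u : 'D_8,
    forall p, h u p = t (d8 j) p.
  have lj := d8_loc L (ltn_ord j).
  have ti : injective (t (d8 j)) by move=> p q; apply: t_inj; rewrite lj.
  have [|u hu] := proj2 (hP (perm ti)).
    move=> p; rewrite !permE; have [w cw Hw] := square_flip L (ltn_ord j).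
    by apply: (t_central _ _ w); rewrite ?lj.
  by exists u => p; rewrite hu permE.
(* A shift is read off from the image of the corner [(false, false)]; a rectangle carries two bits,
   one for each coordinate. *)
pose f1 (j : 'I_a) : 'Z_2 := if loc (c2 j) is Rect k l then
  (if k == j then (t (c2 j) (false, false)).1 else (t (c2 j) (false, false)).2)%:R%R
  else ((t (c2 j) (false, false)).1)%:R%R.
pose f : G := (finfun f1, finfun f2).
have bitE j (ja : j < a) : bit f j = odd (f1 (Ordinal ja)).
  by rewrite /bit insubT /= ffunE.
have oddb (c : bool) : odd (c%:R%R : 'Z_2) = c by case: c.
have on_base x p : vertex (loc x) p -> s (cl (base x) p) = act f (cl (base x) p).
  move=> vp; have vb : vertex (loc (base x)) p by rewrite (base_loc L).
  have [_ ->] := st _ _ vb; rewrite /act (loc_cl L) // (pos_cl L) //.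
  have [vt _] := st _ _ vb.
  rewrite (cl_cl L) ?move_valid //; congr cl.
  have := loc_base L x; have := base_loc L x.
  move: vb vt; case lx: (loc (base x)) => [|j|j k|j] /=.
  - move=> v0 t0 _ _; rewrite perm1; move: (t _ _) t0 => q.
    by case: p q v0 {vp} => -[] [] [[] []].
  - move=> p2 t2 <- [ja e]; rewrite shiftE bitE /f1 /= -e lx oddb.
    have v u : vertex (loc (base x)) (u, false) by rewrite lx.
    have [+ _] := st _ _ (v false); have [+ _] := st _ _ (v true).
    have := t_inj _ _ _ (v true) (v false).
    rewrite lx /=; case: p p2 {vp t2} => u [] // _.
    case: u => /=; case: (t _ (true, false)) (t _ (false, false)) => -[] [] // [[] []] //= H _ _;
      by have := H erefl.
  - move=> _ _ <- [ja ka jk ej ek]; rewrite shiftE !bitE /f1 /= -ej -ek lx.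
    rewrite eqxx (introF eqP jk) !oddb -surjective_pairing.
    (* A permutation of the square commuting with all four shifts is itself a shift. *)
    have := rect_flip L ja; rewrite -ej lx => /(_ p)[w cw Hw].
    have := @t_central (base x) p w cw; rewrite lx.
    move=> /(_ isT (fun _ _ => isT) Hw (false, false) isT).
    by rewrite /xorp /= !addbF -!surjective_pairing => ->;
      rewrite ![_ (+) p.1]addbC ![_ (+) p.2]addbC.
  - by move=> _ _ <- [jb ->]; rewrite /dih insubT /= ffunE Hf2.
apply/morphimP; exists f; rewrite ?inE //; apply/permP => x; rewrite permE.
(* Equivariant maps that agree on base blocks agree on their images under central maps, hence
   everywhere. *)
have [w [p [cw vp <-]]] := base_reach L x.
rewrite (cw _ sE) (cw _ (@act_equivariant f)); congr w.
exact: on_base.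
Qed.

Lemma labelling_isog_action : [set: G] \isog K.
Proof. by apply/isogP; exists mact; [apply: inj_mact | apply: im_mact]. Qed.

End Action.

Theorem labelling_isog : K \isog [set: G].
Proof.
have [h [hM hI hP]] := square_symmetries.
by rewrite isog_sym; apply: labelling_isog_action hM hI hP.
Qed.

End Labelling.

(** * Generating pairs of PSL2 and their traces *)

Local Close Scope group_scope.
Local Open Scope ring_scope.

(** The entries have an arbitrary type so that the same formulas serve for the field and for the
    codes of its elements used in computation. *)
Record m2 (K : Type) := M2 { m11 : K; m12 : K; m21 : K; m22 : K }.

Definition map_m2 (K L : Type) (f : K -> L) (A : m2 K) :=
  M2 (f (m11 A)) (f (m12 A)) (f (m21 A)) (f (m22 A)).

Section Operations.
Variables (K : Type) (add mul : K -> K -> K) (opp : K -> K).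

Definition gen_mul (A B : m2 K) := M2
  (add (mul (m11 A) (m11 B)) (mul (m12 A) (m21 B)))
  (add (mul (m11 A) (m12 B)) (mul (m12 A) (m22 B)))
  (add (mul (m21 A) (m11 B)) (mul (m22 A) (m21 B)))
  (add (mul (m21 A) (m12 B)) (mul (m22 A) (m22 B))).

Definition gen_det (A : m2 K) :=
  add (mul (m11 A) (m22 A)) (opp (mul (m12 A) (m21 A))).

Definition gen_tr (A : m2 K) := add (m11 A) (m22 A).

End Operations.

Section Matrices.
Variable F : finFieldType.
Implicit Types A B M N X Y : m2 F.

Definition mmul A B := gen_mul +%R *%R A B.
Definition mdet A := gen_det +%R *%R -%R A.
Definition mtr A := gen_tr +%R A.
Definition mopp A := M2 (- m11 A) (- m12 A) (- m21 A) (- m22 A).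
Definition madj A := M2 (m22 A) (- m12 A) (- m21 A) (m11 A).
Definition mscale (a : F) A := M2 (a * m11 A) (a * m12 A) (a * m21 A) (a * m22 A).
Definition mone : m2 F := M2 1 0 0 1.
(** The additive commutator [A B - B A]. *)
Definition commm A B := M2
  (m12 A * m21 B - m21 A * m12 B)
  (m11 A * m12 B + m12 A * m22 B - m11 B * m12 A - m12 B * m22 A)
  (m21 A * m11 B + m22 A * m21 B - m21 B * m11 A - m22 B * m21 A)
  (m21 A * m12 B - m12 A * m21 B).

Lemma m2P A B : m11 A = m11 B -> m12 A = m12 B -> m21 A = m21 B ->
  m22 A = m22 B -> A = B.
Proof. by case: A B => a b c d [e f g h] /= -> -> -> ->. Qed.

Lemma mdetM A B : mdet (mmul A B) = mdet A * mdet B.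
Proof. by case: A B => a b c d [e f g h]; rewrite /mdet /gen_det /=; ring. Qed.

Lemma mmulA A B M : mmul A (mmul B M) = mmul (mmul A B) M.
Proof.
by case: A B M => a b c d [e f g h] [i j k l]; apply: m2P; rewrite /=; ring.
Qed.

Lemma mmul1 A : mmul mone A = A.
Proof. by case: A => a b c d; apply: m2P; rewrite /=; ring. Qed.

Lemma mmulr1 A : mmul A mone = A.
Proof. by case: A => a b c d; apply: m2P; rewrite /=; ring. Qed.

Lemma mdet1 : mdet mone = 1. Proof. by rewrite /mdet /gen_det /=; ring. Qed.

Lemma mmul_adj A : mmul A (madj A) = mscale (mdet A) mone.
Proof.
by case: A => a b c d; rewrite /mdet /gen_det; apply: m2P; rewrite /=; ring.
Qed.

Lemma madj_mul A : mmul (madj A) A = mscale (mdet A) mone.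
Proof.
by case: A => a b c d; rewrite /mdet /gen_det; apply: m2P; rewrite /=; ring.
Qed.

Lemma mscale1 A : mscale 1 A = A.
Proof. by case: A => a b c d; rewrite /mscale /= !mul1r. Qed.

Lemma mdet_adj A : mdet (madj A) = mdet A.
Proof. by case: A => a b c d; rewrite /mdet /gen_det /=; ring. Qed.

Lemma mdet_opp A : mdet (mopp A) = mdet A.
Proof. by case: A => a b c d; rewrite /mdet /gen_det /=; ring. Qed.

Lemma mdet_scale a A : mdet (mscale a A) = a ^+ 2 * mdet A.
Proof. by case: A => b c d e; rewrite /mdet /gen_det /=; ring. Qed.

Lemma moppK A : mopp (mopp A) = A.
Proof. by case: A => a b c d; rewrite /mopp /= !opprK. Qed.

Lemma mmul_opp A B : mmul (mopp A) B = mopp (mmul A B).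
Proof. by case: A B => a b c d [e f g h]; apply: m2P; rewrite /=; ring. Qed.

Lemma mmulr_opp A B : mmul A (mopp B) = mopp (mmul A B).
Proof. by case: A B => a b c d [e f g h]; apply: m2P; rewrite /=; ring. Qed.

Definition eqpm A B := A = B \/ A = mopp B.

Definition mx A : 'M[F]_2 := \matrix_(i, j)
  if i == 0 then (if j == 0 then m11 A else m12 A)
  else (if j == 0 then m21 A else m22 A).

Lemma mxM A B : mx (mmul A B) = mx A *m mx B.
Proof.
apply/matrixP => i j; rewrite !mxE !big_ord_recl big_ord0 !mxE /= addr0.
by case: ifP => _; case: ifP.
Qed.

Lemma mx_det A : \det (mx A) = mdet A.
Proof.
rewrite (expand_det_row _ ord0) !big_ord_recl big_ord0 /cofactor !det_mx11 !mxE.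
by rewrite /mdet /gen_det /=; ring.
Qed.

Lemma mx1 : mx mone = 1%:M.
Proof.
by apply/matrixP => i j; rewrite !mxE; case: i j => -[|[|[]]] // ? [[|[|[]]]].
Qed.

Lemma mx_surj (u : 'M[F]_2) : exists A, mx A = u.
Proof.
exists (M2 (u 0 0) (u 0 1) (u 1 0) (u 1 1)); apply/matrixP => i j; rewrite mxE /=.
by case: i j => -[|[|[]]] // i0 [[|[|[]]]] // j0 /=; congr (u _ _); apply: val_inj.
Qed.

Lemma mx_inj : injective mx.
Proof.
by move=> A B /matrixP e; apply: m2P; have := e 0 0; have := e 0 1;
  have := e 1 0; have := e 1 1; rewrite !mxE.
Qed.

Definition toGL A : {'GL_2[F]} := insubd (1%g : {'GL_2[F]}) (mx A).

Lemma toGL_val A : mdet A != 0 -> GLval (toGL A) = mx A.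
Proof.
by move=> nA; apply: (@insubdK _ _ {'GL_2[F]}); rewrite -topredE /= unitmxE mx_det unitfE.
Qed.
End Matrices.

(** * PSL2: lifts up to sign, transvections, simplicity *)

Section PSL.
Variable F : finFieldType.
Implicit Types A B M N X Y : m2 F.

Lemma GL_inj (u v : {'GL_2[F]}) : GLval u = GLval v -> u = v.
Proof. exact: val_inj. Qed.

Lemma toGL_M A B : mdet A != 0 -> mdet B != 0 ->
  toGL (mmul A B) = (toGL A * toGL B)%g.
Proof.
move=> nA nB; apply: GL_inj; rewrite GL_ME.
by rewrite !toGL_val ?mdetM ?mulf_neq0 // mxM.
Qed.

Lemma toGL_surj (u : {'GL_2[F]}) : exists2 A, mdet A != 0 & toGL A = u.
Proof.
have [A Au] := mx_surj (GLval u).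
have nA : mdet A != 0 by rewrite -mx_det Au -unitfE -unitmxE; apply: (valP u).
by exists A => //; apply: GL_inj; rewrite toGL_val.
Qed.

Lemma toGL_inj A B : mdet A != 0 -> mdet B != 0 -> toGL A = toGL B -> A = B.
Proof.
by move=> nA nB /(congr1 (@GLval _ _)); rewrite !toGL_val // => /mx_inj.
Qed.

Lemma toGL1 : toGL (mone F) = 1%g.
Proof.
apply: GL_inj; rewrite toGL_val ?mdet1 ?oner_eq0 //.
by rewrite mx1.
Qed.

Lemma toGL_SL A : mdet A = 1 -> toGL A \in SL2 F.
Proof.
by move=> dA; rewrite inE toGL_val ?dA ?oner_eq0 // mx_det dA.
Qed.

Lemma SL2P (u : {'GL_2[F]}) : reflect (exists2 A, mdet A = 1 & toGL A = u) (u \in SL2 F).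
Proof.
apply: (iffP idP) => [|[A dA <-]]; last exact: toGL_SL.
have [A nA <-] := toGL_surj u; rewrite inE toGL_val // mx_det => /eqP dA.
by exists A.
Qed.

Definition up (b : F) := M2 1 b 0 1.
Definition lo (c : F) := M2 1 0 c 1.

Lemma det_up b : mdet (up b) = 1. Proof. by rewrite /mdet /gen_det /=; ring. Qed.
Lemma det_lo c : mdet (lo c) = 1. Proof. by rewrite /mdet /gen_det /=; ring. Qed.

Definition scalar A := m12 A = 0 /\ m21 A = 0 /\ m11 A = m22 A.

Lemma scalarP A B : scalar A -> mmul A B = mmul B A.
Proof.
case: A B => a b c d [e f g h] [/= -> [-> ->]].
by apply: m2P; rewrite /=; ring.
Qed.

Lemma centerP A : mdet A = 1 ->
  reflect (eqpm A (mone F)) (toGL A \in 'Z(SL2 F))%g.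
Proof.
move=> dA; have nA : mdet A != 0 by rewrite dA oner_eq0.
apply: (iffP (@centerP _ _ _)) => [[_ cA]|eA].
  have com B : mdet B = 1 -> mmul A B = mmul B A.
    move=> dB; have nB : mdet B != 0 by rewrite dB oner_eq0.
    apply: toGL_inj; rewrite ?mdetM ?mulf_neq0 // !toGL_M //.
    by have := cA _ (toGL_SL dB); rewrite /commute => ->.
  have := com _ (det_lo 1); have := com _ (det_up 1).
  case: A dA {com cA nA} => a b c d; rewrite /mdet /gen_det /mmul /gen_mul /=.
  move=> dA [e1 e2 _ _] [f1 _ _ _].
  have c0 : c = 0 by apply: (addrI a); rewrite addr0; move: e1; rewrite !mulr1 !mul1r mulr0 addr0.
  have b0 : b = 0 by apply: (addrI a); rewrite addr0; move: f1; rewrite !mulr1 !mul1r mul0r addr0.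
  have ad : a = d by move: e2; rewrite b0 !mulr1 !mul1r addr0 add0r.
  move: dA; rewrite b0 c0 -ad mul0r subr0 => /eqP; rewrite -expr2 sqrf_eq1.
  by case/orP=> /eqP ->; [left | right]; rewrite /mopp /= ?oppr0.
split=> [|u /SL2P[B dB <-]]; first exact: toGL_SL.
have nB : mdet B != 0 by rewrite dB oner_eq0.
rewrite /commute -!toGL_M // scalarP //.
by case: eA => ->; split; rewrite /= ?oppr0.
Qed.

Lemma center_GL (u z : {'GL_2[F]}) : z \in 'Z(SL2 F)%g -> commute z u.
Proof.
move=> Zz; have : z \in SL2 F by apply: (subsetP (center_sub _)).
case/SL2P=> A dA eA; move: Zz; rewrite -eA => /(centerP dA) sA.
have [B nB <-] := toGL_surj u.
rewrite /commute -!toGL_M ?dA ?oner_eq0 // scalarP //.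
by case: sA => ->; split; rewrite /= ?oppr0.
Qed.

(** Hence [coset] is multiplicative on all of GL2, and conjugation by GL2 takes place in the same
    quotient type as PSL2. *)
Lemma norm_center (u : {'GL_2[F]}) : u \in 'N('Z(SL2 F))%g.
Proof.
apply: (subsetP (cent_sub _)); apply/centP => z Zz.
exact/commute_sym/center_GL.
Qed.

Definition prj A : coset_of 'Z(SL2 F)%g := coset 'Z(SL2 F)%g (toGL A).

Lemma prjM A B : mdet A != 0 -> mdet B != 0 -> prj (mmul A B) = (prj A * prj B)%g.
Proof. by move=> nA nB; rewrite /prj toGL_M // morphM ?norm_center. Qed.

Lemma prj1 : prj (mone F) = 1%g.
Proof. by rewrite /prj toGL1; apply: (coset_id (group1 _)). Qed.

Lemma nz1 A : mdet A = 1 -> mdet A != 0.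
Proof. by move=> ->; apply: oner_neq0. Qed.

Lemma prjV A : mdet A = 1 -> prj (madj A) = (prj A)^-1%g.
Proof.
move=> dA; apply: (mulgI (prj A)); rewrite mulgV -prjM ?nz1 ?mdet_adj //.
by rewrite mmul_adj dA mscale1 prj1.
Qed.

Lemma prj_PSL A : mdet A = 1 -> prj A \in PSL2 F.
Proof. by move=> dA; apply: mem_quotient; apply: toGL_SL. Qed.

Lemma PSLP g : reflect (exists2 A, mdet A = 1 & prj A = g) (g \in PSL2 F).
Proof.
apply: (iffP idP) => [|[A dA <-]]; last exact: prj_PSL.
by case/morphimP => u _ /SL2P[A dA <-] ->; exists A.
Qed.

Lemma prj_eq1 A : mdet A = 1 -> prj A = 1%g <-> eqpm A (mone F).
Proof.
move=> dA; split=> [/(coset_idr (norm_center _))/(centerP dA) //|eA].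
by apply/coset_id/(centerP dA).
Qed.

Lemma prj_eq A B : mdet A = 1 -> mdet B = 1 -> prj A = prj B <-> eqpm A B.
Proof.
move=> dA dB; have dBV : mdet (madj B) = 1 by rewrite mdet_adj.
have -> : (prj A = prj B) <-> (prj (mmul A (madj B)) = 1%g).
  rewrite prjM ?nz1 // prjV //; split=> [->|e]; first by rewrite mulgV.
  by apply: (mulIg (prj B)^-1%g); rewrite mulgV.
rewrite prj_eq1 ?mdetM ?dA ?dBV ?mulr1 //.
have E : A = mmul (mmul A (madj B)) B.
  by rewrite -mmulA madj_mul dB mscale1 mmulr1.
split=> -[e|e].
- by left; rewrite E e mmul1.
- by right; rewrite E e mmul_opp mmul1.
- by left; rewrite e mmul_adj dB mscale1.
- by right; rewrite e mmul_opp mmul_adj dB mscale1.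
Qed.

Lemma mtr_opp A : mtr (mopp A) = - mtr A.
Proof. by rewrite /mtr /gen_tr /= opprD. Qed.

Lemma eqpm_sym A B : eqpm A B -> eqpm B A.
Proof. by case=> ->; rewrite ?moppK; [left | right; rewrite moppK]. Qed.

Section Generated.
Variable P : m2 F -> Prop.
Hypothesis PM : forall A B, mdet A = 1 -> mdet B = 1 -> P A -> P B -> P (mmul A B).
Hypotheses (Pu : forall b, P (up b)) (Pl : forall c, P (lo c)).

(** A matrix with nonzero lower left entry is a product upper, lower, upper of transvections;
    multiplication by [lo 1] reduces the other matrices to this case. *)
Lemma SL2_transvections A : mdet A = 1 -> P A.
Proof.
have gen c0 B : m21 B = c0 -> c0 != 0 -> mdet B = 1 -> P B.
  move=> <- nc dB.
  have -> : B = mmul (mmul (up ((m11 B - 1) / m21 B)) (lo (m21 B)))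
                     (up ((m22 B - 1) / m21 B)).
    case: B nc dB => a b c d /= nc; rewrite /mdet /gen_det /= => dB.
    have -> : b = (a * d - 1) / c by rewrite -dB; field.
    by apply: m2P; rewrite /=; field.
  by apply: PM; rewrite ?det_up ?mdetM ?det_lo ?det_up ?mulr1 //; apply: PM;
    rewrite ?det_up ?det_lo.
move=> dA; have [c0|nc] := eqVneq (m21 A) 0; last exact: gen erefl nc dA.
have -> : A = mmul (mmul A (lo 1)) (lo (-1)).
  by case: A {dA c0} => a b c d; apply: m2P; rewrite /=; ring.
have dA1 : mdet (mmul A (lo 1)) = 1 by rewrite mdetM dA det_lo mulr1.
apply: PM; rewrite ?det_lo //; apply: gen erefl _ _ => //.
case: A dA c0 {dA1} => a b c d /=; rewrite /mdet /gen_det /= => dA c0.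
rewrite c0 mul0r add0r mulr1; apply/eqP => d0; move: dA; rewrite c0 d0 !mulr0 subr0.
by move/eqP; rewrite eq_sym oner_eq0.
Qed.

End Generated.

Lemma PSL_transvections (H : {group coset_of 'Z(SL2 F)%g}) :
  (forall b, prj (up b) \in H) -> (forall c, prj (lo c) \in H) ->
  PSL2 F \subset H.
Proof.
move=> Hu Hl; apply/subsetP => g /PSLP[A dA <-].
apply: (@SL2_transvections (fun A => prj A \in H)) => // B M dB dM HB HM.
by rewrite prjM ?nz1 // groupM.
Qed.

Lemma PSL_nonabelian : ~~ abelian (PSL2 F).
Proof.
apply/negP => /centsP /(_ (prj (up 1)) _ (prj (lo 1)) _).
rewrite !prj_PSL ?det_up ?det_lo // => /(_ isT isT).
rewrite /commute -!prjM ?nz1 ?det_up ?det_lo // => /prj_eq.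
rewrite !mdetM !det_up !det_lo mulr1 => /(_ erefl erefl)[] [] /= e f _ _.
  have /eqP : (1 : F) = 0 by apply: (addrI 1); move: e; rewrite !mul1r mul0r.
  by rewrite oner_eq0.
have two : (1 + 1 : F) = 0.
  by move: f; rewrite mulr0 mul1r mul0r !add0r addr0 => {1}->; rewrite addNr.
have /eqP : (1 : F) = 0.
  by move: e; rewrite !mul1r mul0r addr0 two => /esym/eqP; rewrite oppr_eq0 => /eqP.
by rewrite oner_eq0.
Qed.

Lemma prj_opp A : mdet A = 1 -> prj (mopp A) = prj A.
Proof. by move=> dA; apply/prj_eq; rewrite ?mdet_opp //; right. Qed.

Lemma prjJ A M : mdet A = 1 -> mdet M = 1 ->
  prj (mmul (mmul M A) (madj M)) = (prj A ^ (prj M)^-1)%g.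
Proof.
move=> dA dM; rewrite conjgE invgK prjM ?mdetM ?mulf_neq0 ?nz1 ?mdet_adj //.
by rewrite prjM ?nz1 // prjV // mulgA.
Qed.

(* Commutators with a diagonal element and then with a transvection turn a
   nonscalar element of a normal subgroup into arbitrary transvections. *)
Lemma PSL_simple (s : F) : s != 0 -> s ^+ 4 != 1 -> simple (PSL2 F).
Proof.
move=> s0 s4; apply/simpleP; split.
  by apply/eqP => P1; case/negP: PSL_nonabelian; rewrite P1 abelian1.
move=> H nH; have [/trivgP|] := boolP (H \subset [1])%g; first by left.
case/subsetPn => g Hg ng; right; apply/eqP; rewrite eqEsubset normal_sub //.
have HJ A M : mdet A = 1 -> mdet M = 1 -> prj A \in H ->
    prj (mmul (mmul M A) (madj M)) \in H.
  move=> dA dM HA; rewrite prjJ // memJ_norm // groupV.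
  by apply: (subsetP (normal_norm nH)); apply: prj_PSL.
have HM A B : mdet A = 1 -> mdet B = 1 -> prj A \in H -> prj B \in H ->
    prj (mmul A B) \in H.
  by move=> dA dB HA HB; rewrite prjM ?nz1 // groupM.
have HC A M : mdet A = 1 -> mdet M = 1 -> prj A \in H ->
    prj (mmul (mmul (mmul M A) (madj M)) (madj A)) \in H.
  move=> dA dM HA; apply: HM; rewrite ?mdetM ?mdet_adj ?dA ?dM ?mulr1 //.
    exact: HJ.
  by rewrite prjV // groupV.
have sub := subsetP (normal_sub nH).
have /PSLP[A dA gA] := sub _ Hg; rewrite -{g}gA in Hg ng.
have nsA : ~ scalar A.
  case=> b0 [c0 ad]; case/negP: ng; apply/set1P/(prj_eq1 dA).
  move: dA; case: A b0 c0 ad {Hg} => a b c d /= -> -> <-.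
  rewrite /mdet /gen_det /= mul0r subr0 -expr2 => /eqP; rewrite sqrf_eq1.
  by case/orP => /eqP ->; [left | right]; rewrite /mopp /= ?oppr0.
pose w := M2 0 (-1) 1 0 : m2 F.
have dw : mdet w = 1 by rewrite /mdet /gen_det /w /=; ring.
have [B [dB HB nc]] : exists B, [/\ mdet B = 1, prj B \in H & m21 B != 0].
  have swap B : mdet B = 1 -> prj B \in H -> m12 B != 0 ->
      exists B, [/\ mdet B = 1, prj B \in H & m21 B != 0].
    move=> dB HB nb; exists (mmul (mmul w B) (madj w)); split.
    - by rewrite !mdetM mdet_adj dw dB !mulr1.
    - exact: HJ.
    - by rewrite [m21 _](_ : _ = - m12 B) ?oppr_eq0 //=; ring.
  have [c0|nc] := eqVneq (m21 A) 0; last by exists A.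
  have [b0|nb] := eqVneq (m12 A) 0; last exact: swap dA Hg nb.
  apply: (swap (mmul (mmul (up 1) A) (madj (up 1)))).
  - by rewrite !mdetM mdet_adj det_up dA !mulr1.
  - by apply: HJ; rewrite ?det_up.
  rewrite [m12 _](_ : _ = m22 A - m11 A); last by rewrite /= b0 c0; ring.
  by rewrite subr_eq0; apply/eqP => ad; apply: nsA.
have [E [dE HE [a0 nE]]] : exists E, [/\ mdet E = 1, prj E \in H &
    m11 E = 0 /\ m21 E != 0].
  exists (mmul (mmul (up (- m11 B / m21 B)) B) (madj (up (- m11 B / m21 B)))).
  split; first by rewrite !mdetM mdet_adj det_up dB !mulr1.
    by apply: HJ; rewrite ?det_up.
  split; first by rewrite /=; field.
  by rewrite [m21 _](_ : _ = m21 B) //=; ring.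
pose S := M2 s 0 0 s^-1.
have dS : mdet S = 1 by rewrite /mdet /gen_det /S /=; field.
have [t Ht] : exists t, prj (M2 (s ^+ 2) 0 t (s ^- 2)) \in H.
  have := HC E S dE dS HE; case: E dE a0 nE {HE} => a b c d /=.
  rewrite /mdet /gen_det /= => + a0; rewrite a0 mul0r sub0r => dE nc'.
  have -> : b = - c^-1 by rewrite -[LHS]mulr1 -[X in b * X](mulfV nc') mulrA -[b * c]opprK dE; ring.
  set U := mmul _ _ => HU; exists (m21 U); congr (prj _ \in H): HU.
  by apply: m2P; rewrite /U /=; field; rewrite ?s0 ?nc'.
have dT : mdet (M2 (s ^+ 2) 0 t (s ^- 2)) = 1.
  by rewrite /mdet /gen_det /=; field.
have Hl c : prj (lo c) \in H.
  (* The commutator of [lo d] with the triangular element is [lo (d * (1 - s ^- 4))]; this is where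
     the condition on [s] enters. *)
  have n4 : 1 - s ^- 4 != 0.
    rewrite subr_eq0; apply: contra s4 => /eqP e; apply/eqP.
    by rewrite -[LHS]invrK -e invr1.
  have := HC _ (lo (c / (1 - s ^- 4))) dT (det_lo _) Ht.
  set U := mmul _ _ => HU; congr (prj _ \in H): HU.
  have n4' : s ^+ 4 - 1 != 0 by rewrite subr_eq0.
  by apply: m2P; rewrite /U /=; field; rewrite ?s0 ?n4'.
apply: PSL_transvections => // b.
have := HJ _ w (det_lo (- b)) dw (Hl _); congr (prj _ \in H).
by apply: m2P; rewrite /w /=; ring.
Qed.

End PSL.

(** * Invariant lines, traces and generation *)

Section Pairs.
Variable F : finFieldType.
Implicit Types A B M N X Y : m2 F.
Local Notation G := (PSL2 F).

Definition prj2 X Y := (prj X, prj Y).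

Lemma commm_comm X Y : commm X Y = M2 0 0 0 0 -> mmul X Y = mmul Y X.
Proof.
case: X Y => a b c d [e f g h] [/= e1 e2 e3 e4].
by apply: m2P; apply/eqP; rewrite -subr_eq0 /=; apply/eqP;
  [rewrite -e1 | rewrite -e2 | rewrite -e3 | rewrite -e4]; ring.
Qed.

Lemma commute_not_generating X Y : mdet X = 1 -> mdet Y = 1 ->
  mmul X Y = mmul Y X -> ~~ generating G (prj2 X Y).
Proof.
move=> dX dY cXY; apply: contra (PSL_nonabelian F) => /eqP/= <-.
rewrite abelian_gen; apply/centsP.
have c : commute (prj X) (prj Y) by rewrite /commute -!prjM ?nz1 // cXY.
by move=> u /set2P[] -> v /set2P[] -> //; apply: commute_sym.
Qed.

(** The determinant of the vectors [v] and [A v], which vanishes when [v] is an eigenvector. *)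
Definition line (v1 v2 : F) A :=
  v1 * (m21 A * v1 + m22 A * v2) - v2 * (m11 A * v1 + m12 A * v2).

Lemma lineP v1 v2 A : v1 != 0 \/ v2 != 0 -> line v1 v2 A = 0 ->
  exists l, m11 A * v1 + m12 A * v2 = l * v1 /\ m21 A * v1 + m22 A * v2 = l * v2.
Proof.
rewrite /line => v0 /eqP; rewrite subr_eq0 => /eqP e.
case: v0 => v0.
  exists ((m11 A * v1 + m12 A * v2) / v1); split; first by rewrite divfK.
  by apply: (mulfI v0); rewrite e; field.
exists ((m21 A * v1 + m22 A * v2) / v2); split; last by rewrite divfK.
by apply: (mulfI v0); rewrite -e; field.
Qed.

(** The stabilizer of a line is proper: [up 1] and [lo 1] have no common eigenvector. *)
Lemma line_not_generating v1 v2 X Y : mdet X = 1 -> mdet Y = 1 ->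
  v1 != 0 \/ v2 != 0 -> line v1 v2 X = 0 -> line v1 v2 Y = 0 ->
  ~~ generating G (prj2 X Y).
Proof.
move=> dX dY v0 lX lY; apply/negP => /eqP gen.
pose S := [set g | `[< exists A, [/\ mdet A = 1, prj A = g & line v1 v2 A = 0] >]].
have gS : group_set S.
  apply/group_setP; split.
    rewrite inE; apply/asboolP; exists (mone F); rewrite mdet1 prj1; split=> //.
    by rewrite /line /=; ring.
  move=> g h; rewrite !inE => /asboolP[A [dA <- lA]] /asboolP[B [dB <- lB]].
  apply/asboolP; exists (mmul A B); rewrite prjM ?nz1 // mdetM dA dB mulr1.
  split=> //; have [l [e1 e2]] := lineP v0 lA; have [m [f1 f2]] := lineP v0 lB.
  have E1 : m11 (mmul A B) * v1 + m12 (mmul A B) * v2 = m * l * v1.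
    transitivity (m11 A * (m11 B * v1 + m12 B * v2) + m12 A * (m21 B * v1 + m22 B * v2)).
      by rewrite /=; ring.
    rewrite f1 f2; transitivity (m * (m11 A * v1 + m12 A * v2)); first by ring.
    by rewrite e1; ring.
  have E2 : m21 (mmul A B) * v1 + m22 (mmul A B) * v2 = m * l * v2.
    transitivity (m21 A * (m11 B * v1 + m12 B * v2) + m22 A * (m21 B * v1 + m22 B * v2)).
      by rewrite /=; ring.
    rewrite f1 f2; transitivity (m * (m21 A * v1 + m22 A * v2)); first by ring.
    by rewrite e2; ring.
  by rewrite /line E1 E2; ring.
have sGS : G \subset Group gS.
  rewrite -gen gen_subG; apply/subsetP => g /set2P[] -> /=; rewrite inE; apply/asboolP.
    by exists X.
  by exists Y.
have L A : mdet A = 1 -> line v1 v2 A = 0.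
  move=> dA; have /(subsetP sGS) := prj_PSL dA.
  rewrite inE => /asboolP[B [dB eBA lB]].
  have [e|e] := proj1 (prj_eq dB dA) eBA; first by rewrite -e.
  by rewrite -[RHS]oppr0 -lB e /line /=; ring.
have := L _ (det_up 1); have := L _ (det_lo 1); rewrite /line /=.
rewrite (_ : _ - _ = v1 ^+ 2); last by ring.
move/eqP; rewrite sqrf_eq0 => /eqP v10.
rewrite (_ : _ - _ = - v2 ^+ 2); last by ring.
move/eqP; rewrite oppr_eq0 sqrf_eq0 => /eqP v20.
by case: v0; rewrite ?v10 ?v20 eqxx.
Qed.

(** At determinant one this is Fricke's polynomial [4 + x y z - x^2 - y^2 - z^2] in the three
    traces, so irreducibility can be read off from the traces. *)
Lemma commm_det X Y : mdet (commm X Y) =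
  4%:R * mdet X * mdet Y + mtr X * mtr Y * mtr (mmul X Y)
  - mtr X ^+ 2 * mdet Y - mtr Y ^+ 2 * mdet X - mtr (mmul X Y) ^+ 2.
Proof.
by case: X Y => a b c d [e f g h]; rewrite /mdet /mtr /gen_det /gen_tr /=; ring.
Qed.

(** If C = XY - YX is singular, either C = 0 and the pair commutes, or the kernel of C is a line. It
    is invariant because [X C + C X = tr(X) C], and likewise for Y. *)
Lemma generating_irreducible X Y : mdet X = 1 -> mdet Y = 1 ->
  generating G (prj2 X Y) -> mdet (commm X Y) != 0.
Proof.
move=> dX dY; apply: contraTneq => dC.
have [[n1 n2]|v0] : (m11 (commm X Y) = 0 /\ m12 (commm X Y) = 0) \/
    (m12 (commm X Y) != 0 \/ - m11 (commm X Y) != 0).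
- rewrite oppr_eq0; case: (eqVneq (m12 _) 0) => ?; last by right; left.
  by case: (eqVneq (m11 (commm X Y)) 0) => ?; [left | right; right].
- have n4 : m22 (commm X Y) = 0.
    by apply: oppr_inj; rewrite oppr0 -n1 /commm /=; ring.
  case: (eqVneq (m21 (commm X Y)) 0) => [n3|n3].
    apply: commute_not_generating => //; apply: commm_comm.
    by case: (commm X Y) n1 n2 n3 n4 => a b c d /= -> -> -> ->.
  apply: (@line_not_generating (m22 (commm X Y)) (- m21 (commm X Y))) => //.
  - by right; rewrite oppr_eq0.
  - transitivity (- m21 X * mdet (commm X Y)); last by rewrite dC mulr0.
    by case: X Y {dX dY dC n1 n2 n3 n4} => a b c d [e f g h];
      rewrite /line /mdet /gen_det /commm /=; ring.
  - transitivity (- m21 Y * mdet (commm X Y)); last by rewrite dC mulr0.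
    by case: X Y {dX dY dC n1 n2 n3 n4} => a b c d [e f g h];
      rewrite /line /mdet /gen_det /commm /=; ring.
apply: (line_not_generating dX dY v0).
- transitivity (m12 X * mdet (commm X Y)); last by rewrite dC mulr0.
  by case: X Y {dX dY dC v0} => a b c d [e f g h];
      rewrite /line /mdet /gen_det /commm /=; ring.
- transitivity (m12 Y * mdet (commm X Y)); last by rewrite dC mulr0.
  by case: X Y {dX dY dC v0} => a b c d [e f g h];
      rewrite /line /mdet /gen_det /commm /=; ring.
Qed.

Definition companion (a : F) := M2 0 (-1) 1 a.

(* Macbeath: an irreducible pair is determined up to conjugation by its traces.
   The intertwiner has columns v and A v, where v spans the kernel of
   B - p - s A. *)
Lemma macbeath A B (p r s t : F) : mdet A = 1 -> mdet B = 1 ->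
  mdet (M2 p r s t) = 1 -> mtr B = p + t ->
  mtr (mmul A B) = mtr (mmul (companion (mtr A)) (M2 p r s t)) ->
  mdet (commm A B) != 0 ->
  exists M, [/\ mdet M != 0, mmul M (companion (mtr A)) = mmul A M &
                mmul M (M2 p r s t) = mmul B M].
Proof.
move=> dA dB dy trB; have et : t = mtr B - p by rewrite trB addrC addKr.
rewrite {}et {trB} in dy *.
case: A B dA dB dy => a b c d [e f g h] dA dB dy trAB nC.
(* The model pair satisfies [y e1 = (p + s x) e1], so the image [v] of the first basis vector must
   be killed by [B - p - s A]; equality of traces makes this matrix singular. *)
pose z11 := e - p - s * a; pose z12 := f - s * b.
pose z21 := g - s * c; pose z22 := h - p - s * d.
have dZ : z11 * z22 - z12 * z21 = 0.
  transitivity ((mdet (M2 e f g h) - 1) + s ^+ 2 * (mdet (M2 a b c d) - 1)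
     - (mdet (M2 p r s (mtr (M2 e f g h) - p)) - 1)
     + s * (mtr (mmul (M2 a b c d) (M2 e f g h)) -
            mtr (mmul (companion (mtr (M2 a b c d))) (M2 p r s (mtr (M2 e f g h) - p))))).
    by rewrite /mdet /mtr /gen_det /gen_tr /z11 /z12 /z21 /z22 /=; ring.
  by rewrite dA dB dy trAB !subrr !mulr0 subr0 !addr0.
have [v1 [v2 [v0 [kv1 kv2]]]] : exists v1 v2, (v1 != 0 \/ v2 != 0) /\
    (z11 * v1 + z12 * v2 = 0 /\ z21 * v1 + z22 * v2 = 0).
  have [n12|n12] := eqVneq z12 0; last first.
    exists z12, (- z11); split; first by left.
    by split; [ring | rewrite -[RHS]oppr0 -dZ; ring].
  have [n11|n11] := eqVneq z11 0; last first.
    exists z12, (- z11); split; first by right; rewrite oppr_eq0.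
    by split; [ring | rewrite -[RHS]oppr0 -dZ; ring].
  have [n22|n22] := eqVneq z22 0; last first.
    exists z22, (- z21); split; first by left.
    by split; [rewrite n11 n12; ring | ring].
  have [n21|n21] := eqVneq z21 0; last first.
    exists z22, (- z21); split; first by right; rewrite oppr_eq0.
    by split; [rewrite n11 n12; ring | ring].
  (* If the matrix is zero, then B = p + s A commutes with A. *)
  case/eqP: nC.
  have -> : e = p + s * a by apply/eqP; rewrite -subr_eq0 opprD addrA -/z11 n11.
  have -> : f = s * b by apply/eqP; rewrite -subr_eq0 -/z12 n12.
  have -> : g = s * c by apply/eqP; rewrite -subr_eq0 -/z21 n21.
  have -> : h = p + s * d by apply/eqP; rewrite -subr_eq0 opprD addrA -/z22 n22.
  by rewrite /mdet /gen_det /=; ring.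
have er : r = mtr (mmul (M2 a b c d) (M2 e f g h)) + s - (a + d) * (e + h - p).
  by rewrite trAB /mtr /gen_tr /=; ring.
exists (M2 v1 (a * v1 + b * v2) v2 (c * v1 + d * v2)); split.
(* If [v] and [A v] are dependent, [v] is a common eigenvector and the commutator kills it. *)
- apply/eqP => Q0; case/eqP: nC.
  have [] := @lineP v1 v2 (M2 a b c d) v0; first by rewrite -Q0 /line /mdet /gen_det /=; ring.
  move=> l [/= e1 e2].
  have f1 : e * v1 + f * v2 = (p + s * l) * v1.
    transitivity (z11 * v1 + z12 * v2 + p * v1 + s * (a * v1 + b * v2)).
      by rewrite /z11 /z12; ring.
    by rewrite kv1 e1; ring.
  have f2 : g * v1 + h * v2 = (p + s * l) * v2.
    transitivity (z21 * v1 + z22 * v2 + p * v2 + s * (c * v1 + d * v2)).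
      by rewrite /z21 /z22; ring.
    by rewrite kv2 e2; ring.
  set C := commm _ _.
  have C1 : m11 C * v1 + m12 C * v2 = 0.
    transitivity (a * (e * v1 + f * v2) + b * (g * v1 + h * v2)
                  - (e * (a * v1 + b * v2) + f * (c * v1 + d * v2))).
      by rewrite /=; ring.
    rewrite f1 f2 e1 e2.
    transitivity ((p + s * l) * (a * v1 + b * v2) - l * (e * v1 + f * v2)).
      by ring.
    by rewrite f1 e1; ring.
  have C2 : m21 C * v1 + m22 C * v2 = 0.
    transitivity (c * (e * v1 + f * v2) + d * (g * v1 + h * v2)
                  - (g * (a * v1 + b * v2) + h * (c * v1 + d * v2))).
      by rewrite /=; ring.
    rewrite f1 f2 e1 e2.
    transitivity ((p + s * l) * (c * v1 + d * v2) - l * (g * v1 + h * v2)).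
      by ring.
    by rewrite f2 e2; ring.
  case: v0 => v0; apply: (mulIf v0); rewrite mul0r.
    transitivity (m22 C * (m11 C * v1 + m12 C * v2) - m12 C * (m21 C * v1 + m22 C * v2)).
      by rewrite /mdet /gen_det; ring.
    by rewrite C1 C2; ring.
  transitivity (m11 C * (m21 C * v1 + m22 C * v2) - m21 C * (m11 C * v1 + m12 C * v2)).
    by rewrite /mdet /gen_det; ring.
  by rewrite C1 C2; ring.
- have dA' : a * d - b * c = 1 := dA.
  apply: m2P; rewrite /= /mtr /gen_tr /=; try ring.
    apply/eqP; rewrite -subr_eq0; apply/eqP.
    transitivity ((a * d - b * c - 1) * v1); first by ring.
    by rewrite dA'; ring.
  apply/eqP; rewrite -subr_eq0; apply/eqP.
  transitivity ((a * d - b * c - 1) * v2); first by ring.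
  by rewrite dA'; ring.
- have dA' : a * d - b * c = 1 := dA.
  rewrite /mtr /gen_tr /= in er *; rewrite er.
  apply: m2P; rewrite /=; apply/eqP; rewrite -subr_eq0; apply/eqP.
  + by rewrite -[RHS]oppr0 -kv1 /z11 /z12; ring.
  + transitivity (- (d * (z11 * v1 + z12 * v2) - b * (z21 * v1 + z22 * v2)
      + s * (a * d - b * c - 1) * v1)); first by rewrite /z11 /z12 /z21 /z22; ring.
    by rewrite kv1 kv2 dA'; ring.
  + by rewrite -[RHS]oppr0 -kv2 /z21 /z22; ring.
  + transitivity (- (a * (z21 * v1 + z22 * v2) - c * (z11 * v1 + z12 * v2)
      + s * (a * d - b * c - 1) * v2)); first by rewrite /z11 /z12 /z21 /z22; ring.
    by rewrite kv1 kv2 dA'; ring.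
Qed.

(** Schur's lemma: what commutes with an irreducible pair is scalar. *)
Lemma companion_centralizer a Y M : mdet (commm (companion a) Y) != 0 ->
  mmul M (companion a) = mmul (companion a) M -> mmul M Y = mmul Y M ->
  mdet M = m11 M ^+ 2.
Proof.
case: M Y => m n k l [p r s t] nC [/= e1 e2 e3 e4] [/= f1 f2 f3 f4].
have nk : n = - k by transitivity (m * 0 + n * 1); [ring | rewrite e1; ring].
have lk : l = m + a * k by transitivity (k * 0 + l * 1); [ring | rewrite e3; ring].
subst n l; have [->|k0] := eqVneq k 0; first by rewrite /mdet /gen_det /=; ring.
have rs : r = - s.
  apply: (mulfI k0); apply/eqP; rewrite -subr_eq0; apply/eqP.
  transitivity (p * m + r * k - (m * p + - k * s)); first by ring.
  by rewrite f1; ring.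
have pt : p = t + a * r.
  apply: (mulfI k0); apply/eqP; rewrite -subr_eq0; apply/eqP.
  transitivity (m * r + - k * t - (p * - k + r * (m + a * k))); last by rewrite f2; ring.
  by ring.
by case/eqP: nC; rewrite /mdet /gen_det /= pt rs; ring.
Qed.

(* The intertwiner is M = A conjugating the first pair to the second. *)
Lemma gconj_intertwined X Y A B M m : mdet X = 1 -> mdet Y = 1 ->
  mdet A = 1 -> mdet B = 1 -> m != 0 -> mdet M = m ^+ 2 ->
  eqpm (mmul M X) (mmul A M) -> eqpm (mmul M Y) (mmul B M) ->
  gconj G (prj2 X Y) (prj2 A B).
Proof.
move=> dX dY dA dB m0 dM eX eY; pose N := mscale m^-1 M.
have dN : mdet N = 1 by rewrite mdet_scale dM; field.
have NE P Q : mdet P = 1 -> mdet Q = 1 -> eqpm (mmul M P) (mmul Q M) ->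
    prj Q = (prj P ^ (prj N)^-1)%g.
  move=> dP dQ ePQ; rewrite -prjJ //; apply/prj_eq => //.
    by rewrite !mdetM mdet_adj dN dP !mulr1.
  have sc U V : mmul (mscale m^-1 U) V = mscale m^-1 (mmul U V).
    by apply: m2P; rewrite /=; ring.
  have scr U V : mmul V (mscale m^-1 U) = mscale m^-1 (mmul V U).
    by apply: m2P; rewrite /=; ring.
  have E : mmul (mmul Q N) (madj N) = Q by rewrite -mmulA mmul_adj dN mscale1 mmulr1.
  rewrite -{1}E /N sc scr; apply: eqpm_sym; case: ePQ => ->; first by left.
  have sco U : mscale m^-1 (mopp U) = mopp (mscale m^-1 U).
    by apply: m2P; rewrite /=; ring.
  by right; rewrite sco mmul_opp.
exists (prj N)^-1%g; first by rewrite groupV prj_PSL.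
by congr pair; apply: NE.
Qed.

Lemma gconj_intertwiner X Y A B : mdet X = 1 -> mdet Y = 1 ->
  mdet A = 1 -> mdet B = 1 -> gconj G (prj2 X Y) (prj2 A B) ->
  exists M, [/\ mdet M = 1, eqpm (mmul M X) (mmul A M) & eqpm (mmul M Y) (mmul B M)].
Proof.
move=> dX dY dA dB [g /groupVr/PSLP[M dM gM] [eA eB]]; exists M.
have NE P Q : mdet P = 1 -> mdet Q = 1 -> prj Q = (prj P ^ g)%g ->
    eqpm (mmul M P) (mmul Q M).
  move=> dP dQ; rewrite -[g]invgK -gM -prjJ // => /prj_eq.
  rewrite !mdetM mdet_adj dM dP mulr1 => /(_ dQ (mulr1 _)) e.
  have E : mmul M P = mmul (mmul (mmul M P) (madj M)) M.
    by rewrite -mmulA madj_mul dM mscale1 mmulr1.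
  by rewrite E; apply: eqpm_sym; case: e => ->; [left | right; rewrite mmul_opp].
by split=> //; apply: NE.
Qed.

Section Criterion.
Variables X Y : m2 F.
Hypotheses (dX : mdet X = 1) (dY : mdet Y = 1).

Fixpoint word (w : seq bool) : m2 F :=
  if w is b :: w' then mmul (if b then Y else X) (word w') else mone F.

Lemma mdet_word w : mdet (word w) = 1.
Proof.
by elim: w => [|b w IHw] /=; rewrite ?mdet1 // mdetM IHw mulr1; case: b.
Qed.

Lemma prj_word w : prj (word w) \in <<[set prj X; prj Y]>>%g.
Proof.
elim: w => [|b w IHw] /=; first by rewrite prj1 group1.
rewrite prjM ?nz1 ?mdet_word //; last by case: b.
by rewrite groupM //; case: b; rewrite mem_gen // !inE eqxx ?orbT.
Qed.

End Criterion.

(** Irreducibility gives an element that is not upper triangular; transvections turn it into an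
    antidiagonal one, which conjugates upper transvections to lower ones. *)
Lemma generating_up X Y : mdet X = 1 -> mdet Y = 1 ->
  mdet (commm X Y) != 0 ->
  (forall b, prj (up b) \in <<[set prj X; prj Y]>>%g) ->
  generating G (prj2 X Y).
Proof.
move=> dX dY nC Hu; rewrite /generating eqEsubset gen_subG; apply/andP; split.
  by apply/subsetP => g /set2P[] ->; apply: prj_PSL.
have [A [dA HA nA]] : exists A, [/\ mdet A = 1,
    prj A \in <<[set prj X; prj Y]>>%g & m21 A != 0].
  have [x0|nx] := eqVneq (m21 X) 0; last first.
    by exists X; split=> //; rewrite mem_gen // !inE eqxx.
  have [y0|ny] := eqVneq (m21 Y) 0; last first.
    by exists Y; split=> //; rewrite mem_gen // !inE eqxx orbT.
  case/eqP: nC; rewrite /mdet /gen_det /= x0 y0; ring.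
have HM B C : mdet B = 1 -> mdet C = 1 -> prj B \in <<[set prj X; prj Y]>>%g ->
    prj C \in <<[set prj X; prj Y]>>%g -> prj (mmul B C) \in <<[set prj X; prj Y]>>%g.
  by move=> dB dC HB HC; rewrite prjM ?nz1 // groupM.
apply: PSL_transvections => // c.
pose E := mmul (mmul (up (- m11 A / m21 A)) A) (up (- m22 A / m21 A)).
have dE : mdet E = 1 by rewrite !mdetM !det_up dA !mulr1.
have HE : prj E \in <<[set prj X; prj Y]>>%g.
  by apply: (HM); rewrite ?mdetM ?det_up ?dA ?mulr1 //; apply: (HM); rewrite ?det_up.
have EE : E = M2 0 (- (m21 A)^-1) (m21 A) 0.
  have bE : m12 A = (m11 A * m22 A - 1) / m21 A.
    by rewrite -dA /mdet /gen_det; field.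
  by apply: m2P; rewrite /E /= ?bE; field.
suff -> : lo c = mmul (mmul E (up (- c / m21 A ^+ 2))) (madj E).
  have dEu b : mdet (mmul E (up b)) = 1 by rewrite mdetM dE det_up mulr1.
  have HEu b : prj (mmul E (up b)) \in <<[set prj X; prj Y]>>%g.
    by rewrite prjM ?nz1 ?det_up // groupM.
  by rewrite prjM ?nz1 ?mdet_adj // prjV // groupM ?groupV.
by rewrite EE; apply: m2P; rewrite /=; field.
Qed.

Definition unip (c : F) N := M2 (1 + c * m11 N) (c * m12 N) (c * m21 N) (1 + c * m22 N).

Lemma mdet_unip c N : mtr N = 0 -> mdet N = 0 -> mdet (unip c N) = 1.
Proof.
rewrite /mtr /gen_tr /mdet /gen_det /= => tN dN.
transitivity (1 + c * (m11 N + m22 N) + c ^+ 2 * (m11 N * m22 N - m12 N * m21 N)).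
  by ring.
by rewrite tN dN; ring.
Qed.

(** After a change of basis N is strictly upper triangular and [generating_up] applies. *)
Lemma generating_unip X Y N : mdet X = 1 -> mdet Y = 1 ->
  mdet (commm X Y) != 0 -> mtr N = 0 -> mdet N = 0 -> m12 N != 0 \/ m21 N != 0 ->
  (forall c, prj (unip c N) \in <<[set prj X; prj Y]>>%g) ->
  generating G (prj2 X Y).
Proof.
move=> dX dY nC tN dN nN HN.
have n22 : m22 N = - m11 N by apply/eqP; rewrite -addr_eq0 addrC; apply/eqP.
have [n21|n21] := eqVneq (m21 N) 0.
  have n12 : m12 N != 0 by case: nN => //; rewrite n21 eqxx.
  have n11 : m11 N = 0.
    have : m11 N ^+ 2 = 0.
      by rewrite -[RHS]oppr0 -dN /mdet /gen_det n21 n22; ring.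
    by move/eqP; rewrite sqrf_eq0 => /eqP.
  apply: generating_up => // b.
  suff -> : up b = unip (b / m12 N) N by apply: HN.
  by apply: m2P; rewrite /= ?n22 ?n11 ?n21; field.
(* The first column of [g] spans the image of N, which is also its kernel. *)
pose g := M2 (m11 N) (- (m21 N)^-1) (m21 N) 0.
have dg : mdet g = 1 by rewrite /mdet /gen_det /g /=; field.
pose J A := mmul (mmul (madj g) A) g.
have dJ A : mdet A = 1 -> mdet (J A) = 1.
  by move=> dA; rewrite !mdetM mdet_adj dg dA !mulr1.
have prjJ' A : mdet A = 1 -> prj (J A) = (prj A ^ prj g)%g.
  move=> dA; rewrite -[prj g]invgK -prjV // -prjJ ?mdet_adj //; congr prj.
  by rewrite /J; congr mmul; apply: m2P; rewrite /= ?opprK.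
have gG : prj g \in G by apply: prj_PSL.
suff gen : generating G (pconj (prj2 X Y) (prj g)).
  by rewrite -(pconjK (prj g) (prj2 X Y)) pconj_generating ?groupV.
rewrite /pconj /= -!prjJ' // -/(prj2 _ _); apply: generating_up; try exact: dJ.
  have JM A B : mmul (J A) (J B) = J (mmul A B).
    rewrite /J -!mmulA; congr mmul; congr mmul; rewrite !mmulA; congr mmul.
    by rewrite mmul_adj dg mscale1 mmul1.
  have trJ A : mtr (J A) = mtr A.
    by rewrite -[RHS]mul1r -dg /mtr /gen_tr /mdet /gen_det /J /=; ring.
  suff -> : mdet (commm (J X) (J Y)) = mdet (commm X Y) by [].
  by rewrite !commm_det JM !trJ !dJ // dX dY.
move=> b.
have -> : [set prj (J X); prj (J Y)] = ([set prj X; prj Y] :^ prj g)%g.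
  by rewrite !prjJ' // conjUg !conjg_set1.
rewrite genJ.
have n12 : m12 N = - m11 N ^+ 2 / m21 N.
  apply: (mulIf n21); rewrite divfK //; apply/eqP; rewrite -subr_eq0; apply/eqP.
  by rewrite -[RHS]oppr0 -dN /mdet /gen_det n22; ring.
have -> : up b = J (unip (- b * m21 N) N).
  by apply: m2P; rewrite /J /g /= ?n22 ?n12; field.
by rewrite prjJ' ?mdet_unip // memJ_conjg.
Qed.

(** The right stabilizer of the image of L is a subgroup. If it were all of PSL2, the image, which
    contains 1, would contain U. *)
Lemma not_generating_closed X Y (L : seq (m2 F)) U : mdet X = 1 -> mdet Y = 1 ->
  mdet U = 1 -> (forall A, List.In A L -> mdet A = 1) -> List.In (mone F) L ->
  (forall A, List.In A L -> exists2 B, List.In B L & eqpm B (mmul A X)) ->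
  (forall A, List.In A L -> exists2 B, List.In B L & eqpm B (mmul A Y)) ->
  (forall A, List.In A L -> ~ eqpm A U) ->
  ~~ generating G (prj2 X Y).
Proof.
move=> dX dY dU dL L1 LX LY LU; apply/negP => /eqP gen.
pose S := [set g | `[< exists2 A, List.In A L & prj A = g >]].
have gT : group_set [set g | S :* g == S]%g.
  apply/group_setP; split; first by rewrite inE rcoset1.
  by move=> g h; rewrite !inE => /eqP gS /eqP hS; rewrite rcosetM gS hS.
have stab Z : mdet Z = 1 -> (forall A, List.In A L -> exists2 B, List.In B L & eqpm B (mmul A Z)) ->
    (S :* prj Z == S)%g.
  move=> dZ LZ; rewrite eqEcard card_rcoset leqnn andbT.
  apply/subsetP => _ /rcosetP[g + ->]; rewrite !inE => /asboolP[A LA <-].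
  have [B LB eB] := LZ A LA; apply/asboolP; exists B => //.
  have dA := dL _ LA; have dAZ : mdet (mmul A Z) = 1 by rewrite mdetM dA dZ mulr1.
  by rewrite (proj2 (prj_eq (dL _ LB) dAZ) eB) prjM ?nz1.
have sG : G \subset Group gT.
  by rewrite -gen gen_subG; apply/subsetP => g /set2P[] ->; rewrite inE stab.
have : prj U \in S.
  have /(subsetP sG) := prj_PSL dU; rewrite inE => /eqP <-.
  apply/rcosetP; exists 1%g; last by rewrite mul1g.
  by rewrite inE; apply/asboolP; exists (mone F) => //; apply: prj1.
rewrite inE => /asboolP[A LA eA].
exact: LU LA (proj1 (prj_eq (dL _ LA) dU) eA).
Qed.

End Pairs.

(** * Even characteristic *)

Section Classes.
Local Close Scope ring_scope.
Local Open Scope group_scope.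
Variables (gT : finGroupType) (G : {group gT}).

Lemma pull_commute (phi psi : {perm Gbar G}) e :
  phi \in Aut [set: Gbar G] -> psi \in Aut [set: Gbar G] -> generating G e ->
  coset (Inn [set: Gbar G]%G) phi * coset (Inn [set: Gbar G]%G) psi ==
    coset (Inn [set: Gbar G]%G) psi * coset (Inn [set: Gbar G]%G) phi ->
  gconj G (pull psi (pull phi e)) (pull phi (pull psi e)).
Proof.
move=> Ap Aq ge; have NJ := subsetP (Aut_norm_Inn [set: Gbar G]%G).
have Apq := groupM Ap Aq; have Aqp := groupM Aq Ap.
rewrite -!morphM ?NJ // eq_mulgV1 -morphV ?NJ // -morphM ?NJ ?groupV //.
set c := _ * _ => /eqP c1; have Ac : c \in Aut [set: Gbar G].
  by rewrite groupM ?groupV.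
have Jc := coset_idr (NJ _ Ac) c1.
rewrite -!pullM // -[phi * psi](mulgKV (psi * phi)) -/c (pullM Ac Aqp ge).
exact: pull_Inn (pull_generating _ _).
Qed.

(** Theta and delta bring y and [y^-1 x^-1] into the first place, where the condition on x
    applies. *)
Lemma GT1_classes (phi : {perm Gbar G}) e :
  phi \in GT1_aut G -> generating G e -> let f := pull phi e in
  [/\ f.1 \in e.1 ^: G, f.2 \in e.2 ^: G &
      f.2^-1 * f.1^-1 \in (e.2^-1 * e.1^-1) ^: G].
Proof.
case/setIdP=> Aphi /and3P[phix cth cde] ge f.
have gf : generating G f by apply: pull_generating.
have gt := pull_generating (theta_Aut G) ge.
have gd := pull_generating (delta_Aut G) ge.
split; first exact: bar_x_pull.
  have := pull_commute Aphi (theta_Aut G) ge cth.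
  rewrite pull_theta // => -[g Gg e1].
  have := bar_x_pull phix gt; rewrite e1 pull_theta //.
  by rewrite /= (@class_transl _ _ _ _ _ (memJ_class _ Gg)).
have := pull_commute Aphi (delta_Aut G) ge cde.
rewrite pull_delta // => -[g Gg e1].
have := bar_x_pull phix gd; rewrite e1 pull_delta //.
by rewrite /= (@class_transl _ _ _ _ _ (memJ_class _ Gg)).
Qed.

Lemma GT1_trivial : simple G -> ~~ abelian G ->
  (forall phi e, phi \in GT1_aut G -> generating G e -> gconj G e (pull phi e)) ->
  GT1 G :=: 1.
Proof.
move=> sG nG H; apply: quotientS1; apply/subsetP => phi Gphi.
have /setIdP[Aphi _] := Gphi.
by apply: Inn_pull => // e; apply: H.
Qed.

End Classes.

Local Close Scope group_scope.
Local Open Scope ring_scope.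

Section Conjugacy.
Variable F : finFieldType.
Implicit Types A B M X Y : m2 F.
Local Notation G := (PSL2 F).

Lemma mtr_conj A M : mdet M = 1 -> mtr (mmul (mmul M A) (madj M)) = mtr A.
Proof.
by move=> dM; rewrite -[RHS]mul1r -dM /mtr /gen_tr /mdet /gen_det /=; ring.
Qed.

Lemma class_trace A B : mdet A = 1 -> mdet B = 1 ->
  (prj B \in prj A ^: G)%g -> mtr B = mtr A \/ mtr B = - mtr A.
Proof.
move=> dA dB /imsetP[g /groupVr/PSLP[M dM gM]].
rewrite -[g]invgK -gM -prjJ // => e.
have dMA : mdet (mmul (mmul M A) (madj M)) = 1.
  by rewrite !mdetM mdet_adj dM dA !mulr1.
have [->|->] := proj1 (prj_eq dB dMA) e; [left | right].
  exact: mtr_conj.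
by rewrite mtr_opp mtr_conj.
Qed.

Lemma mmul_cancel M A B : mdet M != 0 -> mmul A M = mmul B M -> A = B.
Proof.
move=> nM e; have K C : C = mscale (mdet M)^-1 (mmul (mmul C M) (madj M)).
  rewrite -mmulA mmul_adj; case: M nM {e} => a b c d nM.
  by apply: m2P; rewrite /=; field.
by rewrite (K A) e -K.
Qed.

Lemma companion_form X Y : mdet X = 1 -> mdet Y = 1 -> mdet (commm X Y) != 0 ->
  exists p r s t, [/\ mdet (M2 p r s t) = 1, mtr Y = p + t &
    mtr (mmul X Y) = mtr (mmul (companion (mtr X)) (M2 p r s t))].
Proof.
move=> dX dY nC.
(* A matrix for which e1, e2 and e1 + e2 are all eigenvectors is scalar. *)
have [v1 [v2 nv]] : exists v1 v2, line v1 v2 X != 0.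
  have [l1|] := eqVneq (line 1 0 X) 0; last by exists 1, 0.
  have [l2|] := eqVneq (line 0 1 X) 0; last by exists 0, 1.
  have [l3|] := eqVneq (line 1 1 X) 0; last by exists 1, 1.
  case/eqP: nC; rewrite /line !mul1r !mulr1 !mul0r !mulr0 ?subr0 ?addr0 ?add0r ?sub0r in l1 l2 l3.
  have b0 : m12 X = 0 by apply: oppr_inj; rewrite l2 oppr0.
  have ad : m11 X = m22 X.
    by apply/esym/eqP; rewrite -subr_eq0; move: l3; rewrite l1 b0 add0r addr0 => ->.
  by rewrite /mdet /gen_det /= l1 b0 ad; ring.
pose M := M2 v1 (m11 X * v1 + m12 X * v2) v2 (m21 X * v1 + m22 X * v2).
have dM : mdet M != 0.
  by rewrite (_ : mdet M = line v1 v2 X) // /mdet /gen_det /line /=; ring.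
pose Y0 := mscale (mdet M)^-1 (mmul (mmul (madj M) Y) M).
exists (m11 Y0), (m12 Y0), (m21 Y0), (m22 Y0).
have EY : M2 (m11 Y0) (m12 Y0) (m21 Y0) (m22 Y0) = Y0 by case: Y0.
have dY0 : mdet Y0 = 1.
  by rewrite mdet_scale !mdetM mdet_adj dY; field.
have trY0 Z : mtr (mscale (mdet M)^-1 (mmul (mmul (madj M) Z) M)) = mtr Z.
  transitivity ((mdet M)^-1 * mdet M * mtr Z); last by rewrite mulVf ?mul1r.
  by rewrite /mtr /gen_tr /mdet /gen_det /=; ring.
split; rewrite ?EY //; first by rewrite -[LHS]trY0.
have MX : mmul M (companion (mtr X)) = mmul X M.
  have dX' : m11 X * m22 X - m12 X * m21 X = 1 := dX.
  apply: m2P; rewrite /= /mtr /gen_tr; try ring.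
    apply/eqP; rewrite -subr_eq0; apply/eqP.
    transitivity ((m11 X * m22 X - m12 X * m21 X - 1) * v1); first by ring.
    by rewrite dX'; ring.
  apply/eqP; rewrite -subr_eq0; apply/eqP.
  transitivity ((m11 X * m22 X - m12 X * m21 X - 1) * v2); first by ring.
  by rewrite dX'; ring.
rewrite -(trY0 (mmul X Y)); congr mtr.
have sc U V c : mmul (mscale c U) V = mscale c (mmul U V).
  by apply: m2P; rewrite /=; ring.
have scr U V c : mmul V (mscale c U) = mscale c (mmul V U).
  by apply: m2P; rewrite /=; ring.
have XMa : mmul (madj M) X = mmul (companion (mtr X)) (madj M).
  apply: (mmul_cancel dM); rewrite -!mmulA -MX madj_mul mmulA madj_mul.
  by rewrite scr sc mmul1 mmulr1.
by rewrite /Y0 scr; congr mscale; rewrite !mmulA XMa.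
Qed.

(** Both pairs are intertwined with one companion model; since every determinant is a square, the
    resulting intertwiner rescales into SL2. *)
Lemma same_traces_gconj X Y A B : mdet X = 1 -> mdet Y = 1 ->
  mdet A = 1 -> mdet B = 1 -> mdet (commm X Y) != 0 ->
  (forall a : F, exists b, a = b ^+ 2) ->
  mtr A = mtr X -> mtr B = mtr Y -> mtr (mmul A B) = mtr (mmul X Y) ->
  gconj G (prj2 X Y) (prj2 A B).
Proof.
move=> dX dY dA dB nC sq tA tB tAB.
have [p [r [s [t [d0 t0 t1]]]]] := companion_form dX dY nC.
have nC' : mdet (commm A B) != 0 by move: nC; rewrite !commm_det dX dY dA dB tA tB tAB.
have [M [nM MX MY]] := macbeath dX dY d0 t0 t1 nC.
have [|||N [nN NA NB]] := @macbeath _ A B p r s t dA dB d0; rewrite ?tA ?tB ?tAB //.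
rewrite tA in NA; have rel U C C' : mmul M U = mmul C M -> mmul N U = mmul C' N ->
    mmul (mmul N (madj M)) C = mmul C' (mmul N (madj M)).
  move=> e1 e2; apply: (mmul_cancel nM).
  have sc V W c : mmul (mscale c V) W = mscale c (mmul V W).
    by apply: m2P; rewrite /=; ring.
  have scr V W c : mmul W (mscale c V) = mscale c (mmul W V).
    by apply: m2P; rewrite /=; ring.
  rewrite -!mmulA -e1 [mmul (madj M) (mmul M U)]mmulA madj_mul sc mmul1 !scr mmulr1.
  by rewrite e2.
have [m em] := sq (mdet N * mdet M).
have dNM : mdet (mmul N (madj M)) = m ^+ 2 by rewrite mdetM mdet_adj.
apply: (gconj_intertwined dX dY dA dB _ dNM).
- by apply: contraTneq nM => m0; move/eqP: em; rewrite m0 expr0n /= mulf_eq0 (negbTE nN) => /= ->.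
- by left; apply: rel NA; apply: MX.
- by left; apply: rel NB; apply: MY.
Qed.

Lemma GT1_even (s : F) : (1 + 1 = 0 :> F) -> (forall a : F, exists b, a = b ^+ 2) ->
  s != 0 -> s ^+ 4 != 1 -> GT1 G :=: 1%g.
Proof.
move=> char2 sq s0 s4; apply: GT1_trivial; first exact: PSL_simple s0 s4.
  exact: PSL_nonabelian.
have opp (a : F) : - a = a.
  by apply/eqP; rewrite -subr_eq0 -opprD oppr_eq0 -[a]mul1r -mulrDl char2 mul0r.
move=> phi e Gphi ge; have [G1 G2] := generating_mem ge.
have /PSLP[X dX eX] := G1; have /PSLP[Y dY eY] := G2.
have /setIdP[Aphi _] := Gphi.
have ee : e = prj2 X Y by rewrite /prj2 eX eY; case: (e).
have [c1 c2 c3] := GT1_classes Gphi ge.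
have gf := pull_generating Aphi ge; have [H1 H2] := generating_mem gf.
have /PSLP[A dA eA] := H1; have /PSLP[B dB eB] := H2.
have ef : pull phi e = prj2 A B by rewrite /prj2 eA eB; case: (pull phi e).
move: c1 c2 c3; rewrite ef ee /= => c1 c2 c3.
have t1 := class_trace dX dA c1; have t2 := class_trace dY dB c2.
have t3 : mtr (mmul A B) = mtr (mmul X Y).
  move: c3; rewrite -!prjV // -!prjM ?nz1 ?mdet_adj // => /class_trace.
  rewrite !mdetM !mdet_adj dX dY dA dB !mulr1 => /(_ erefl erefl).
  have E U V : mtr (mmul (madj U) (madj V)) = mtr (mmul V U).
    by rewrite /mtr /gen_tr /=; ring.
  by rewrite !E opp; case.
apply: same_traces_gconj => //.
- by apply: generating_irreducible => //; rewrite -ee.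
- by case: t1; rewrite ?opp.
- by case: t2; rewrite ?opp.
Qed.

End Conjugacy.

(* X^4 - 1 has at most four roots, and over F_4 it is X - 1. *)
Lemma exists_fourth_power (F : finFieldType) : #|F| = 4%N \/ (6 <= #|F|)%N ->
  exists s : F, s != 0 /\ s ^+ 4 != 1.
Proof.
case=> cF.
  have [s /andP[s0 s1]|none] := pickP (fun s : F => (s != 0) && (s != 1)).
    by exists s; rewrite -cF expf_card.
  have /subset_leq_card : F \subset [set (0 : F); 1].
    apply/subsetP => s _; have /negbT := none s.
    by rewrite !inE negb_and !negbK.
  by rewrite cards2 cF; case: (_ != _).
have [s /andP[s0 s1]|none] := pickP (fun s : F => (s != 0) && (s ^+ 4 != 1)).
  by exists s.
have : (size (filter (predC1 (0%R : F)) (enum F)) < size ('X^4 - 1 : {poly F})%R)%N.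
  apply: max_poly_roots.
  - by rewrite -size_poly_eq0 size_XnsubC.
  - apply/allP => s; rewrite mem_filter => /andP[/= s0 _].
    rewrite /root !hornerE subr_eq0; apply/negPn/negP => s4.
    by have := none s; rewrite s0 s4.
  - by rewrite filter_uniq ?enum_uniq.
rewrite size_XnsubC //.
have -> : size (filter (predC1 (0 : F)) (enum F)) = #|F|.-1.
  by rewrite -(cardC1 (0 : F)) cardE [in RHS]/enum_mem !size_filter enumT; apply: eq_count.
by rewrite ltnS; case: #|F| cF => [|[|[|[|[|[|n]]]]]].
Qed.

Lemma GT1_even_card (F : finFieldType) k : #|F| = (2 ^ k.+2)%N ->
  GT1 (PSL2 F) :=: 1%g.
Proof.
move=> cF; have ch : 2%N \in [pchar F] by apply: card_finPcharP cF _.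
have [|s [s0 s4]] := @exists_fourth_power F.
  by rewrite cF; case: k {cF} => [|k]; [left | right; rewrite !expnS; nia].
apply: GT1_even s0 s4; first by have := pcharf0 ch; rewrite mulr2n.
(* The exponent is half of [#|F|], and raising to the power [#|F|] is the identity. *)
move=> a; exists (a ^+ (2 ^ k.+1)); rewrite -exprM -expnSr -cF.
by rewrite expf_card.
Qed.

(** * Conjugation by GL2 and field automorphisms *)

Section Outer.
Variable F : finFieldType.
Implicit Types A B M X Y : m2 F.
Local Notation G := (PSL2 F).

Lemma prj_norm M : mdet M != 0 -> prj M \in ('N(G))%g.
Proof.
move=> nM; rewrite inE; apply/subsetP => _ /imsetP[_ /PSLP[A dA <-] ->].
pose B := mscale (mdet M)^-1 (mmul (mmul (madj M) A) M).
have dB : mdet B = 1 by rewrite mdet_scale !mdetM mdet_adj dA; field.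
suff -> : (prj A ^ prj M)%g = prj B by apply: prj_PSL.
have sc c U V : mmul V (mscale c U) = mscale c (mmul V U).
  by apply: m2P; rewrite /=; ring.
have sc' c U V : mmul (mscale c V) U = mscale c (mmul V U).
  by apply: m2P; rewrite /=; ring.
have E : mmul A M = mmul M B.
  rewrite sc !mmulA mmul_adj !sc' mmul1.
  by apply: m2P; rewrite /mdet /gen_det /= in nM *; field.
apply: (mulgI (prj M)); rewrite conjgE mulKVg.
by rewrite -(prjM nM (nz1 dB)) -E (prjM (nz1 dA) nM).
Qed.

Lemma gconj_norm e f (d : coset_of 'Z(SL2 F)%g) : d \in ('N(G))%g ->
  gconj G e f -> gconj G (pconj e d) (pconj f d).
Proof.
move=> Nd [g Gg ->]; exists (g ^ d)%g; first by rewrite memJ_norm.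
by rewrite /pconj /= -!conjgM -!conjgC.
Qed.

Lemma norm_generating e (d : coset_of 'Z(SL2 F)%g) : d \in ('N(G))%g ->
  generating G e -> generating G (pconj e d).
Proof.
move=> Nd /eqP ge; rewrite /generating /=.
have -> : [set (e.1 ^ d)%g; (e.2 ^ d)%g] = ([set e.1; e.2] :^ d)%g.
  by rewrite conjUg !conjg_set1.
by rewrite genJ ge; apply/eqP; apply: (normP Nd).
Qed.

Lemma intertwiner_pconj X Y A B M : mdet X = 1 -> mdet Y = 1 ->
  mdet A = 1 -> mdet B = 1 -> mdet M != 0 ->
  mmul M X = mmul A M -> mmul M Y = mmul B M ->
  prj2 A B = pconj (prj2 X Y) (prj M)^-1%g.
Proof.
move=> dX dY dA dB nM.
have H U V : mdet U = 1 -> mdet V = 1 -> mmul M U = mmul V M ->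
    prj V = (prj U ^ (prj M)^-1)%g.
  move=> dU dV e; rewrite conjgE invgK; apply: (mulIg (prj M)).
  by rewrite mulgA mulgKV -(prjM nM (nz1 dU)) e (prjM (nz1 dV) nM).
by move=> e1 e2; congr pair; apply: H.
Qed.

Lemma intertwiner_generating X Y A B M : mdet X = 1 -> mdet Y = 1 ->
  mdet A = 1 -> mdet B = 1 -> mdet M != 0 ->
  mmul M X = mmul A M -> mmul M Y = mmul B M ->
  generating G (prj2 X Y) = generating G (prj2 A B).
Proof.
move=> dX dY dA dB nM e1 e2; rewrite (intertwiner_pconj dX dY dA dB nM e1 e2).
have Nd := groupVr (prj_norm nM); apply/idP/idP; first exact: norm_generating.
move/(norm_generating (groupVr Nd)); by rewrite pconjK.
Qed.

Section Diagonal.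
Variable n : F.
Hypothesis n0 : n != 0.

Definition dmx : m2 F := M2 n 0 0 1.
Definition dconj A := M2 (m11 A) (n * m12 A) (n^-1 * m21 A) (m22 A).

Lemma mdet_dmx : mdet dmx = n.
Proof. by rewrite /mdet /gen_det /=; ring. Qed.

Lemma nz_dmx : mdet dmx != 0. Proof. by rewrite mdet_dmx. Qed.

Lemma mdet_dconj A : mdet (dconj A) = mdet A.
Proof. by rewrite /mdet /gen_det /=; field. Qed.

Lemma dconjM A B : dconj (mmul A B) = mmul (dconj A) (dconj B).
Proof. by apply: m2P; rewrite /=; field. Qed.

Lemma mtr_dconj A : mtr (dconj A) = mtr A. Proof. by []. Qed.

Lemma dmx_dconj A : mmul dmx A = mmul (dconj A) dmx.
Proof. by apply: m2P; rewrite /=; field. Qed.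

(** Inverted because [A ^ d] stands for [d^-1 A d], whereas [dconj] is [dmx A dmx^-1]. *)
Definition dd : coset_of 'Z(SL2 F)%g := (prj dmx)^-1%g.

Lemma dd_norm : dd \in ('N(G))%g.
Proof. by rewrite groupV prj_norm ?nz_dmx. Qed.

Lemma pconj_dd X Y : mdet X = 1 -> mdet Y = 1 ->
  pconj (prj2 X Y) dd = prj2 (dconj X) (dconj Y).
Proof.
move=> dX dY; apply/esym/intertwiner_pconj; rewrite ?mdet_dconj ?nz_dmx //;
  exact: dmx_dconj.
Qed.

(** The matrix diag(n^2, 1) is [n] times an element of SL2, so twisting twice is inner. *)
Lemma dconj2 X Y : mdet X = 1 -> mdet Y = 1 ->
  gconj G (prj2 X Y) (prj2 (dconj (dconj X)) (dconj (dconj Y))).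
Proof.
move=> dX dY; have d1 : mdet (M2 n 0 0 n^-1) = 1 ^+ 2.
  by rewrite /mdet /gen_det /=; field.
apply: (gconj_intertwined _ _ _ _ (oner_neq0 F) d1); rewrite ?mdet_dconj //;
  by left; apply: m2P; rewrite /=; field.
Qed.

Lemma prj_conj_dmx A : mdet A = 1 -> (prj A ^ dd)%g = prj (dconj A).
Proof. by move=> dA; have [] := pconj_dd dA dA. Qed.

Lemma dconj_aut : exists2 a, a \in Aut G &
  forall A, mdet A = 1 -> a (prj A) = prj (dconj A).
Proof.
exists (conj_aut G dd); first exact: Aut_aut.
by move=> A dA; rewrite norm_conj_autE ?dd_norm ?prj_PSL // prj_conj_dmx.
Qed.

End Diagonal.

Lemma map_mdet (s : {rmorphism F -> F}) A : mdet (map_m2 s A) = s (mdet A).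
Proof. by rewrite /mdet /gen_det /= rmorphB !rmorphM. Qed.

Lemma map_mmul (s : {rmorphism F -> F}) A B :
  map_m2 s (mmul A B) = mmul (map_m2 s A) (map_m2 s B).
Proof. by apply: m2P; rewrite /= rmorphD !rmorphM. Qed.

Lemma map_mopp (s : {rmorphism F -> F}) A : map_m2 s (mopp A) = mopp (map_m2 s A).
Proof. by rewrite /map_m2 /mopp /= !rmorphN. Qed.

Lemma frob_aut (s : {rmorphism F -> F}) : exists2 a, a \in Aut G &
  forall A, mdet A = 1 -> a (prj A) = prj (map_m2 s A).
Proof.
have sinj : injective s by apply: fmorph_inj.
have /choice[l Hl] (g : coset_of 'Z(SL2 F)%g) :
    exists A, g \in G -> mdet A = 1 /\ prj A = g.
  have [/PSLP[A dA <-]|] := boolP (g \in G); first by exists A.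
  by exists (mone F).
pose f g := prj (map_m2 s (l g)).
have fE A : mdet A = 1 -> f (prj A) = prj (map_m2 s A).
  move=> dA; have [dl el] := Hl _ (prj_PSL dA); rewrite /f.
  have dls : mdet (map_m2 s (l (prj A))) = 1 by rewrite map_mdet dl rmorph1.
  have dAs : mdet (map_m2 s A) = 1 by rewrite map_mdet dA rmorph1.
  apply: (proj2 (prj_eq dls dAs)).
  by case: (proj1 (prj_eq dl dA) el) => ->; [left | right; rewrite map_mopp].
have fM : {in G &, {morph f : g h / (g * h)%g}}.
  move=> _ _ /PSLP[A dA <-] /PSLP[B dB <-].
  rewrite -prjM ?nz1 // !fE ?mdetM ?dA ?dB ?mulr1 // map_mmul.
  by rewrite prjM // map_mdet ?dA ?dB rmorph1 oner_neq0.
pose mf := Morphism fM.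
have injf : ('injm mf)%g.
  apply/subsetP => g /morphpreP[/PSLP[A dA <-] /set1P]; rewrite /= fE // => e.
  have dAs : mdet (map_m2 s A) = 1 by rewrite map_mdet dA rmorph1.
  apply/set1P/(prj_eq1 dA); case: (proj1 (prj_eq1 dAs) e) => -[a b c d].
    left; apply: m2P; apply: sinj; rewrite /= ?rmorph0 ?rmorph1 //.
  by right; apply: m2P; apply: sinj; rewrite /= ?rmorphN ?rmorph0 ?rmorph1 //.
have imf : (mf @* G = G)%g.
  apply/eqP; rewrite eqEcard card_injm ?leqnn ?andbT //.
  apply/subsetP => _ /morphimP[_ _ /PSLP[A dA <-] ->]; rewrite /= fE //.
  by apply: prj_PSL; rewrite map_mdet dA rmorph1.
exists (aut injf imf) => [|A dA]; first exact: Aut_aut.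
by rewrite autE ?prj_PSL //= fE.
Qed.

Lemma eqpm_trace X A M : mdet M = 1 -> eqpm (mmul M X) (mmul A M) ->
  exists c : bool, mmul M X = mscale ((-1) ^+ c) (mmul A M) /\
    mtr X = (-1) ^+ c * mtr A.
Proof.
move=> dM; have trc c : mmul M X = mscale c (mmul A M) -> mtr X = c * mtr A.
  move=> e; rewrite -(mtr_conj X dM) e.
  transitivity (c * (mdet M * mtr A)); last by rewrite dM mul1r.
  by rewrite /mtr /gen_tr /mdet /gen_det /=; ring.
case=> e.
  have e' : mmul M X = mscale ((-1) ^+ false) (mmul A M) by rewrite expr0 mscale1.
  by exists false; split=> //; apply: trc.
have e' : mmul M X = mscale ((-1) ^+ true) (mmul A M).
  by rewrite e expr1; apply: m2P; rewrite /= mulN1r.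
by exists true; split=> //; apply: trc.
Qed.

(** The signs of the lifts of the two generators are free and force the sign on the product. *)
Lemma gconj_traces X Y A B : mdet X = 1 -> mdet Y = 1 ->
  mdet A = 1 -> mdet B = 1 -> gconj G (prj2 X Y) (prj2 A B) ->
  exists M (c d : bool), [/\ mdet M = 1,
    mmul M X = mscale ((-1) ^+ c) (mmul A M) /\ mtr X = (-1) ^+ c * mtr A,
    mmul M Y = mscale ((-1) ^+ d) (mmul B M) /\ mtr Y = (-1) ^+ d * mtr B &
    mtr (mmul X Y) = (-1) ^+ (c (+) d) * mtr (mmul A B)].
Proof.
move=> dX dY dA dB /(gconj_intertwiner dX dY dA dB)[M [dM eX eY]].
have [c [cX tX]] := eqpm_trace dM eX; have [d [cY tY]] := eqpm_trace dM eY.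
exists M, c, d; split=> //.
have E : mmul M (mmul X Y) = mscale ((-1) ^+ c * (-1) ^+ d) (mmul (mmul A B) M).
  have sc k U V : mmul V (mscale k U) = mscale k (mmul V U).
    by apply: m2P; rewrite /=; ring.
  have sc' k U V : mmul (mscale k V) U = mscale k (mmul V U).
    by apply: m2P; rewrite /=; ring.
  rewrite mmulA cX sc' -mmulA cY sc mmulA.
  by apply: m2P; rewrite /=; ring.
rewrite -(mtr_conj (mmul X Y) dM) E signr_addb.
transitivity ((-1) ^+ c * (-1) ^+ d * (mdet M * mtr (mmul A B))); last by rewrite dM mul1r.
by rewrite /mtr /gen_tr /mdet /gen_det /=; ring.
Qed.

(* Two of the traces vanish if a sign is nontrivial; otherwise [dmx]^-1 M is
   a scalar, so n would be a square. *)
Lemma companion_not_dconj a Y n : n != 0 -> (forall b, n != b ^+ 2) ->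
  mdet (companion a) = 1 -> mdet Y = 1 -> (2%:R : F) != 0 ->
  mdet (commm (companion a) Y) != 0 ->
  let b := mtr Y in let c := mtr (mmul (companion a) Y) in
  (a != 0) || (b != 0) -> (a != 0) || (c != 0) -> (b != 0) || (c != 0) ->
  ~ gconj G (prj2 (companion a) Y) (prj2 (dconj n (companion a)) (dconj n Y)).
Proof.
move=> n0 nsq dx dY two nC b c ab ac bc.
case/gconj_traces=> //; rewrite ?mdet_dconj // => M [s [t [dM [eX tX] [eY tY] tXY]]].
have tx : mtr (companion a) = a by rewrite /mtr /gen_tr /= add0r.
move: tX tY tXY; rewrite -dconjM // !mtr_dconj -/b -/c tx.
have neg (z : F) : z = - z -> z = 0.
  move/eqP; rewrite -subr_eq0 opprK -mulr2n -mulr_natl mulf_eq0 (negbTE two).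
  by move=> /eqP.
case: s t eX eY => -[] eX eY; rewrite ?expr1 ?expr0 ?mulN1r ?mul1r.
- by move=> /neg a0 /neg b0 _; rewrite a0 b0 eqxx in ab.
- by move=> /neg a0 _ /neg c0; rewrite a0 c0 eqxx in ac.
- by move=> _ /neg b0 /neg c0; rewrite b0 c0 eqxx in bc.
move=> _ _ _; pose N := mmul (madj (dmx n)) M.
have NE Z : mmul M Z = mscale ((-1) ^+ false) (mmul (dconj n Z) M) ->
    mmul N Z = mmul Z N.
  rewrite expr0 mscale1 => e; rewrite /N -mmulA e !mmulA; congr mmul.
  by apply: m2P; rewrite /=; field.
have := companion_centralizer nC (NE _ eX) (NE _ eY).
rewrite mdetM mdet_adj mdet_dmx dM mulr1 => e.
by have := nsq (m11 N); rewrite -e eqxx.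
Qed.

(** The centralizer of a nontrivial unipotent consists of matrices u + v x, whose determinant (u +
    v)^2 is a square. This makes the class of trace 2 split under PGL2. *)
Lemma unipotent_not_dconj n : n != 0 -> (forall b, n != b ^+ 2) ->
  (4%:R : F) != 0 ->
  (prj (dconj n (companion (2%:R : F))) \notin prj (companion 2%:R) ^: G)%g.
Proof.
move=> n0 nsq four; set x := companion _.
have dx : mdet x = 1 by rewrite /mdet /gen_det /=; ring.
apply/negP => /imsetP[g Gg e].
have : gconj G (prj2 x x) (prj2 (dconj n x) (dconj n x)).
  by exists g => //; rewrite /pconj /= -e.
case/gconj_traces=> //; rewrite ?mdet_dconj // => M [[] [_ [dM [eX tX] _ _]]].
  case/eqP: four; move: tX; rewrite mtr_dconj expr1 /mtr /gen_tr /= mulN1r add0r.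
  by move/eqP; rewrite -subr_eq0 opprK -natrD => /eqP.
move: eX; rewrite expr0 mscale1 => eX.
pose N := mmul (madj (dmx n)) M.
have NE : mmul N x = mmul x N.
  rewrite /N -mmulA eX !mmulA; congr mmul.
  by apply: m2P; rewrite /=; field.
have dN : mdet N = n by rewrite mdetM mdet_adj mdet_dmx dM mulr1.
have := nsq (m11 N + m21 N); rewrite -{1}dN.
have [] : m12 N = - m21 N /\ m22 N = m11 N + 2%:R * m21 N.
  case: N NE {dN} => m k l o [/= e1 e2 e3 e4]; split.
    by transitivity (m * 0 + k * 1); [ring | rewrite e1; ring].
  by transitivity (l * 0 + o * 1); [ring | rewrite e3; ring].
rewrite /mdet /gen_det => -> ->; case/eqP; ring.
Qed.

Lemma class_intertwiner X A M m : mdet X = 1 -> mdet A = 1 -> m != 0 ->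
  mdet M = m ^+ 2 -> mmul M X = mmul A M -> (prj A \in prj X ^: G)%g.
Proof.
move=> dX dA m0 dM e; have e' : eqpm (mmul M X) (mmul A M) by left.
have [g Gg [eA _]] := gconj_intertwined dX dX dA dA m0 dM e' e'.
by apply/imsetP; exists g.
Qed.

End Outer.

(** * Tables of generating pairs *)

Fixpoint forall_from (m : nat) (i : N) (f : N -> bool) : bool :=
  if m is m'.+1 then f i && forall_from m' (N.succ i) f else true.

Lemma forall_fromP m f : forall_from m 0%num f ->
  forall i, (i < m)%N -> f (N.of_nat i).
Proof.
have H k j : forall_from k (N.of_nat j) f ->
    forall i, (i < k)%N -> f (N.of_nat (j + i)%N).
  elim: k j => //= k IHk j /andP[fj]; rewrite -Nnat.Nat2N.inj_succ => /IHk H.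
  by case=> [_|i /H]; rewrite ?addn0 // addSnnS.
by move/(H m 0%N).
Qed.

(** Executable arithmetic on codes. One element may have several codes, so [keqb] compares values;
    [ksig] is a field automorphism and [kspan] accepts lists that generate the field additively. *)
Record arith (K : Type) := Arith {
  k0 : K; k1 : K; kadd : K -> K -> K; kmul : K -> K -> K; kopp : K -> K;
  keqb : K -> K -> bool; ksig : K -> K; kspan : seq K -> bool }.

Record interprets (F : finFieldType) (K : Type) (R : arith K)
    (sg : {rmorphism F -> F}) (phi : K -> F) : Prop := Interprets {
  phi0 : phi (k0 R) = 0;
  phi1 : phi (k1 R) = 1;
  phiD : forall a b, phi (kadd R a b) = phi a + phi b;
  phiM : forall a b, phi (kmul R a b) = phi a * phi b;
  phiN : forall a, phi (kopp R a) = - phi a;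
  phi_eqb : forall a b, keqb R a b = (phi a == phi b);
  phi_sig : forall a, phi (ksig R a) = sg (phi a);
  phi_span : forall cs, kspan R cs -> forall P : F -> Prop,
    (forall x y, P x -> P y -> P (x + y)) ->
    (forall c, List.In c cs -> P (phi c)) -> forall x, P x }.

(* The pair (X, Y), where X is the companion matrix of trace number e_a and
   Y = e_y has trace number e_b; the trace of X Y has number e_g. The words in
   e_w take the values +-(1 + c e_n), with e_n nilpotent and the c generating F
   additively. In e_th, the triple (k, b, M) means that M conjugates entry k,
   itself conjugated by diag(nsq, 1) if b holds, to the image (Y, X) of the
   pair; likewise for e_de and for the field automorphism e_fr. *)
Record entry (K : Type) := Entry {
  e_a : N; e_b : N; e_g : N; e_y : m2 K; e_n : m2 K;
  e_w : seq (seq bool * K);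
  e_th : N * bool * m2 K; e_de : N * bool * m2 K; e_fr : N * bool * m2 K }.

(* [Closed y L U]: up to sign, the list L is stable under right multiplication by
   a pair having the traces in question, and does not contain U. *)
Inductive certificate (K : Type) :=
  | Reducible
  | Listed of N
  | Closed of m2 K & seq (m2 K) & m2 K.

(* [halves] lists the traces up to sign, [elems] all of them; [twists] conjugates
   each companion matrix of trace different from +-2 to its diag(nsq, 1)-conjugate.
   The words in [tests] are trivial on entry [rigid], and on no other entry except
   its image under the field automorphism, so they pin down Aut G. *)
Record table (K : Type) := Table {
  halves : seq K; elems : seq K; nsq : K; ninv : K; twists : seq (m2 K * K);
  uni : nat; entries : PositiveMap.t (entry K); keys : PositiveMap.t N;
  covering : seq (certificate K); tests : seq (seq bool); rigid : N }.

Section Check.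
Variables (K : Type) (R : arith K) (T : table K) (m : nat).
Implicit Types A B M : m2 K.
Local Notation "a =k b" := (keqb R a b) (at level 70).
Local Notation "a +k b" := (kadd R a b) (at level 50).
Local Notation "a *k b" := (kmul R a b) (at level 40).

Definition nzk a := ~~ (a =k k0 R).
Definition kmm A B := gen_mul (kadd R) (kmul R) A B.
Definition kdet A := gen_det (kadd R) (kmul R) (kopp R) A.
Definition ktr A := gen_tr (kadd R) A.
Definition kone := M2 (k1 R) (k0 R) (k0 R) (k1 R).
Definition kadj A := M2 (m22 A) (kopp R (m12 A)) (kopp R (m21 A)) (m11 A).
Definition kneg A := map_m2 (kopp R) A.
Definition keq A B := [&& m11 A =k m11 B, m12 A =k m12 B, m21 A =k m21 B
  & m22 A =k m22 B].
Definition keqpm A B := keq A B || keq A (kneg B).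
Definition kx a := M2 (k0 R) (kopp R (k1 R)) (k1 R) a.
Definition kdconj A := M2 (m11 A) (nsq T *k m12 A) (ninv T *k m21 A) (m22 A).
Definition kunip c A := M2 (k1 R +k c *k m11 A) (c *k m12 A) (c *k m21 A)
  (k1 R +k c *k m22 A).
(** The formula of [commm_det] for determinants one, in terms of the traces. *)
Definition kcommdet al be ga :=
  let u := k1 R +k k1 R in
  (u *k u +k al *k be *k ga) +k
  kopp R (al *k al +k be *k be +k ga *k ga).
Fixpoint kword A B (w : seq bool) : m2 K :=
  if w is b :: w' then kmm (if b then B else A) (kword A B w') else kone.

Definition tr_half (i : N) := nth (k0 R) (halves T) (N.to_nat i).
Definition tr_elem (i : N) := nth (k0 R) (elems T) (N.to_nat i).

Definition unmoved i j g y n w : entry K :=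
  let t := (0%num, false, kone) in Entry i j g y n w t t t.

Definition dummy : entry K := unmoved 0%num 0%num 0%num kone kone [::].

Definition ent (k : N) : entry K :=
  if PositiveMap.find (N.succ_pos k) (entries T) is Some e then e else dummy.

Definition ex (e : entry K) := kx (tr_half (e_a e)).

Definition twist_if (b : bool) A := if b then kdconj A else A.

(** The trace numbers packed in base 32. Each entry must be found under its own key, so entries with
    the same traces coincide. *)
Definition key (e : entry K) : positive :=
  N.succ_pos (N.add (e_g e) (N.mul 32 (N.add (e_b e) (N.mul 32 (e_a e))))).

Definition check_arith : bool :=
  let nh := size (halves T) in
  [&& all (fun a => has (fun h => (a =k h) || (a =k kopp R h)) (halves T)) (elems T),
      all (fun i => all (fun j => (i == j) ||
        ~~ (nth (k0 R) (halves T) i =k nth (k0 R) (halves T) j) &&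
        ~~ (nth (k0 R) (halves T) i =k kopp R (nth (k0 R) (halves T) j)))
          (iota 0 nh)) (iota 0 nh),
      all (fun i => all (fun j => (i == j) ||
        ~~ (nth (k0 R) (elems T) i =k nth (k0 R) (elems T) j))
          (iota 0 (size (elems T)))) (iota 0 (size (elems T))),
      (* An index below [nh] thus names the same trace in both lists. *)
      all (fun i => nth (k0 R) (elems T) i =k nth (k0 R) (halves T) i) (iota 0 nh),
      (uni T < nh)%N, nth (k0 R) (halves T) (uni T) =k (k1 R +k k1 R),
      nzk (k1 R +k k1 R), (nh <= 32)%N, (size (elems T) <= 32)%N,
      nsq T *k ninv T =k k1 R,
      all (fun a => ~~ (nsq T =k a *k a)) (elems T),
      all (fun a => has (fun b => (a =k b *k b) || (a =k nsq T *k (b *k b)))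
        (elems T)) (elems T) &
      all (fun i => (i == uni T) ||
        let: (M, r) := nth (kone, k0 R) (twists T) i in
        let x := kx (nth (k0 R) (halves T) i) in
        [&& nzk r, kdet M =k r *k r & keq (kmm M x) (kmm (kdconj x) M)]) (iota 0 nh)].

Definition check_moved A B (t : N * bool * m2 K) : bool :=
  let: (k, b, M) := t in let e := ent k in
  [&& N.ltb k (N.of_nat m), kdet M =k k1 R,
      keqpm (kmm M (twist_if b (ex e))) (kmm A M)
    & keqpm (kmm M (twist_if b (e_y e))) (kmm B M)].

Definition check_tests (e : entry K) : bool :=
  all (fun w => keqpm (kword (ex e) (e_y e) w) kone) (tests T).

Definition check_entry (k : N) : bool :=
  let e := ent k in let x := ex e in let y := e_y e in
  let al := tr_half (e_a e) in let be := tr_half (e_b e) in let ga := tr_elem (e_g e) in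
  let nh := N.of_nat (size (halves T)) in
  [&& [&& N.ltb (e_a e) nh, N.ltb (e_b e) nh &
          N.ltb (e_g e) (N.of_nat (size (elems T)))],
      [&& kdet y =k k1 R, ktr y =k be, ktr (kmm x y) =k ga
        & nzk (kcommdet al be ga)],
      (* No two traces vanish, as would happen for a pair generating a dihedral group; this is what
         [companion_not_dconj] needs. The last clause normalizes the third trace when its sign is
         free. *)
      [&& nzk al || nzk be, nzk al || nzk ga, nzk be || nzk ga
        & nzk al && nzk be || N.ltb (e_g e) nh],
      (if PositiveMap.find (key e) (keys T) is Some k' then N.eqb k' k else false),
      [&& ktr (e_n e) =k k0 R, kdet (e_n e) =k k0 R,
          nzk (m12 (e_n e)) || nzk (m21 (e_n e)),
          all (fun wc => keqpm (kword x y wc.1) (kunip wc.2 (e_n e))) (e_w e)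
        & kspan R (map snd (e_w e))],
      check_moved y x (e_th e), check_moved (kmm (kadj y) (kadj x)) y (e_de e),
      check_moved (map_m2 (ksig R) x) (map_m2 (ksig R) y) (e_fr e)
    & check_tests e ==>
        (N.eqb k (rigid T) || N.eqb k (e_fr (ent (rigid T))).1.1)].

Definition check_cert (al be ga : K) (c : certificate K) : bool :=
  match c with
  | Reducible => kcommdet al be ga =k k0 R
  | Listed k => let e := ent k in
      [&& N.ltb k (N.of_nat m), al =k tr_half (e_a e), be =k tr_half (e_b e)
        & ga =k tr_elem (e_g e)]
  | Closed y L U => let x := kx al in
      [&& [&& kdet y =k k1 R, ktr y =k be, ktr (kmm x y) =k ga,
              kdet U =k k1 R & has (keq kone) L],
          all (fun A => kdet A =k k1 R) L,
          all (fun A => has (fun B => keqpm B (kmm A x)) L) L,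
          all (fun A => has (fun B => keqpm B (kmm A y)) L) L
        & all (fun A => ~~ keqpm A U) L]
  end.

(* A trace is only defined up to sign; if the first or the second one vanishes,
   the third may be taken among the halves as well. *)
Definition triples : seq (K * K * K) :=
  flatten [seq flatten [seq [seq (a, b, c) |
     c <- if nzk a && nzk b then elems T else halves T] | b <- halves T] | a <- halves T].

Definition check_cover : bool :=
  all2 (fun t c => check_cert t.1.1 t.1.2 t.2 c) triples (covering T).

Definition check_table : bool :=
  [&& check_arith, N.ltb (rigid T) (N.of_nat m), check_tests (ent (rigid T)),
      check_cover & forall_from m 0%num check_entry].

End Check.

Lemma unipD (F : finFieldType) (x y : F) N : mtr N = 0 -> mdet N = 0 ->
  unip (x + y) N = mmul (unip x N) (unip y N).
Proof.
case: N => a b c d; rewrite /mtr /gen_tr /mdet /gen_det /= => /eqP.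
rewrite addrC addr_eq0 => /eqP -> dN.
have aa : a * a + b * c = 0 by rewrite -[RHS]oppr0 -dN; ring.
apply/esym/m2P; rewrite /=; try ring.
  transitivity (1 + (x + y) * a + x * y * (a * a + b * c)); first by ring.
  by rewrite aa mulr0 addr0.
transitivity (1 + (x + y) * - a + x * y * (a * a + b * c)); first by ring.
by rewrite aa mulr0 addr0.
Qed.

(** * Soundness of the table check *)

Section Sound.
Variables (F : finFieldType) (K : Type) (R : arith K).
Variables (sg : {rmorphism F -> F}) (phi : K -> F) (T : table K) (m : nat).
Hypothesis IR : interprets R sg phi.
Hypothesis elems_surj : forall f : F, exists2 a, List.In a (elems T) & phi a = f.
Hypothesis checked : check_table R T m.
Implicit Types A B M : m2 K.
Local Notation G := (PSL2 F).
Local Notation ph := (map_m2 phi).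
Local Notation n := (phi (nsq T)).

Let f0 := phi0 IR.
Let f1 := phi1 IR.
Let fM := phiM IR.
Let fN := phiN IR.
Let fE := phi_eqb IR.
Let simp := (f0, f1, phiD IR, fM, fN).

Let ph_mm A B : ph (kmm R A B) = mmul (ph A) (ph B).
Proof. by apply: m2P; rewrite /= !simp. Qed.

Let ph_det A : phi (kdet R A) = mdet (ph A).
Proof. by rewrite /kdet /mdet /gen_det /= !simp. Qed.

Let ph_tr A : phi (ktr R A) = mtr (ph A).
Proof. by rewrite /ktr /mtr /gen_tr /= !simp. Qed.

Let ph_one : ph (kone R) = mone F.
Proof. by apply: m2P; rewrite /= !simp. Qed.

Let ph_adj A : ph (kadj R A) = madj (ph A).
Proof. by apply: m2P; rewrite /= ?simp. Qed.

Let ph_neg A : ph (kneg R A) = mopp (ph A).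
Proof. by apply: m2P; rewrite /= ?simp. Qed.

Let ph_x a : ph (kx R a) = companion (phi a).
Proof. by apply: m2P; rewrite /= ?simp. Qed.

Let ph_unip c A : ph (kunip R c A) = unip (phi c) (ph A).
Proof. by apply: m2P; rewrite /= !simp. Qed.

Let ph_sig A : ph (map_m2 (ksig R) A) = map_m2 sg (ph A).
Proof. by apply: m2P; rewrite /= (phi_sig IR). Qed.

Let ph_word A B w : ph (kword R A B w) = word (ph A) (ph B) w.
Proof. by elim: w => [|[] w IHw] //=; rewrite ?ph_one // ph_mm IHw. Qed.

Let keqP A B : keq R A B -> ph A = ph B.
Proof.
by rewrite /keq !fE => /and4P[/eqP e1 /eqP e2 /eqP e3 /eqP e4]; apply: m2P.
Qed.

Let keqpmP A B : reflect (eqpm (ph A) (ph B)) (keqpm R A B).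
Proof.
apply: (iffP orP) => -[].
- by move/keqP; left.
- by move/keqP; rewrite ph_neg; right.
- by move=> [e1 e2 e3 e4]; left; rewrite /keq !fE e1 e2 e3 e4 !eqxx.
- rewrite -ph_neg => -[e1 e2 e3 e4]; right.
  by rewrite /keq !fE; apply/and4P; split; apply/eqP.
Qed.

Let nzP a : nzk R a = (phi a != 0).
Proof. by rewrite /nzk fE f0. Qed.

Let ltN i k : N.ltb i (N.of_nat k) -> (N.to_nat i < k)%N.
Proof. by move/N.ltb_lt; lia. Qed.

Let arith_ok : check_arith R T. Proof. by case/and5P: checked. Qed.
Let rigid_lt : (N.to_nat (rigid T) < m)%N.
Proof. by case/and5P: checked => _ /ltN. Qed.
Let rigid_tests : check_tests R T (ent R T (rigid T)).
Proof. by case/and5P: checked. Qed.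
Let cover_ok : check_cover R T m. Proof. by case/and5P: checked. Qed.
Let entry_ok (k : nat) : (k < m)%N -> check_entry R T m (N.of_nat k).
Proof. by case/and5P: checked => _ _ _ _ H /(forall_fromP H). Qed.

Let entry_okN (k : N) : (N.to_nat k < m)%N -> check_entry R T m k.
Proof. by move/entry_ok; rewrite Nnat.N2Nat.id. Qed.

Local Notation hf i := (nth (k0 R) (halves T) i).
Local Notation el i := (nth (k0 R) (elems T) i).
Local Notation nh := (size (halves T)).

Let In_nth (s : seq K) a : List.In a s -> exists2 i, (i < size s)%N & nth (k0 R) s i = a.
Proof.
elim: s => //= b s IHs [->|/IHs[i si <-]]; first by exists 0%N.
by exists i.+1.
Qed.

Let all_In U (p : U -> bool) (s : seq U) : all p s -> forall a, List.In a s -> p a.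
Proof. by elim: s => //= b s IHs /andP[pb /IHs H] a [<-|/H]. Qed.

Let has_In U (p : U -> bool) (s : seq U) : has p s -> exists2 a, List.In a s & p a.
Proof.
elim: s => //= b s IHs /orP[pb|/IHs[a sa pa]]; first by exists b; [left|].
by exists a; [right|].
Qed.

Let half_ex (f : F) : exists2 i, (i < nh)%N & f = phi (hf i) \/ f = - phi (hf i).
Proof.
have [a ea <-] := elems_surj f; case/andP: arith_ok => /all_In/(_ a ea).
case/has_In => h /In_nth[i ih <-]; rewrite !fE fN //.
by case/orP => /eqP ->; exists i => //; [left | right].
Qed.

Let half_inj i j : (i < nh)%N -> (j < nh)%N ->
  phi (hf i) = phi (hf j) \/ phi (hf i) = - phi (hf j) -> i = j.
Proof.
move=> ih jh; case/and3P: arith_ok => _ /allP H _ e; apply/eqP.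
have := H i; rewrite mem_iota /= add0n ih => /(_ isT)/allP/(_ j).
rewrite mem_iota /= add0n jh => /(_ isT).
case/orP => //; rewrite !fE fN // => /andP[/eqP n1 /eqP n2].
by case: e.
Qed.

Let elem_inj i j : (i < size (elems T))%N -> (j < size (elems T))%N ->
  phi (el i) = phi (el j) -> i = j.
Proof.
move=> ih jh e; case/and4P: arith_ok => _ _ /allP H _; apply/eqP.
have := H i; rewrite mem_iota /= add0n ih => /(_ isT)/allP/(_ j).
rewrite mem_iota /= add0n jh => /(_ isT).
by case/orP => //; rewrite fE e eqxx.
Qed.

Let elem_half i : (i < nh)%N -> phi (el i) = phi (hf i).
Proof.
move=> ih; case/and5P: arith_ok => _ _ _ /allP/(_ i) + _; rewrite mem_iota /= add0n ih.
by move/(_ isT); rewrite fE => /eqP.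
Qed.

Let arith_tail : [/\ (uni T < nh)%N, phi (hf (uni T)) = 2%:R, (2%:R : F) != 0 &
  n * phi (ninv T) = 1].
Proof.
case/and5P: arith_ok => _ _ _ _ /and5P[u1]; rewrite nzP !fE !simp -natr1.
move=> /eqP -> nz _ /and3P[_ /eqP -> _]; split=> //.
Qed.

Let n_neq0 : n != 0.
Proof.
by case: arith_tail => _ _ _; apply: contra_eq_neq => ->; rewrite mul0r eq_sym oner_neq0.
Qed.

Let ninvE : phi (ninv T) = n^-1.
Proof. by case: arith_tail => _ _ _ e; apply: (mulfI n_neq0); rewrite e mulfV. Qed.

Let ph_dconj A : ph (kdconj R T A) = dconj n (ph A).
Proof. by apply: m2P; rewrite /= ?simp ?ninvE. Qed.

Let four_neq0 : (4%:R : F) != 0.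
Proof. by case: arith_tail => _ _ two _; rewrite (natrM _ 2 2) mulf_neq0. Qed.

Let nonsquare (b : F) : n != b ^+ 2.
Proof.
have [a ea <-] := elems_surj b.
case/and5P: arith_ok => _ _ _ _ /and5P[_ _ _ _ /and4P[_ _ /all_In/(_ a ea)]].
by rewrite fE fM.
Qed.

Let square_class (b : F) : exists r, b = r ^+ 2 \/ b = n * r ^+ 2.
Proof.
have [a ea <-] := elems_surj b.
case/and5P: arith_ok => _ _ _ _ /and5P[_ _ _ _ /and5P[_ _ _ /all_In/(_ a ea)]].
case/has_In=> r _; rewrite !fE !fM // => /orP[]/eqP e _; exists (phi r).
  by left.
by right; rewrite e.
Qed.

Let twist_ok i : (i < nh)%N -> i != uni T -> exists (M : m2 F) (r : F),
  [/\ r != 0, mdet M = r ^+ 2 & mmul M (companion (phi (hf i))) =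
      mmul (dconj n (companion (phi (hf i)))) M].
Proof.
move=> ih iu.
case/and5P: arith_ok => _ _ _ _ /and5P[_ _ _ _ /and5P[_ _ _ _ /allP/(_ i)]].
rewrite mem_iota /= add0n ih (negbTE iu) => /(_ isT) /=.
case: nth => M r /and3P[]; rewrite nzP fE fM // ph_det => r0 /eqP dM.
by move/keqP; rewrite !ph_mm ph_dconj ph_x => e; exists (ph M), (phi r).
Qed.

Definition pk (b : bool) (X : m2 F) := if b then dconj n X else X.
Definition xk (k : N) := companion (phi (tr_half R T (e_a (ent R T k)))).
Definition yk (k : N) := ph (e_y (ent R T k)).
Definition reps (k : N) (b : bool) : coset_of 'Z(SL2 F)%g * coset_of 'Z(SL2 F)%g :=
  prj2 (pk b (xk k)) (pk b (yk k)).

Let det_companion (a : F) : mdet (companion a) = 1.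
Proof. by rewrite /mdet /gen_det /=; ring. Qed.

Let dxk k : mdet (xk k) = 1. Proof. exact: det_companion. Qed.

Let det_pk b X : mdet (pk b X) = mdet X.
Proof. by case: b; rewrite //= mdet_dconj ?n_neq0. Qed.

Let commdetE (X Y : m2 F) al be ga : mdet X = 1 -> mdet Y = 1 -> mtr X = phi al ->
  mtr Y = phi be -> mtr (mmul X Y) = phi ga ->
  phi (kcommdet R al be ga) = mdet (commm X Y).
Proof.
move=> dX dY e1 e2 e3; rewrite commm_det dX dY e1 e2 e3 /kcommdet !simp; ring.
Qed.

Let tr_companion (a : F) : mtr (companion a) = a.
Proof. by rewrite /mtr /gen_tr /= add0r. Qed.

Record good_entry (k : N) : Prop := GoodEntry {
  ge_a : (N.to_nat (e_a (ent R T k)) < nh)%N;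
  ge_b : (N.to_nat (e_b (ent R T k)) < nh)%N;
  ge_g : (N.to_nat (e_g (ent R T k)) < size (elems T))%N;
  ge_dy : mdet (yk k) = 1;
  ge_ty : mtr (yk k) = phi (tr_half R T (e_b (ent R T k)));
  ge_txy : mtr (mmul (xk k) (yk k)) = phi (tr_elem R T (e_g (ent R T k)));
  ge_irr : mdet (commm (xk k) (yk k)) != 0;
  ge_ab : (mtr (xk k) != 0) || (mtr (yk k) != 0);
  ge_ac : (mtr (xk k) != 0) || (mtr (mmul (xk k) (yk k)) != 0);
  ge_bc : (mtr (yk k) != 0) || (mtr (mmul (xk k) (yk k)) != 0);
  ge_gh : (mtr (xk k) != 0) && (mtr (yk k) != 0) \/
          (N.to_nat (e_g (ent R T k)) < nh)%N;
  ge_key : PositiveMap.find (key (ent R T k)) (keys T) = Some k;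
  ge_gen : generating G (reps k false) }.

Let entry_good (k : N) : (N.to_nat k < m)%N -> good_entry k.
Proof.
move/entry_okN; rewrite /check_entry; set e := ent R T k.
case/and5P => /and3P[/ltN ia /ltN ib /ltN ig] /and4P[+ + + +] /and4P[ab ac bc gh] kk.
rewrite !nzP in ab ac bc gh.
rewrite !fE f1 // ph_det => /eqP dy.
rewrite ph_tr => /eqP ty; rewrite ph_tr ph_mm /ex ph_x => /eqP txy.
rewrite nzP (@commdetE (xk k) (yk k)) ?tr_companion // => irr.
case/andP=> /and5P[]; rewrite !nzP ?fE ?f0 ?ph_tr ?ph_det.
move=> /eqP tN /eqP dN nN ws span _.
have gen : generating G (reps k false).
  apply: (@generating_unip _ _ _ (ph (e_n e))); rewrite ?dxk //.
    by case/orP: nN; [left | right].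
  move=> c; move: span => /(phi_span IR)/(_ (fun c => prj (unip c (ph (e_n e))) \in
    <<[set prj (xk k); prj (yk k)]>>%g)); apply.
    move=> x y Hx Hy.
    rewrite unipD //.
    by rewrite prjM ?nz1 ?mdet_unip // groupM.
  move=> c0; elim: (e_w e) ws => //= -[w d] l IHl /andP[/= hw /IHl{}IHl].
  case=> [<-|//]; move/keqpmP: hw; rewrite ph_word ph_unip ph_x -/(xk k) -/(yk k) => hw.
  rewrite -(proj2 (prj_eq _ _) hw) ?prj_word ?mdet_word ?mdet_unip //.
split=> //; rewrite ?tr_companion // ?ty ?txy //.
- by case/orP: gh => [->|/ltN gh]; [left | right].
- by case: PositiveMap.find kk => // k' /N.eqb_eq ->.
Qed.

Let reps_gen k b : (N.to_nat k < m)%N -> generating G (reps k b).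
Proof.
move/entry_good => gk; case: b; last exact: ge_gen gk.
by rewrite /reps /= -pconj_dd ?n_neq0 ?ge_dy //;
  apply/norm_generating/ge_gen; rewrite ?dd_norm ?n_neq0.
Qed.

Let flip k b : (N.to_nat k < m)%N ->
  gconj G (reps k (~~ b)) (pconj (reps k b) (dd n)).
Proof.
move/entry_good => gk; rewrite /reps pconj_dd ?n_neq0 ?det_pk ?ge_dy //.
case: b => /=; last exact: gconj_refl.
by apply: dconj2; rewrite ?n_neq0 ?ge_dy.
Qed.

Let moved_ok A B t : mdet (ph A) = 1 -> mdet (ph B) = 1 -> check_moved R T m A B t ->
  (N.to_nat t.1.1 < m)%N /\ gconj G (reps t.1.1 t.1.2) (prj2 (ph A) (ph B)).
Proof.
case: t => -[k b] M dA dB /= /and4P[/ltN km].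
rewrite fE f1 ph_det => /eqP dM /keqpmP eA /keqpmP eB; split=> //.
have gk := entry_good km.
have E Z : ph (twist_if R T b Z) = pk b (ph Z).
  by case: b {eA eB} => //=; rewrite ph_dconj.
move: eA eB; rewrite !ph_mm !E /ex ph_x -/(xk k) -/(yk k) => eA eB.
apply: (gconj_intertwined _ _ dA dB (oner_neq0 F) _ eA eB); rewrite ?det_pk ?ge_dy //.
by rewrite dM expr1n.
Qed.

Let X : finType := ('I_m * bool)%type.
Let nI (i : 'I_m) : N := N.of_nat i.
Let nI_lt (i : 'I_m) : (N.to_nat (nI i) < m)%N.
Proof. by rewrite /nI Nnat.Nat2N.id. Qed.

Definition rep (p : 'I_m * bool) := reps (N.of_nat p.1) p.2.
(** The moves commute with the twist up to conjugacy, so the table records them on untwisted pairs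
    and the twist bits add up. *)
Definition move (f : entry K -> N * bool * m2 K) (p : 'I_m * bool) : 'I_m * bool :=
  let t := f (ent R T (N.of_nat p.1)) in
  (insubd p.1 (N.to_nat t.1.1), t.1.2 (+) p.2).
Definition dflip (p : 'I_m * bool) : 'I_m * bool := (p.1, ~~ p.2).
Definition frob := move (@e_fr K).
(** The trace up to sign determines the class of the first component, except at trace 2, where the
    class splits and the twist bit tells the halves apart. *)
Definition colour (p : 'I_m * bool) : nat * bool :=
  let a := N.to_nat (e_a (ent R T (N.of_nat p.1))) in (a, (a == uni T) && p.2).

Let move_op f (op : coset_of 'Z(SL2 F)%g * coset_of 'Z(SL2 F)%g ->
    coset_of 'Z(SL2 F)%g * coset_of 'Z(SL2 F)%g) :
  (forall e, generating G e -> gconj G (pconj (op e) (dd n)) (op (pconj e (dd n)))) ->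
  (forall i : 'I_m, let t := f (ent R T (nI i)) in (N.to_nat t.1.1 < m)%N /\
     gconj G (reps t.1.1 t.1.2) (op (reps (nI i) false))) ->
  forall p, gconj G (rep (move f p)) (op (rep p)).
Proof.
move=> Hop Hf [i b]; have [tm Ht] := Hf i; rewrite /rep /move /=.
rewrite val_insubd tm Nnat.N2Nat.id -/(nI i); set t := f _ in tm Ht *.
case: b; last by rewrite addbF.
rewrite addbT; apply: gconj_trans (flip _ tm) _.
apply: gconj_trans (gconj_norm (dd_norm n_neq0) Ht) _.
have gi := entry_good (nI_lt i).
have -> : reps (nI i) true = pconj (reps (nI i) false) (dd n).
  by rewrite /reps /= -pconj_dd ?n_neq0 ?ge_dy.
by apply: Hop; apply: ge_gen.
Qed.

Let rep_gen p : generating G (rep p). Proof. exact/reps_gen/nI_lt. Qed.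

Let rep_th p : gconj G (rep (move (@e_th K) p)) ((rep p).2, (rep p).1).
Proof.
apply: (@move_op (@e_th K) (fun e => (e.2, e.1))) => [e ge|i].
  exact: gconj_refl.
have gi := entry_good (nI_lt i); have := entry_okN (nI_lt i).
case/and5P=> _ _ _ _ /and5P[_ ok _ _ _].
have := moved_ok _ _ ok; rewrite /ex ph_x -/(xk _) -/(yk _).
by rewrite ge_dy // dxk => /(_ erefl erefl).
Qed.

Let rep_de p : gconj G (rep (move (@e_de K) p)) ((rep p).2^-1 * (rep p).1^-1, (rep p).2)%g.
Proof.
apply: (@move_op (@e_de K) (fun e => (e.2^-1 * e.1^-1, e.2)%g)) => [e ge|i].
  by rewrite /pconj /= conjMg !conjVg; apply: gconj_refl.
have gi := entry_good (nI_lt i); have := entry_okN (nI_lt i).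
case/and5P=> _ _ _ _ /and5P[_ _ ok _ _].
have := moved_ok _ _ ok; rewrite ph_mm !ph_adj /ex ph_x -/(xk _) -/(yk _).
rewrite mdetM !mdet_adj ge_dy // dxk mulr1 => /(_ erefl erefl).
by rewrite /prj2 prjM ?nz1 ?mdet_adj ?ge_dy // !prjV ?ge_dy.
Qed.

(** A field automorphism preserves the class of nonsquares, so it commutes with the twist up to an
    inner automorphism. *)
Let sg_nonsquare : exists2 r, r != 0 & sg n = n * r ^+ 2.
Proof.
have [r [e|e]] := square_class (sg n).
  have [s rs] : exists s, sg s = r.
    by exists (invF (fmorph_inj sg) r); apply: f_invF.
  case/eqP: (nonsquare s); apply: (fmorph_inj sg).
  by rewrite rmorphXn /= rs.
exists r => //; apply: contraNneq n_neq0 => r0.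
by rewrite -(fmorph_eq0 sg) e r0 expr0n mulr0.
Qed.

Let rep_fr : exists2 a, a \in Aut G &
  forall p, gconj G (rep (frob p)) (paut a (rep p)).
Proof.
have [a Aa aE] := frob_aut sg; exists a => // p.
apply: (@move_op (@e_fr K) (paut a)) => [e ge|i].
  have [/PSLP[U dU eU] /PSLP[V dV eV]] := generating_mem ge.
  have -> : e = prj2 U V by rewrite /prj2 eU eV; case: (e).
  have dsU : mdet (map_m2 sg U) = 1 by rewrite map_mdet dU rmorph1.
  have dsV : mdet (map_m2 sg V) = 1 by rewrite map_mdet dV rmorph1.
  rewrite pconj_dd ?n_neq0 // /paut /= !aE ?mdet_dconj ?n_neq0 //.
  rewrite -!/(prj2 _ _) pconj_dd ?n_neq0 //.
  have [r r0 er] := sg_nonsquare; have n0 := n_neq0.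
  have d1 : mdet (M2 r 0 0 r^-1) = 1 ^+ 2 by rewrite /mdet /gen_det /=; field.
  apply: (gconj_intertwined _ _ _ _ (oner_neq0 F) d1);
    rewrite ?map_mdet ?mdet_dconj ?n_neq0 ?dU ?dV ?rmorph1 //;
    by left; apply: m2P; rewrite /= ?rmorphM ?fmorphV ?er; field; rewrite ?r0 ?n0.
have gi := entry_good (nI_lt i); have := entry_okN (nI_lt i).
case/and5P=> _ _ _ _ /and5P[_ _ _ ok _].
have := moved_ok _ _ ok; rewrite !ph_sig /ex ph_x -/(xk _) -/(yk _).
rewrite !map_mdet ge_dy // dxk rmorph1 => /(_ erefl erefl).
by rewrite /paut /= !aE ?ge_dy.
Qed.

Let rep_dflip : exists2 a, a \in Aut G &
  forall p, gconj G (rep (dflip p)) (paut a (rep p)).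
Proof.
have [a Aa aE] := dconj_aut n_neq0; exists a => // -[i b].
apply: gconj_trans (flip b (nI_lt i)) _; have gi := entry_good (nI_lt i).
rewrite /rep /= /reps pconj_dd ?n_neq0 ?det_pk ?ge_dy // /paut /=.
by rewrite !aE ?det_pk ?ge_dy //; apply: gconj_refl.
Qed.

(** The classes of outer automorphisms when [sg] and the twist generate them. For a prime field [sg]
    is the identity, and [frob] acts trivially. *)
Definition auts : seq ('I_m * bool -> 'I_m * bool) :=
  [:: id; dflip; frob; frob \o dflip].

Let table_aut t : List.In t auts -> exists2 a, a \in Aut G &
  forall p, gconj G (rep (t p)) (paut a (rep p)).
Proof.
have [a Aa aE] := rep_fr; have [b Ab bE] := rep_dflip.
case=> [<-|[<-|[<-|[<-|//]]]].
- exists 1%g; first exact: group1.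
  by move=> p; rewrite /paut !perm1 -surjective_pairing; apply: gconj_refl.
- by exists b.
- by exists a.
exists (b * a)%g => [|p]; first exact: groupM.
apply: gconj_trans (aE _) _; rewrite /paut !permM.
exact: gconj_paut (bE p).
Qed.

Let half_lift (g : coset_of 'Z(SL2 F)%g) : g \in G ->
  exists (A : m2 F) i, [/\ mdet A = 1, prj A = g,
  (i < nh)%N & mtr A = phi (hf i)].
Proof.
case/PSLP=> A dA eA; have [i ih [e|e]] := half_ex (mtr A); first by exists A, i.
by exists (mopp A), i; rewrite mdet_opp prj_opp // mtr_opp e opprK.
Qed.

Let triple_lift e : generating G e -> exists (A B : m2 F) a b c,
  [/\ [/\ mdet A = 1, mdet B = 1 & e = prj2 A B], List.In (a, b, c) (triples R T) &
    [/\ mtr A = phi a, mtr B = phi b & mtr (mmul A B) = phi c]].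
Proof.
move=> ge; have [G1 G2] := generating_mem ge.
have [A [i [dA eA ih tA]]] := half_lift G1; have [B [j [dB eB jh tB]]] := half_lift G2.
have ee : e = prj2 A B by rewrite /prj2 eA eB; case: (e).
have inN (s : seq K) k : (k < size s)%N -> List.In (nth (k0 R) s k) s.
  by elim: s k => //= x s IHs [|k] /=; [left | right; apply: IHs].
have inF (U V : Type) (f : U -> seq V) s x y : List.In x s -> List.In y (f x) ->
    List.In y (flatten (map f s)).
  elim: s => //= z s IHs [->|/IHs{}IHs] xy; apply/List.in_app_iff; [by left|].
  by right; apply: IHs.
have intr c : List.In c (if nzk R (hf i) && nzk R (hf j) then elems T else halves T) ->
    List.In (hf i, hf j, c) (triples R T).
  move=> Hc; apply: (inF _ _ _ _ (hf i)); first exact: inN.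
  apply: (inF _ _ _ _ (hf j)); first exact: inN.
  by apply: List.in_map.
have [nz|z] := boolP (nzk R (hf i) && nzk R (hf j)).
  have [c Hc e3] := elems_surj (mtr (mmul A B)).
  by exists A, B, (hf i), (hf j), c; split=> //; apply: intr; rewrite nz.
have [k kh e3] := half_ex (mtr (mmul A B)).
have intk : List.In (hf i, hf j, hf k) (triples R T).
  by apply: intr; rewrite (negbTE z); apply: inN.
case: e3 => e3; first by exists A, B, (hf i), (hf j), (hf k).
(* Negating a lift of trace zero changes only the trace of the product. *)
move: z; rewrite !nzP negb_and !negbK => /orP[] /eqP z0.
  exists (mopp A), B, (hf i), (hf j), (hf k).
  by rewrite mdet_opp mtr_opp mmul_opp mtr_opp e3 opprK tA z0 oppr0 /prj2 prj_opp.
exists A, (mopp B), (hf i), (hf j), (hf k).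
by rewrite mdet_opp mtr_opp mmulr_opp mtr_opp e3 opprK tB z0 oppr0 /prj2 prj_opp.
Qed.

Let cert_ex t : List.In t (triples R T) -> exists c, check_cert R T m t.1.1 t.1.2 t.2 c.
Proof.
move: cover_ok; rewrite /check_cover; elim: (triples R T) (covering T) => //= x s IHs.
by case=> // c l /andP[xc /IHs{}IHs] [<-|//]; exists c.
Qed.

Let m2eta (Z : m2 F) : M2 (m11 Z) (m12 Z) (m21 Z) (m22 Z) = Z. Proof. by case: Z. Qed.

Let macbeath' (A B Y : m2 F) (a : F) : mdet A = 1 -> mdet B = 1 -> mdet Y = 1 ->
  mtr A = a -> mtr B = mtr Y -> mtr (mmul A B) = mtr (mmul (companion a) Y) ->
  mdet (commm A B) != 0 -> exists M : m2 F, [/\ mdet M != 0,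
    mmul M (companion a) = mmul A M & mmul M Y = mmul B M].
Proof.
move=> dA dB dY <- e2 e3 irr; rewrite -(m2eta Y).
by apply: macbeath; rewrite ?m2eta.
Qed.

Let rep_ex e : generating G e -> exists p, gconj G (rep p) e.
Proof.
move=> ge; have [A [B [a [b [c [[dA dB ee] tin [tA tB tAB]]]]]]] := triple_lift ge.
have irr : mdet (commm A B) != 0 by apply: generating_irreducible; rewrite -?ee.
have [[|k|y L U]] := cert_ex tin => /=.
- by rewrite fE f0 (@commdetE A B) // (negbTE irr).
- rewrite !fE => /and4P[/ltN km /eqP ea /eqP eb /eqP ec].
  have gk := entry_good km.
  have [|||M [nM MX MY]] := @macbeath' A B (yk k) (mtr (xk k)) dA dB (ge_dy gk) _ _ _ irr.
  + by rewrite tA ea tr_companion.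
  + by rewrite tB eb ge_ty.
  + by rewrite tAB ec tr_companion -(ge_txy gk).
  rewrite tr_companion -/(xk k) in MX.
  have kO : N.of_nat (Ordinal km) = k by rewrite /= Nnat.N2Nat.id.
  (* The square class of the determinant decides between the entry and its twist. *)
  have [r [er|er]] := square_class (mdet M).
    exists (Ordinal km, false); rewrite /rep kO ee /reps /=.
    apply: (gconj_intertwined _ _ dA dB _ er); rewrite ?ge_dy //; try by left.
    by apply: contraNneq nM => r0; rewrite er r0 expr0n.
  exists (Ordinal km, true); rewrite /rep kO ee /reps /=.
  have r0 : n * r != 0.
    by rewrite mulf_neq0 ?n_neq0 //; apply: contraNneq nM => r0; rewrite er r0 expr0n mulr0.
  have d2 : mdet (mmul M (madj (dmx n))) = (n * r) ^+ 2.
    by rewrite mdetM mdet_adj mdet_dmx er; ring.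
  have E Z V : mmul M Z = mmul V M ->
      mmul (mmul M (madj (dmx n))) (dconj n Z) = mmul V (mmul M (madj (dmx n))).
    move=> eZ; rewrite mmulA -eZ -!mmulA; congr mmul; have := n_neq0 => n0.
    by apply: m2P; rewrite /=; field.
  by apply: (gconj_intertwined _ _ dA dB r0 d2); rewrite ?mdet_dconj ?n_neq0 ?ge_dy //;
    left; apply: E.
case/and5P=> /and5P[+ + + + /has_In[I0 I0L /keqP eI]].
rewrite !fE f1 !ph_det !ph_tr ph_mm ph_x => /eqP dy /eqP ty /eqP txy /eqP dU dL LX LY LU.
have [M [nM MX MY]] := @macbeath' A B (ph y) (phi a) dA dB dy tA (etrans tB (esym ty))
  (etrans tAB (esym txy)) irr.
(* The pair is conjugate under GL2 to the model of the certificate, whose closed list shows that it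
   does not generate. *)
have := ge; rewrite ee -(intertwiner_generating _ dy dA dB nM MX MY) ?det_companion //.
have inm V : List.In V (map ph L) -> exists2 A0, List.In A0 L & ph A0 = V.
  by case/List.in_map_iff => A0 [<- ?]; exists A0.
suff /negbTE -> : ~~ generating G (prj2 (companion (phi a)) (ph y)) by [].
apply: (@not_generating_closed _ _ _ (map ph L) (ph U)) => //.
- move=> V /inm[A0 A0L <-]; rewrite -ph_det; apply/eqP; rewrite -f1 -fE.
  exact: all_In dL _ A0L.
- by rewrite -ph_one eI; apply: List.in_map.
- move=> V /inm[A0 A0L <-]; have /has_In[B0 B0L /keqpmP] := all_In LX A0L.
  by rewrite ph_mm ph_x => ?; exists (ph B0) => //; apply: List.in_map.
- move=> V /inm[A0 A0L <-]; have /has_In[B0 B0L /keqpmP] := all_In LY A0L.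
  by rewrite ph_mm => ?; exists (ph B0) => //; apply: List.in_map.
by move=> V /inm[A0 A0L <-] /keqpmP; apply/negP; apply: all_In LU _ A0L.
Qed.

Let mtr_pk b Z : mtr (pk b Z) = mtr Z. Proof. by case: b. Qed.

Let pkM b Y Z : mmul (pk b Y) (pk b Z) = pk b (mmul Y Z).
Proof. by case: b => //=; rewrite dconjM ?n_neq0. Qed.

Let neg0 (z : F) : z = - z -> z = 0.
Proof.
move/eqP; rewrite -subr_eq0 opprK -mulr2n -mulr_natl mulf_eq0.
by case: arith_tail => _ _ /negbTE -> _ /eqP.
Qed.

Let signE (c : bool) (x y : F) : x = (-1) ^+ c * y -> x = y \/ x = - y.
Proof. by case: c; rewrite ?mulN1r ?mul1r; [right | left]. Qed.

(** Conjugate pairs have the same traces up to compatible signs, hence the same key and the same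
    entry; [companion_not_dconj] separates the two twists. *)
Let rep_uniq p q : gconj G (rep p) (rep q) -> p = q.
Proof.
case: p q => i b [j c] pq.
have gi := entry_good (nI_lt i); have gj := entry_good (nI_lt j).
have := pq; rewrite /rep /reps /= -/(nI i) -/(nI j).
case/gconj_traces; rewrite ?det_pk ?dxk ?ge_dy // => M [s [t [_ [_ tX] [_ tY]]]].
move: tX tY; rewrite !pkM !mtr_pk => tX tY tXY.
have eA : N.to_nat (e_a (ent R T (nI i))) = N.to_nat (e_a (ent R T (nI j))).
  apply: half_inj (ge_a gi) (ge_a gj) _.
  by apply: signE; move: tX; rewrite /xk !tr_companion => ->.
have eB : N.to_nat (e_b (ent R T (nI i))) = N.to_nat (e_b (ent R T (nI j))).
  apply: half_inj (ge_b gi) (ge_b gj) _.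
  by apply: signE; move: tY; rewrite !ge_ty // => ->.
have xij : xk (nI i) = xk (nI j) by rewrite /xk /tr_half eA.
have yij : mtr (yk (nI i)) = mtr (yk (nI j)) by rewrite !ge_ty // /tr_half eB.
have eG : N.to_nat (e_g (ent R T (nI i))) = N.to_nat (e_g (ent R T (nI j))).
  move: tXY; rewrite !ge_txy //.
  have [st|st] := boolP (s (+) t); last first.
    by rewrite expr0 mul1r; apply: elem_inj (ge_g gi) (ge_g gj).
  rewrite expr1 mulN1r => tXY.
  (* A sign on the third trace means a sign on exactly one generator, whose trace then vanishes; in
     that case the third trace was chosen among the halves. *)
  have z : ~~ ((mtr (xk (nI i)) != 0) && (mtr (yk (nI i)) != 0)).
    rewrite negb_and !negbK; case: s st tX => [_ tX|/= tt _]; apply/orP.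
      by left; apply/eqP/neg0; rewrite {1}tX xij expr1 mulN1r.
    by right; apply/eqP/neg0; move: tY; rewrite tt {1}yij expr1 mulN1r yij.
  have z' : ~~ ((mtr (xk (nI j)) != 0) && (mtr (yk (nI j)) != 0)) by rewrite -xij -yij.
  have gih : (N.to_nat (e_g (ent R T (nI i))) < nh)%N.
    by case: (ge_gh gi) => // h; rewrite h in z.
  have gjh : (N.to_nat (e_g (ent R T (nI j))) < nh)%N.
    by case: (ge_gh gj) => // h; rewrite h in z'.
  by apply: half_inj => //; right; rewrite -!elem_half.
have nij : nI i = nI j.
  have : PositiveMap.find (key (ent R T (nI i))) (keys T) =
         PositiveMap.find (key (ent R T (nI j))) (keys T).
    by rewrite /key (Nnat.N2Nat.inj _ _ eA) (Nnat.N2Nat.inj _ _ eB)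
      (Nnat.N2Nat.inj _ _ eG).
  by rewrite !ge_key // => -[].
have ij : i = j by apply/val_inj/Nnat.Nat2N.inj.
congr pair => //; subst j.
have no := @companion_not_dconj _ (phi (tr_half R T (e_a (ent R T (nI i))))) (yk (nI i))
  n n_neq0 nonsquare (det_companion _) (ge_dy gi).
have [_ _ two _] := arith_tail.
have {}no := no two (ge_irr gi).
move: (ge_ab gi) (ge_ac gi) (ge_bc gi); rewrite tr_companion => ab ac bc.
have {no} := no ab ac bc; rewrite -/(reps (nI i) false) -/(reps (nI i) true).
case: b c pq {tX tY tXY} => -[] // pq no; case: no => //.
exact: gconj_sym.
Qed.

Let colE p q : (colour p == colour q) = ((rep q).1 \in (rep p).1 ^: G)%g.
Proof.
case: p q => i b [j c]; rewrite /colour /rep /reps /= -/(nI i) -/(nI j).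
have gi := entry_good (nI_lt i); have gj := entry_good (nI_lt j).
have dist a : (N.to_nat a < nh)%N ->
    (prj (dconj n (companion (phi (tr_half R T a)))) \in
      prj (companion (phi (tr_half R T a))) ^: G)%g = (N.to_nat a != uni T).
  move=> ah; have [au|au] := eqVneq (N.to_nat a) (uni T).
    have [_ e2 _ _] := arith_tail; rewrite /tr_half au e2; apply/negbTE.
    by apply: unipotent_not_dconj n_neq0 nonsquare four_neq0.
  have [M [r [r0 dM eM]]] := twist_ok ah au.
  by apply: (class_intertwiner _ _ r0 dM eM); rewrite ?mdet_dconj ?n_neq0 ?det_companion.
apply/eqP/idP => [[ea eb]|cl].
  have -> : xk (nI j) = xk (nI i) by rewrite /xk /tr_half ea.
  have := dist _ (ge_a gi); rewrite -/(xk (nI i)); move: eb; rewrite -ea.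
  case: (_ == uni T) => /=.
    by move=> -> _; apply: class_refl.
  by case: b c => -[] _ H; rewrite ?class_refl //= class_sym.
have eA : N.to_nat (e_a (ent R T (nI i))) = N.to_nat (e_a (ent R T (nI j))).
  apply: half_inj (ge_a gi) (ge_a gj) _.
  have := class_trace _ _ cl; rewrite !det_pk !mtr_pk !dxk /xk !tr_companion.
  by case=> // ->; [left | right; rewrite opprK].
move: cl; have -> : xk (nI j) = xk (nI i) by rewrite /xk /tr_half eA.
have := dist _ (ge_a gi); rewrite -/(xk (nI i)) -eA.
case: (N.to_nat _ == uni T) => //= H.
by case: b; case: c => //=; [rewrite class_sym H | rewrite H].
Qed.

Let gword (e : coset_of 'Z(SL2 F)%g * coset_of 'Z(SL2 F)%g) (w : seq bool) :=
  foldr (fun b z => ((if b then e.2 else e.1) * z)%g) 1%g w.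

Let gwordE Y Z w : mdet Y = 1 -> mdet Z = 1 -> gword (prj2 Y Z) w = prj (word Y Z w).
Proof.
move=> dY dZ; elim: w => [|b w IHw] /=; first by rewrite prj1.
by rewrite IHw prjM ?nz1 ?mdet_word //; case: b.
Qed.

Let gword_conj e g w : gword (pconj e g) w = (gword e w ^ g)%g.
Proof.
elim: w => [|b w IHw] /=; first by rewrite conj1g.
by rewrite IHw conjMg; case: b.
Qed.

Let gword_aut a e w : a \in Aut G -> generating G e ->
  gword (paut a e) w = a (gword e w) /\ gword e w \in G.
Proof.
move=> Aa ge; have [G1 G2] := generating_mem ge.
elim: w => [|b w [IHw Gw]] /=.
  by rewrite group1; have := morph1 (autm_morphism Aa); rewrite /= autmE.
have Gb : (if b then e.2 else e.1) \in G by case: b.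
by rewrite groupM // IHw (autGM Aa) //; case: (b).
Qed.

Let tests_rep k b : (N.to_nat k < m)%N ->
  all (fun w => gword (reps k b) w == 1%g) (tests T) = check_tests R T (ent R T k).
Proof.
move=> km; have gk := entry_good km; apply: eq_all => w.
have -> : (gword (reps k b) w == 1%g) = (gword (reps k false) w == 1%g).
  case: b; last exact: erefl.
  have -> : reps k true = pconj (reps k false) (dd n).
    by rewrite /reps /= pconj_dd ?n_neq0 ?ge_dy.
  by rewrite gword_conj conjg_eq1.
rewrite gwordE ?ge_dy ?det_pk ?dxk //.
have dw : mdet (word (xk k) (yk k) w) = 1 by rewrite mdet_word ?ge_dy.
have E : ph (kword R (ex R T (ent R T k)) (e_y (ent R T k)) w) = word (xk k) (yk k) w.
  by rewrite ph_word /ex ph_x.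
apply/eqP/idP => [/(proj1 (prj_eq1 dw)) e|/keqpmP].
  by apply/keqpmP; rewrite E ph_one.
by rewrite E ph_one => /(proj2 (prj_eq1 dw)).
Qed.

(** The image of the rigid pair satisfies the same relations, so the table makes it conjugate to the
    image under a listed automorphism. The two automorphisms then differ by an inner one, because
    the rigid pair generates. *)
Let aut_table a : a \in Aut G -> exists2 t, List.In t auts &
  forall p, gconj G (rep (t p)) (paut a (rep p)).
Proof.
move=> Aa; pose i0 := Ordinal rigid_lt.
have i0E : nI i0 = rigid T by rewrite /nI /= Nnat.N2Nat.id.
pose e0 := rep (i0, false); have ge0 : generating G e0 by apply: rep_gen.
have gae := paut_generating Aa ge0.
have [[k b] Hk] := rep_ex gae.
have tk : check_tests R T (ent R T (nI k)).
  rewrite -(@tests_rep (nI k) b) ?nI_lt //.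
  move: rigid_tests; rewrite -(@tests_rep _ false rigid_lt) => /allP H.
  apply/allP => w wT; have := H w wT.
  have [g Gg e] := gconj_sym Hk; rewrite -/(rep (k, b)) e gword_conj conjg_eq1.
  have [-> _] := gword_aut w Aa ge0.
  rewrite /e0 /rep /= -/(nI i0) i0E => /eqP ->.
  by have := morph1 (autm_morphism Aa); rewrite /= autmE => ->.
have [t lt et] : exists2 t, List.In t auts & t (i0, false) = (k, b).
  have := entry_okN (nI_lt k); case/and5P=> _ _ _ _ /and5P[_ _ _ _ /implyP/(_ tk)].
  have key0 j : N.of_nat (val j) = N.of_nat (val k) -> j = k.
    by move=> e; apply/val_inj/Nnat.Nat2N.inj.
  case/orP => /N.eqb_eq ek.
    have ik : i0 = k by apply: key0; rewrite -/(nI i0) -/(nI k) i0E ek.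
    case: b {Hk}; [exists dflip | exists id]; rewrite /auts /= ?ik //; by [left | right; left].
  have fr0 : frob (i0, false) = (k, (e_fr (ent R T (rigid T))).1.2).
    rewrite /frob /move /= -/(nI i0) i0E addbF; congr pair; apply: val_inj.
    rewrite val_insubd -ek /nI Nnat.Nat2N.id ltn_ord //.
  have [eb|nb] := eqVneq b (e_fr (ent R T (rigid T))).1.2.
    by exists frob; [right; right; left | rewrite fr0 eb].
  exists (frob \o dflip); first by right; right; right; left.
  move: fr0; rewrite /frob /move /= addbF => -[-> _]; congr pair.
  by rewrite -/(nI i0) i0E addbT; case: b nb {Hk} => -[] //; case: (e_fr _) => -[? []].
have [c Ac cE] := table_aut lt; exists t => // p.
have [g Gg eg] : gconj G (paut c e0) (paut a e0).
  by apply: gconj_trans (gconj_sym (cE _)) _; rewrite et.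
apply: gconj_trans (cE p) _; exists g => //.
have gen z : z \in G -> a z = (c z ^ g)%g.
  move=> Gz; have [q <-] := ev_surj ge0 Gz.
  by rewrite -(ev_paut q Aa ge0) eg ev_pconj ?paut_generating // ev_paut.
by have [G1 G2] := generating_mem (rep_gen p); rewrite /paut /pconj !gen.
Qed.

Lemma rigid_lt_m : (N.to_nat (rigid T) < m)%N. Proof. exact: rigid_lt. Qed.

Lemma moved_lt k : (N.to_nat k < m)%N -> let e := ent R T k in
  [/\ N.to_nat (e_th e).1.1 < m, N.to_nat (e_de e).1.1 < m
    & N.to_nat (e_fr e).1.1 < m]%N.
Proof.
move/entry_okN; have lt A B t : check_moved R T m A B t -> (N.to_nat t.1.1 < m)%N.
  by case: t => -[k' b] M /= /and4P[/ltN].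
by case/and5P=> _ _ _ _ /and5P[_ /lt ? /lt ? /lt ? _].
Qed.

Theorem table_isog : (5 < #|F|)%N -> GT1 G \isog
  equivariant_perms [:: move (@e_th K), move (@e_de K) & auts] colour.
Proof.
move=> F6; have [s [s0 s4]] := exists_fourth_power (or_intror F6).
apply: (@GT1_isog_perms _ G (PSL_simple s0 s4) (PSL_nonabelian F) _ _ rep).
- exact: rep_gen.
- exact: rep_ex.
- exact: rep_uniq.
- exact: rep_th.
- exact: rep_de.
- exact: aut_table.
- exact: table_aut.
- exact: colE.
Qed.

End Sound.

(** * Labelled orbits *)

Local Close Scope ring_scope.

Definition npt := (N * bool)%type.

(* A block is an orbit of the centralizer, spread over the corners of a square
   (with repetitions if it is smaller). It is obtained from its base block by a
   word in the moves: [l_word] takes the corner [l_start] of the base block to the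
   labelled point, which is the corner [l_pos] of its own block. *)
Record block := Block {
  b_pt : npt * npt * npt * npt; b_shape : orbit_shape; b_base : N }.

Record label := Label {
  l_block : N; l_pos : corner; l_word : seq nat; l_start : corner }.

Record labels := Labels {
  blocks : PositiveMap.t block; points : PositiveMap.t (label * label);
  words : seq (seq nat); signatures : PositiveMap.t N;
  c2_blocks : seq N; d8_blocks : seq N }.

Definition corners : seq corner :=
  [:: (false, false); (true, false); (false, true); (true, true)].

Definition shape_eqb (l l' : orbit_shape) : bool :=
  match l, l' with
  | Point, Point => true
  | Pair j, Pair j' => j == j'
  | Rect j k, Rect j' k' => (j == j') && (k == k')
  | Square j, Square j' => j == j'
  | _, _ => false
  end.

Section CheckLabels.
Variables (K : Type) (R : arith K) (T : table K) (L : labels) (m a b : nat).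

Definition npt_eqb (x y : npt) := N.eqb x.1 y.1 && (x.2 == y.2).

Definition nmove (f : entry K -> N * bool * m2 K) (x : npt) : npt :=
  let t := f (ent R T x.1) in (t.1.1, t.1.2 (+) x.2).

Definition nflip (x : npt) : npt := (x.1, ~~ x.2).

Definition ngens : seq (npt -> npt) :=
  [:: nmove (@e_th K); nmove (@e_de K); id; nflip; nmove (@e_fr K);
      nmove (@e_fr K) \o nflip].

Definition nword (w : seq nat) (x : npt) : npt :=
  foldr (fun i y => nth id ngens i y) x w.

Definition ncolour (x : npt) : N :=
  let c := e_a (ent R T x.1) in
  N.add (N.double c) (if N.eqb c (N.of_nat (uni T)) && x.2 then 1%num else 0%num).

(** The colours of x and of its images under theta and delta, packed in base 64, followed by one bit
    for each word telling whether it fixes x. The centralizer preserves all this, and [check_label]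
    requires it to determine the block; hence orbits stay inside blocks. *)
Definition signature (x : npt) : positive :=
  N.succ_pos (foldl (fun s w => N.add (N.double s)
      (if npt_eqb (nword w x) x then 1%num else 0%num))
    (N.add (ncolour x) (N.mul 64 (N.add (ncolour (nword [:: 0] x))
      (N.mul 64 (ncolour (nword [:: 1] x)))))) (words L)).

Definition dummy_block := Block (0%num, false, (0%num, false), (0%num, false),
  (0%num, false)) Point 0%num.
Definition dummy_label := Label 0%num (false, false) [::] (false, false).

Definition blk (i : N) : block :=
  if PositiveMap.find (N.succ_pos i) (blocks L) is Some B then B else dummy_block.

Definition lab (x : npt) : label :=
  if PositiveMap.find (N.succ_pos x.1) (points L) is Some l
  then (if x.2 then l.2 else l.1) else dummy_label.

Definition bpt (B : block) (p : corner) : npt :=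
  let: (x, y, z, t) := b_pt B in
  if p.2 then (if p.1 then t else z) else (if p.1 then y else x).

Definition nc2 (j : nat) : N := nth 0%num (c2_blocks L) j.
Definition nd8 (j : nat) : N := nth 0%num (d8_blocks L) j.

Definition in_range (x : npt) := N.ltb x.1 (N.of_nat m).

Definition check_label (x : npt) : bool :=
  let l := lab x in let B := blk (l_block l) in let s := b_shape B in
  let B0 := blk (b_base B) in
  [&& (if PositiveMap.find (signature x) (signatures L) is Some i
       then N.eqb i (l_block l) else false),
      vertex s (l_pos l) && npt_eqb (bpt B (l_pos l)) x,
      all (fun p => vertex s p ==> let y := bpt B p in let l' := lab y in
        [&& in_range y, N.eqb (l_block l') (l_block l), l_pos l' == p
          & N.eqb (ncolour y) (ncolour x)]) corners,
      all (fun g => let y := g x in let l' := lab y in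
        let B' := blk (l_block l') in let c := xorp (l_pos l) (l_pos l') in
        [&& shape_eqb (b_shape B') s, central_shift s c
          & all (fun p => vertex s p ==>
              npt_eqb (g (bpt B p)) (bpt B' (xorp c p))) corners]) ngens
    & [&& shape_eqb (b_shape B0) s && in_range (bpt B0 (false, false)),
          N.eqb (l_block (lab (bpt B0 (false, false)))) (b_base B),
          vertex s (l_start l), npt_eqb (nword (l_word l) (bpt B0 (l_start l))) x
        & match s with
          | Point => true
          | Pair j => (j < a) && N.eqb (b_base B) (nc2 j)
          | Rect j k => [&& j < a, k < a, j != k, N.eqb (b_base B) (nc2 j)
                          & N.eqb (b_base B) (nc2 k)]
          | Square j => (j < b) && N.eqb (b_base B) (nd8 j)
          end]].

(** A word in the moves is central, so realizing the shift by a word forces the centralizer to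
    commute with it on this block. *)
Definition check_shift (B : block) (c : corner) : bool :=
  has (fun w => all (fun p => npt_eqb (nword w (bpt B p)) (bpt B (xorp c p)))
    corners) (words L).

Definition check_c2 (j : nat) : bool :=
  let i := nc2 j in let B := blk i in let x := bpt B (false, false) in
  [&& in_range x, N.eqb (l_block (lab x)) i &
      match b_shape B with
      | Pair k => k == j
      | Rect k l => ((k == j) || (l == j)) && all (check_shift B) corners
      | _ => false
      end].

Definition check_d8 (j : nat) : bool :=
  let i := nd8 j in let B := blk i in let x := bpt B (false, false) in
  [&& in_range x, N.eqb (l_block (lab x)) i, shape_eqb (b_shape B) (Square j)
    & check_shift B (true, false)].

Definition check_labels : bool :=
  [&& all check_c2 (iota 0 a), all check_d8 (iota 0 b)
    & forall_from m 0%num (fun k => check_label (k, false) && check_label (k, true))].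

End CheckLabels.

(** * Soundness of the label check *)

Section Labelled.
Variables (F : finFieldType) (K : Type) (R : arith K).
Variables (sg : {rmorphism F -> F}) (phi : K -> F) (T : table K) (L : labels).
Variables (m a b : nat).
Hypothesis IR : interprets R sg phi.
Hypothesis elems_surj : forall f : F, exists2 a, List.In a (elems T) & phi a = f.
Hypothesis checked : check_table R T m.
Hypothesis labelled : check_labels R T L m a b.

Let X : finType := ('I_m * bool)%type.
Let x0 : 'I_m := Ordinal (rigid_lt_m checked).
Let emb (x : X) : npt := (N.of_nat x.1, x.2).
Let toX (t : npt) : X := (insubd x0 (N.to_nat t.1), t.2).

Let in_rangeP (t : npt) : in_range m t = (N.to_nat t.1 < m).
Proof. by rewrite /in_range; apply/N.ltb_spec0/idP; lia. Qed.

Let embK : cancel emb toX.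
Proof.
by case=> i c; rewrite /toX /emb /= Nnat.Nat2N.id; congr pair; apply: val_inj;
  rewrite val_insubd ltn_ord.
Qed.

Let toXK t : in_range m t -> emb (toX t) = t.
Proof.
rewrite in_rangeP; case: t => k c /= km; rewrite /emb /toX /= val_insubd km.
by rewrite Nnat.N2Nat.id.
Qed.

Let npt_eqP (x y : npt) : npt_eqb x y -> x = y.
Proof. by case: x y => k c [l d] /andP[/N.eqb_eq /= -> /eqP ->]. Qed.

Local Notation thX := (@move K R T m (@e_th K)).
Local Notation deX := (@move K R T m (@e_de K)).
Local Notation gensX := [:: thX, deX & auts R T m].

Let emb_move f (x : X) : (N.to_nat (f (ent R T (N.of_nat x.1))).1.1 < m) ->
  emb (move R T f x) = nmove R T f (emb x).
Proof. by move=> h; rewrite /emb /move /nmove /= val_insubd h Nnat.N2Nat.id. Qed.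

Let emb_gen i (x : X) :
  emb (nth id gensX i x) = nth id (ngens R T) i (emb x).
Proof.
have ml (j : 'I_m) : N.to_nat (N.of_nat j) < m by rewrite Nnat.Nat2N.id.
have [t1 t2 t3] := moved_lt checked (ml x.1).
case: i => [|[|[|[|[|[|i]]]]]] //; try exact: emb_move.
by rewrite /= !nth_nil.
Qed.

Let In_gens i (x : X -> X) : List.In (nth id gensX i) gensX.
Proof.
case: i => [|[|[|[|[|[|i]]]]]]; rewrite /= ?nth_nil; do ?[by left | right].
Qed.

Let gens_In g : List.In g gensX -> exists2 i, i < size (ngens R T) & g = nth id gensX i.
Proof.
by case=> [|[|[|[|[|[|//]]]]]] <-; [exists 0 | exists 1 | exists 2 | exists 3
  | exists 4 | exists 5].
Qed.

Let wordX (w : seq nat) (x : X) : X := foldr (fun i y => nth id gensX i y) x w.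

Let emb_word w x : emb (wordX w x) = nword R T w (emb x).
Proof. by elim: w => //= i w IHw; rewrite emb_gen IHw. Qed.

Let word_central w : central gensX (wordX w).
Proof.
move=> t tE x; elim: w => //= i w IHw.
by rewrite tE ?IHw //; apply: In_gens.
Qed.

Let cls x := blk L (l_block (lab L (emb x))).
Let cl (x : X) (p : corner) : X := toX (bpt (cls x) p).
Let pos (x : X) := l_pos (lab L (emb x)).
Let loc (x : X) := b_shape (cls x).
Let base (x : X) : X := toX (bpt (blk L (b_base (cls x))) (false, false)).
Let c2 j : X := toX (bpt (blk L (nc2 L j)) (false, false)).
Let d8 j : X := toX (bpt (blk L (nd8 L j)) (false, false)).

Let label_ok x : check_label R T L m a b (emb x).
Proof.
case/and3P: labelled => _ _ /forall_fromP/(_ x.1 (ltn_ord _))/andP[].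
by case: x => i [].
Qed.

Let shapeP l l' : shape_eqb l l' -> l = l'.
Proof.
case: l l' => [|j|j k|j] [|j'|j' k'|j'] //=; try by move/eqP ->.
by case/andP => /eqP -> /eqP ->.
Qed.

Let all_corners (P : corner -> bool) : all P corners -> forall p, P p.
Proof. by move=> /and5P[? ? ? ? _] [[] []]. Qed.

Let block_ok x p : vertex (loc x) p -> [/\ in_range m (bpt (cls x) p),
  l_block (lab L (bpt (cls x) p)) = l_block (lab L (emb x)),
  l_pos (lab L (bpt (cls x) p)) = p &
  ncolour R T (bpt (cls x) p) = ncolour R T (emb x)].
Proof.
move=> vp; case/and5P: (label_ok x) => _ _ /all_corners/(_ p)/implyP/(_ vp).
by move=> /and4P[? /N.eqb_eq ? /eqP ? /N.eqb_eq ?] _ _; split.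
Qed.

Let emb_cl x p : vertex (loc x) p -> emb (cl x p) = bpt (cls x) p.
Proof. by case/block_ok => r _ _ _; apply: toXK. Qed.

Let cls_cl x p : vertex (loc x) p -> cls (cl x p) = cls x.
Proof. by move=> vp; rewrite /cls emb_cl //; case: (block_ok vp) => _ ->. Qed.

Let colourE (x y : X) : ncolour R T (emb x) = ncolour R T (emb y) <-> colour R T x = colour R T y.
Proof.
rewrite /ncolour /colour /=.
set e := e_a _; set f := e_a _.
have E (c : N) : N.eqb c (N.of_nat (uni T)) = (N.to_nat c == uni T).
  by apply/N.eqb_spec/eqP; lia.
rewrite !E; split=> [|[ef]].
  move=> h; have ef : e = f by case: (_ && _) h; case: (_ && _); lia.
  rewrite ef in h *; congr pair.
  by move: h; case: (_ && _); case: (_ && _); lia.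
have -> : e = f by lia.
by move=> ->.
Qed.

Let signature_K (s : {perm X}) x : s \in equivariant_perms gensX (colour R T (m := m)) ->
  signature R T L (emb (s x)) = signature R T L (emb x).
Proof.
case/equivariant_permsP => sE sC; rewrite /signature.
have col y : ncolour R T (emb (s y)) = ncolour R T (emb y) by apply/colourE.
have sw w y : s (wordX w y) = wordX w (s y) by apply: word_central.
have nw w y : nword R T w (emb (s y)) = emb (s (wordX w y)) by rewrite sw emb_word.
rewrite !nw !col !emb_word; congr N.succ_pos.
set c := N.add _ _; elim: (words L) c => //= w l IHl c; rewrite IHl.
congr foldl; congr N.add.
have emb_eq y z : npt_eqb (emb y) (emb z) = (y == z).
  apply/idP/eqP => [/npt_eqP/(can_inj embK) //|->].
  by rewrite /npt_eqb N.eqb_refl eqxx.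
by rewrite nw -!emb_word !emb_eq (inj_eq perm_inj).
Qed.

Let c2_ok j : j < a -> check_c2 R T L m j.
Proof. by case/and3P: labelled => /allP H _ _ ja; apply: H; rewrite mem_iota. Qed.

Let d8_ok j : j < b -> check_d8 R T L m j.
Proof. by case/and3P: labelled => _ /allP H _ jb; apply: H; rewrite mem_iota. Qed.

Let has_In U (p : U -> bool) (s : seq U) : has p s -> exists2 a, List.In a s & p a.
Proof.
elim: s => //= c s IHs /orP[pc|/IHs[d sd pd]]; first by exists c; [left|].
by exists d; [right|].
Qed.

Let emb_inj : injective emb. Proof. exact: can_inj embK. Qed.

Let shift_ok i c : check_shift R T L (blk L i) c ->
  let x := toX (bpt (blk L i) (false, false)) in cls x = blk L i ->
  (forall p, vertex (b_shape (blk L i)) p) ->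
  exists2 w, central gensX w & forall p, w (cl x p) = cl x (xorp c p).
Proof.
case/has_In=> w _ /all_corners H x cx v; exists (wordX w) => [|p].
  exact: word_central.
have vp q : vertex (loc x) q by rewrite /loc cx.
by apply: emb_inj; rewrite emb_word !emb_cl // cx; apply/npt_eqP/H.
Qed.

Let c2_cls j : j < a -> cls (c2 j) = blk L (nc2 L j).
Proof.
by move/c2_ok/and3P => [r /N.eqb_eq e _]; rewrite /cls toXK // e.
Qed.

Let d8_cls j : j < b -> cls (d8 j) = blk L (nd8 L j).
Proof.
by move/d8_ok/and4P => [r /N.eqb_eq e _ _]; rewrite /cls toXK // e.
Qed.

Let base_ok x : cls (base x) = blk L (b_base (cls x)).
Proof.
case/and5P: (label_ok x) => _ _ _ _ /and5P[/andP[_ r] /N.eqb_eq e _ _ _].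
by rewrite {1}/cls toXK // e.
Qed.

Let vertex_xor l c p : vertex l c -> vertex l p -> vertex l (xorp c p).
Proof. by case: l => [|j|j k|j] //=; case: c p => -[] [] [[] []]. Qed.

Lemma labels_labelling : labelling gensX (colour R T (m := m)) a b cl pos loc base c2 d8.
Proof.
split.
- by move=> x; case/and5P: (label_ok x) => _ /andP[].
- move=> x; apply: emb_inj; case/and5P: (label_ok x) => _ /andP[vp /npt_eqP e] _ _ _.
  by rewrite emb_cl.
- by move=> x p vp; rewrite /pos emb_cl //; case: (block_ok vp).
- by move=> x p vp; rewrite /loc cls_cl.
- by move=> x p q vp vq; rewrite /cl cls_cl.
- by move=> x p vp; apply/colourE; rewrite emb_cl //; case: (block_ok vp).
- move=> s Ks x; have e := signature_K x Ks.
  case/and5P: (label_ok x); case/and5P: (label_ok (s x)); rewrite e.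
  case: PositiveMap.find => // i /N.eqb_eq i1 /andP[v /npt_eqP c] _ _ _ /N.eqb_eq i2 _ _ _ _.
  have lx : cls (s x) = cls x by rewrite /cls -i1 -i2.
  exists (pos (s x)); first by rewrite /loc -lx.
  by apply: emb_inj; rewrite emb_cl /loc -?lx // -c.
- move=> g /gens_In[i iN ->] x.
  case/and5P: (label_ok x) => _ _ _ gx _.
  have iG : List.In (nth id (ngens R T) i) (ngens R T).
    by case: i iN => [|[|[|[|[|[|i]]]]]] //= _; do ?[by left | right].
  have {iN}[es sc H] : [/\ loc (nth id gensX i x) = loc x,
      central_shift (loc x) (xorp (pos x) (pos (nth id gensX i x))) &
      forall p, vertex (loc x) p -> nth id (ngens R T) i (bpt (cls x) p) =
        bpt (cls (nth id gensX i x)) (xorp (xorp (pos x) (pos (nth id gensX i x))) p)].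
    rewrite /loc /pos /cls emb_gen.
    elim: (ngens R T) (nth id (ngens R T) i) iG gx => [|h l IHl] u; first by [].
    move=> ul; rewrite [all _ _]/(_ && all _ l) => /andP[Hh Hl].
    case: (ul : h = u \/ List.In u l) => [<-|/IHl]; last exact.
    case/and3P: Hh => /shapeP es sc /all_corners H; split=> // p vp.
    by apply: npt_eqP; have := H p; rewrite vp.
  split=> //; exists (xorp (pos x) (pos (nth id gensX i x))) => // p vp.
  apply: emb_inj; rewrite emb_gen !emb_cl ?es //; first exact: H.
  by apply: vertex_xor => //; case/andP: sc.
- by move=> x; rewrite /loc base_ok; case/and5P: (label_ok x) => _ _ _ _ /and5P[/andP[/shapeP]].
- move=> x; case/and5P: (label_ok x) => _ _ _ _ /and5P[/andP[/shapeP es _] _ vs /npt_eqP e _].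
  exists (wordX (l_word (lab L (emb x)))), (l_start (lab L (emb x))); split.
  - exact: word_central.
  - exact: vs.
  by apply: emb_inj; rewrite emb_word emb_cl /loc base_ok // es.
- move=> j jb; case/and4P: (d8_ok jb) => _ _ /shapeP es sh.
  by apply: (shift_ok sh (d8_cls jb)) => p; rewrite es.
- move=> j ja; rewrite /loc (c2_cls ja); case/and3P: (c2_ok ja) => _ _.
  case es: (b_shape _) => [|k|k l|k] // /andP[_ /all_corners sh] c.
  by apply: (shift_ok (sh c) (c2_cls ja)) => p; rewrite es.
- move=> j ja; rewrite /loc (c2_cls ja); case/and3P: (c2_ok ja) => _ _.
  case: (b_shape _) => [|k /eqP|k l /andP[/orP[]/eqP]|k] //; by [left | right].
- by move=> j jb; rewrite /loc (d8_cls jb); case/and4P: (d8_ok jb) => _ _ /shapeP.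
move=> x; case/and5P: (label_ok x) => _ _ _ _ /and5P[_ _ _ _].
rewrite /loc /base /c2 /d8 -/(cls x); case: (b_shape _) => [|j|j k|j] //.
- by case/andP => ja /N.eqb_eq ->.
- by case/and5P => ja ka /eqP jk /N.eqb_eq e1 /N.eqb_eq e2; split=> //; rewrite -?e1 -?e2.
- by case/andP => ja /N.eqb_eq ->.
Qed.

Theorem labels_isog : (5 < #|F|)%N -> GT1 (PSL2 F) \isog [set: C2D8 a b].
Proof.
move=> F6; apply: isog_trans (table_isog IR elems_surj checked F6) _.
exact: labelling_isog labels_labelling.
Qed.

End Labelled.

(** * Computing the tables *)

Section Search.
Variables (K : Type) (R : arith K) (hv el : seq K) (ns : K) (un : nat).
Variable full : seq (m2 K * seq bool) -> m2 K * seq bool ->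
  option (m2 K * seq (seq bool * K)).

Local Notation "a *k b" := (kmul R a b) (at level 40).
Local Notation "a +k b" := (kadd R a b) (at level 50).
Local Notation "a =k b" := (keqb R a b) (at level 70).

Definition kfind (a : K) : N := N.of_nat (find (keqb R a) el).
Definition kscale (c : K) (A : m2 K) := M2 (c *k m11 A) (c *k m12 A) (c *k m21 A) (c *k m22 A).
Definition kinv (a : K) : K := nth (k0 R) el (find (fun b => a *k b =k k1 R) el).
Definition ksqrt (a : K) : option K :=
  let i := find (fun b => a =k b *k b) el in
  if (i < size el)%N then Some (nth (k0 R) el i) else None.

(** For given [p] and [r] the two trace conditions determine the lower row; the determinant is then
    left to the search. *)
Definition find_y (al be ga : K) : m2 K :=
  let cand := flatten [seq [seq
      let t := be +k kopp R p in
      M2 p r (r +k al *k t +k kopp R ga) t | r <- el] | p <- el] in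
  nth (kone R) cand (find (fun y => kdet R y =k k1 R) cand).

(* The boolean connectives are strict under [vm_compute]; [if] is not. *)
Fixpoint known (A B : m2 K) (s : seq (m2 K * seq bool)) : bool :=
  if s is (C, _) :: s' then
    if (if keqb R (m11 C) (m11 A) then keq R C A else false) then true else
    if (if keqb R (m11 C) (m11 B) then keq R C B else false) then true else
    known A B s'
  else false.

(** Breadth-first enumeration, up to sign, of the generated group, stopped as soon as [full] finds
    its unipotents. An exhausted queue leaves the whole subgroup, which is also stable under right
    multiplication as [Closed] demands. *)
Fixpoint bfs (fuel : nat) (x y : m2 K) (seen front : seq (m2 K * seq bool)) :
    (m2 K * seq (seq bool * K)) + seq (m2 K) :=
  if fuel is fuel'.+1 then
    match front with
    | [::] => inr (map fst seen)
    | (A, w) :: front' =>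
        let step (b : bool) (st : option (m2 K * seq (seq bool * K)) *
            seq (m2 K * seq bool) * seq (m2 K * seq bool)) :=
          let: (r, seen, new) := st in
          if r is Some _ then st else
          let B := kmm R (if b then y else x) A in
          if known B (kneg R B) seen then st else
          (full seen (B, b :: w), (B, b :: w) :: seen, (B, b :: w) :: new) in
        let: (r, seen', new) := step true (step false (None, seen, [::])) in
        if r is Some c then inl c else bfs fuel' x y seen' (front' ++ rev new)
    end
  else inr [::].

Definition unip_part (A : m2 K) : option (m2 K) :=
  let two := k1 R +k k1 R in
  let A' := if ktr R A =k two then Some A
            else if ktr R A =k kopp R two then Some (kneg R A) else None in
  if A' is Some B then
    let C := M2 (m11 B +k kopp R (k1 R)) (m12 B) (m21 B) (m22 B +k kopp R (k1 R)) in
    if nzk R (m12 C) || nzk R (m21 C) then Some C else None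
  else None.

(* A proper subgroup without invariant line cannot contain all the upper
   transvections. *)
Definition missing (L : seq (m2 K)) : m2 K :=
  let cand := [seq M2 (k1 R) a (k0 R) (k1 R) | a <- el] in
  nth (kone R) cand (find (fun U => ~~ has (fun A => keqpm R A U) L) cand).

Definition classify (al be ga : K) : certificate K * seq (m2 K * (m2 K * seq (seq bool * K))) :=
  if kcommdet R al be ga =k k0 R then (Reducible K, [::]) else
  let y := find_y al be ga in
  (* The bound exceeds 3420, the order of PSL2 over the field with 19 elements. *)
  match bfs 4000 (kx R al) y [:: (kone R, [::])] [:: (kone R, [::])] with
  | inl c => (Listed K 0%num, [:: (y, c)])
  | inr L => (Closed y L (missing L), [::])
  end.

Fixpoint build (ts : seq (K * K * K)) (k : N) :
    seq (certificate K) * seq (N * entry K) :=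
  if ts is (al, be, ga) :: ts' then
    let: (c, e) := classify al be ga in
    match e with
    | [:: (y, (n, w))] =>
        let: (cs, es) := build ts' (N.succ k) in
        (Listed K k :: cs, (k, unmoved R (kfind al) (kfind be) (kfind ga) y n w) :: es)
    | _ => let: (cs, es) := build ts' k in (c :: cs, es)
    end
  else ([::], [::]).

Definition pre (cs : seq (certificate K)) (es : seq (N * entry K)) rg tst : table K :=
  Table hv el ns (kinv ns)
    [seq let a := nth (k0 R) hv i in
         if i == un then (kone R, k1 R) else
         let cand := flatten [seq [seq (u, v) | v <- el] | u <- el] in
         (* This is the determinant of u + v x for the companion matrix x of trace [a]. When it
            equals [ns], the matrix diag(ns, 1)(u + v x) twists x and has determinant ns^2. *)
         let d c := c.1 *k c.1 +k a *k c.1 *k c.2 +k c.2 *k c.2 in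
         let c := nth (k0 R, k0 R) cand (find (fun c => d c =k ns) cand) in
         let: (u, v) := c in
         let M := M2 (ns *k u) (kopp R (ns *k v)) v (u +k a *k v) in (M, ns)
    | i <- iota 0 (size hv)] un
    (foldr (fun ke m => PositiveMap.add (N.succ_pos ke.1) ke.2 m)
       (PositiveMap.empty _) es)
    (foldr (fun ke m => PositiveMap.add (key ke.2) ke.1 m) (PositiveMap.empty _) es)
    cs tst rg.

Section Moves.
Variable T : table K.

Definition canon (A : m2 K) : m2 K :=
  if has (keqb R (ktr R A)) hv then A else kneg R A.

Definition locate (A B : m2 K) : N * bool * m2 K :=
  let A := canon A in let B := canon B in
  let ga := ktr R (kmm R A B) in
  (* When one of the first two traces vanishes, the sign of its lift is used to bring the third
     among the halves. *)
  let z := ~~ (nzk R (ktr R A) && nzk R (ktr R B)) && ~~ has (keqb R ga) hv in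
  let: (A, B) := if z then (if nzk R (ktr R A) then (A, kneg R B) else (kneg R A, B))
                 else (A, B) in
  let i := kfind (ktr R A) in let j := kfind (ktr R B) in
  let g := kfind (ktr R (kmm R A B)) in
  let e0 := unmoved R i j g (kone R) (kone R) [::] in
  let k := if PositiveMap.find (key e0) (keys T) is Some k then k else 0%num in
  let y := e_y (ent R T k) in
  let p := m11 y in let s := m21 y in
  let z11 := m11 B +k kopp R (p +k s *k m11 A) in
  let z12 := m12 B +k kopp R (s *k m12 A) in
  let z21 := m21 B +k kopp R (s *k m21 A) in
  let z22 := m22 B +k kopp R (p +k s *k m22 A) in
  let: (v1, v2) := if nzk R z11 || nzk R z12 then (z12, kopp R z11)
                   else (z22, kopp R z21) in
  let M := M2 v1 (m11 A *k v1 +k m12 A *k v2) v2 (m21 A *k v1 +k m22 A *k v2) in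
  match ksqrt (kdet R M) with
  | Some r => (k, false, kscale (kinv r) M)
  | None =>
      (* The determinant is [ns * r^2]; multiplying by diag(1, ns), a multiple of the inverse twist,
         makes it the square of [ns * r]. *)
      let r := if ksqrt (kdet R M *k kinv ns) is Some r then r else k1 R in
      (k, true, kscale (kinv (ns *k r)) (kmm R M (M2 (k1 R) (k0 R) (k0 R) ns)))
  end.

Definition with_moves (ke : N * entry K) : N * entry K :=
  let: (k, e) := ke in
  let x := kx R (nth (k0 R) hv (N.to_nat (e_a e))) in let y := e_y e in
  (k, Entry (e_a e) (e_b e) (e_g e) y (e_n e) (e_w e) (locate y x)
    (locate (kmm R (kadj R y) (kadj R x)) y)
    (locate (map_m2 (ksig R) x) (map_m2 (ksig R) y))).

End Moves.

Definition make (rigid_triple : K * K * K) (tst : seq (seq bool)) : table K * nat :=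
  let T0 := Table hv el ns (kinv ns) [::] un (PositiveMap.empty _)
    (PositiveMap.empty _) [::] [::] 0%num in
  let: (cs, es) := build (triples R T0) 0%num in
  let T1 := pre cs es 0%num tst in
  let: (ra, rb, rc) := rigid_triple in
  let e0 := unmoved R (kfind ra) (kfind rb) (kfind rc) (kone R) (kone R) [::] in
  let k := if PositiveMap.find (key e0) (keys T1) is Some k then k else 0%num in
  (pre cs (map (with_moves T1) es) k tst, size es).

End Search.

Section SearchLabels.
Variables (K : Type) (R : arith K) (T : table K) (ws : seq (seq nat)).

Record state := State {
  s_next : N; s_a : nat; s_b : nat;
  s_blocks : seq (N * block); s_labels : PositiveMap.t label;
  s_c2 : seq N; s_d8 : seq N }.

Definition L0 := Labels (PositiveMap.empty _) (PositiveMap.empty _) ws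
  (PositiveMap.empty _) [::] [::].

Definition pkey (x : npt) : positive :=
  N.succ_pos (N.add (N.double x.1) (if x.2 then 1%num else 0%num)).

Definition all_points (m : nat) : seq npt :=
  flatten [seq [:: (N.of_nat k, false); (N.of_nat k, true)] | k <- iota 0 m].

Definition group_points (m : nat) : PositiveMap.t (seq npt) :=
  foldr (fun x M => let g := signature R T L0 x in
    PositiveMap.add g (x :: (if PositiveMap.find g M is Some l then l else [::])) M)
   (PositiveMap.empty _) (all_points m).

(** Points with equal signature form a block. Four points that are all images of one of them under
    words make a rectangle, using up two bits; otherwise the block is taken for a square, with the
    twist as its central flip. *)
Definition four (s : state) (l : seq npt) :
    npt * npt * npt * npt * orbit_shape * state :=
  let: State nx a b bs ls c d := s in
  match l with
  | [:: x] => (x, x, x, x, Point, s)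
  | [:: x; y] => (x, y, x, y, Pair a, State nx a.+1 b bs ls (nx :: c) d)
  | x :: _ =>
      let ox := filter (fun y => has (fun w => npt_eqb (nword R T w x) y) ws) l in
      let other := filter (fun y => ~~ npt_eqb x y && ~~ npt_eqb (nflip x) y) in
      if (size ox == 4)%N then
        let z := head x (other l) in
        let w := nth [::] ws (find (fun w => npt_eqb (nword R T w x) z) ws) in
        (x, nflip x, nword R T w x, nword R T w (nflip x), Rect a a.+1,
         State nx a.+2 b bs ls (nx :: nx :: c) d)
      else
        let z := head x (other l) in
        (x, nflip x, z, nflip z, Square b, State nx a b.+1 bs ls c (nx :: d))
  | [::] => ((0%num, false), (0%num, false), (0%num, false), (0%num, false), Point, s)
  end.

Definition add_block (base : N) (sh : orbit_shape) (B : block) (w : seq nat)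
    (s : state) : state :=
  let: State nx a b bs ls c d := s in
  let x := nword R T w (bpt B (false, false)) in
  if PositiveMap.find (pkey x) ls is Some _ then s else
  let B' := Block (x, nword R T w (bpt B (true, false)),
      nword R T w (bpt B (false, true)), nword R T w (bpt B (true, true))) sh base in
  let put ls p := if vertex sh p then
      PositiveMap.add (pkey (bpt B' p)) (Label nx p w p) ls else ls in
  State (N.succ nx) a b ((nx, B') :: bs) (foldl put ls corners) c d.

Definition add_point (G : PositiveMap.t (seq npt)) (s : state) (x : npt) : state :=
  if PositiveMap.find (pkey x) (s_labels s) is Some _ then s else
  let l := if PositiveMap.find (signature R T L0 x) G is Some l then l else [::] in
  let nx := s_next s in
  let: (p, q, r, t, sh, s') := four s l in
  foldl (fun s w => add_block nx sh (Block (p, q, r, t) sh nx) w s) s' ws.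

Definition make_labels (m : nat) : labels * nat * nat :=
  let G := group_points m in
  let pts := all_points m in
  let s := foldl (add_point G) (State 0%num 0 0 [::] (PositiveMap.empty _) [::] [::]) pts in
  let lb x := if PositiveMap.find (pkey x) (s_labels s) is Some l then l else dummy_label in
  (Labels (foldr (fun ib M => PositiveMap.add (N.succ_pos ib.1) ib.2 M)
            (PositiveMap.empty _) (s_blocks s))
     (foldr (fun k M => let k := N.of_nat k in
          PositiveMap.add (N.succ_pos k) (lb (k, false), lb (k, true)) M)
        (PositiveMap.empty _) (iota 0 m))
     ws
     (foldr (fun x M => PositiveMap.add (signature R T L0 x) (l_block (lb x)) M)
        (PositiveMap.empty _) pts)
     (rev (s_c2 s)) (rev (s_d8 s)), s_a s, s_b s).

End SearchLabels.

Section PrimeArith.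
Variables (p : N) (l : seq N).

(** Subtracting listed multiples of [p] replaces the costlier division: 16p, 8p, 4p, 2p and p
    suffice below 32p, hence for products of residues when [p] is at most 19. The final [N.modulo]
    makes the result correct for every [n]. *)
Definition reduce (n : N) : N :=
  if N.ltb n p then n else
  let r := foldl (fun n q => if N.ltb n q then n else N.sub n q) n l in
  if N.ltb r p then r else N.modulo r p.

Definition prime_arith : arith N := Arith 0%num 1%num
  (fun a b => reduce (N.add a b)) (fun a b => reduce (N.mul a b))
  (fun a => reduce (N.sub p (reduce a)))
  (fun a b => N.eqb (reduce a) (reduce b)) id (has (N.eqb 1%num)).

End PrimeArith.

Definition prime_full p l (seen : seq (m2 N * seq bool)) (c : m2 N * seq bool) :
    option (m2 N * seq (seq bool * N)) :=
  if unip_part (prime_arith p l) c.1 is Some C then Some (C, [:: (c.2, 1%num)]) else None.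

Definition prime_make (p : nat) (ns : N) :=
  let pN := N.of_nat p in
  let l := [seq N.mul c pN | c <- [:: 16; 8; 4; 2; 1]%num] in
  let hv := [seq N.of_nat i | i <- iota 0 (p.+1 %/ 2)] in
  let el := hv ++ [seq N.of_nat i | i <- iota (p.+1 %/ 2) (p - p.+1 %/ 2)] in
  (* The tests say that x y x is an involution and that x and y have order p. Then both traces are
     2, and tr(xyx) = tr(x) tr(xy) - tr(y) = 0 gives tr(xy) = 1, so a single entry passes. *)
  make (prime_arith pN l) hv el ns 2 (prime_full pN l) (2, 2, 1)%num
    [:: [:: false; true; false; false; true; false]; nseq p false; nseq p true].

(** Theta and delta generate modulo inner automorphisms a symmetric group on the classes of x, y and
    [y^-1 x^-1]: the six words list it, and move 3 is the twist. *)
Definition prime_words : seq (seq nat) :=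
  [seq w ++ v | v <- [:: [::]; [:: 3]], w <- [:: [::]; [:: 0]; [:: 1]; [:: 0; 1];
     [:: 1; 0]; [:: 0; 1; 0]]].

(** * Prime fields and the field with nine elements *)

Local Open Scope ring_scope.

Definition natF (F : finFieldType) (n : N) : F := (N.to_nat n)%:R.

Section NatF.
Variable F : finFieldType.
Local Notation natF := (@natF F).

Lemma natFD a b : natF (N.add a b) = natF a + natF b.
Proof. by rewrite /natF -natrD; congr _%:R; lia. Qed.

Lemma natFM a b : natF (N.mul a b) = natF a * natF b.
Proof. by rewrite /natF -natrM; congr _%:R; lia. Qed.

Lemma natF_sub a b : (b <= a)%num -> natF (N.sub a b) = natF a - natF b.
Proof. by move=> ba; apply/eqP; rewrite eq_sym subr_eq -natFD; apply/eqP; congr natF; lia. Qed.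
End NatF.

Section Prime.
Variables (F : finFieldType) (p : nat).
Hypotheses (p_prime : prime p) (pF : p \in [pchar F]).
Local Notation pN := (N.of_nat p).
Local Notation natF := (@natF F).

Lemma p_gt0 : (0 < p)%N. Proof. exact: prime_gt0. Qed.

Lemma natFp : natF pN = 0.
Proof. by rewrite /natF Nnat.Nat2N.id; apply: pcharf0. Qed.

Lemma natF_mult q : N.eqb (N.modulo q pN) 0%num -> natF q = 0.
Proof.
move/N.eqb_eq => q0; rewrite (N.div_mod q pN); last by have := p_gt0; lia.
by rewrite q0 natFD natFM natFp mul0r addr0.
Qed.

Lemma natF_inj i j : (i < p)%N -> (j < p)%N -> (i%:R : F) = j%:R -> i = j.
Proof.
wlog ij : i j / (i <= j)%N.
  by move=> H ip jp e; case/orP: (leq_total i j) => h; [|apply/esym]; apply: H.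
move=> ip jp e; have : (j - i)%:R = 0 :> F by rewrite natrB // e subrr.
move/eqP; rewrite -(dvdn_pcharf pF) => /dvdn_leq; lia.
Qed.

Lemma natF_surj (x : F) : #|F| = p -> exists2 i, (i < p)%N & x = i%:R.
Proof.
move=> cF; have inj : injective (fun i : 'I_p => (i : nat)%:R : F).
  by move=> i j /(natF_inj (ltn_ord i) (ltn_ord j)) e; apply: val_inj.
have := inj_card_onto inj; rewrite card_ord cF => /(_ (leqnn _) x)/codomP[i ->].
by exists i.
Qed.

Section Reduction.
Variable l : seq N.
Hypothesis l_mult : all (fun q => N.eqb (N.modulo q pN) 0%num) l.

Lemma natF_reduce n : natF (reduce pN l n) = natF n.
Proof.
rewrite /reduce; case: ifP => // _.
set f := (fun n q => _); set r := foldl f n l.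
have fold s k : all (fun q => N.eqb (N.modulo q pN) 0%num) s ->
    natF (foldl f k s) = natF k.
  elim: s k => //= q s IHs k /andP[q0 qs]; rewrite IHs // /f.
  case: ifP => // /N.ltb_nlt nq.
  by rewrite natF_sub; [rewrite (natF_mult q0) subr0 | lia].
rewrite -(fold l n l_mult) -/r.
case: ifP => // _; rewrite [in RHS](N.div_mod r pN); last by have := p_gt0; lia.
by rewrite natFD natFM natFp mul0r add0r.
Qed.

Lemma reduce_lt n : (N.to_nat (reduce pN l n) < p)%N.
Proof.
rewrite /reduce; have p0 := p_gt0; case: ifP => [/N.ltb_lt|_]; first by lia.
case: ifP => [/N.ltb_lt|_]; first by lia.
by have := N.mod_lt (foldl (fun n q => if N.ltb n q then n else N.sub n q) n l) pN; lia.
Qed.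

Lemma natF_eqb a b :
  N.eqb (reduce pN l a) (reduce pN l b) = (natF a == natF b).
Proof.
rewrite -(natF_reduce a) -(natF_reduce b).
apply/N.eqb_spec/eqP => [->//|/(natF_inj (reduce_lt a) (reduce_lt b))].
by lia.
Qed.

Lemma natFN a : natF (reduce pN l (N.sub pN (reduce pN l a))) = - natF a.
Proof.
rewrite natF_reduce natF_sub; last by have := reduce_lt a; lia.
by rewrite natFp natF_reduce sub0r.
Qed.

Lemma prime_interprets : #|F| = p ->
  interprets (prime_arith pN l) (idfun : {rmorphism F -> F}) natF.
Proof.
move=> cF; split=> //=.
- by move=> a b; rewrite natF_reduce natFD.
- by move=> a b; rewrite natF_reduce natFM.
- exact: natFN.
- exact: natF_eqb.
move=> cs c1 P PD Pc.
have P1 : P 1.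
  elim: cs c1 Pc => // c s IHs cs1 Pc.
  have {cs1}[/N.eqb_eq c1|/IHs{}IHs] : N.eqb 1%num c \/ has (N.eqb 1%num) s by exact/orP.
    by rewrite -[1]/(natF 1); apply: Pc; left; rewrite c1.
  by apply: IHs => d ds; apply: Pc; right.
have Pn k : P k.+1%:R by elim: k => // k IHk; rewrite -natr1; apply: PD.
move=> x; have [[|i] _ ->] := natF_surj x cF; last exact: Pn.
by have := Pn p.-1; rewrite prednK ?p_gt0 // (pcharf0 pF).
Qed.

End Reduction.
End Prime.

Theorem GT1_prime (p : N) (l : seq N) (T : table N) (L : labels) (m a b : nat) :
  prime (N.to_nat p) -> (5 < N.to_nat p)%N ->
  all (fun q => N.eqb (N.modulo q p) 0%num) l ->
  all (fun i => has (N.eqb (N.of_nat i)) (elems T)) (iota 0 (N.to_nat p)) ->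
  check_table (prime_arith p l) T m -> check_labels (prime_arith p l) T L m a b ->
  forall F : finFieldType, #|F| = N.to_nat p -> GT1 (PSL2 F) \isog [set: C2D8 a b].
Proof.
rewrite -{3 5 6}[p]Nnat.N2Nat.id; move: (N.to_nat p) => {}p pp p5 lm el ct cl F cF.
have pF : p \in [pchar F] by apply: (@card_finPcharP F p 1); rewrite ?expn1.
have IR := prime_interprets pp pF lm cF.
apply: (labels_isog IR _ ct cl); last by rewrite cF.
move=> x; have [i ip ->] := natF_surj pp pF x cF.
have /allP/(_ i) := el; rewrite mem_iota /= => /(_ ip).
elim: (elems T) => //= c s IHs /orP[/N.eqb_eq <-|/IHs[d ds e]].
  by exists (N.of_nat i); [left | rewrite /natF Nnat.Nat2N.id].
by exists d; [right|].
Qed.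

(* F_9 = F_3(i) with i^2 = -1. *)
Definition reduce3 := reduce 3 [:: 6; 3]%num.

Definition nine_arith : arith (N * N) := Arith (0, 0)%num (1, 0)%num
  (fun x y => (reduce3 (N.add x.1 y.1), reduce3 (N.add x.2 y.2)))
  (fun x y => (reduce3 (N.add (N.mul x.1 y.1) (N.mul 2 (N.mul x.2 y.2))),
               reduce3 (N.add (N.mul x.1 y.2) (N.mul x.2 y.1))))
  (fun x => (reduce3 (N.sub 3 (reduce3 x.1)), reduce3 (N.sub 3 (reduce3 x.2))))
  (fun x y => N.eqb (reduce3 x.1) (reduce3 y.1) && N.eqb (reduce3 x.2) (reduce3 y.2))
  (fun x => (x.1, reduce3 (N.sub 3 (reduce3 x.2))))
  (fun cs => has (fun c => N.eqb (reduce3 c.1) 1 && N.eqb (reduce3 c.2) 0) cs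
          && has (fun c => ~~ N.eqb (reduce3 c.2) 0) cs).

Local Arguments N.mul : simpl never.
Local Arguments N.sub : simpl never.
Local Arguments N.add : simpl never.

Section Nine.
Variable F : finFieldType.
Hypothesis cF : #|F| = 9%N.

Lemma three_F : 3%N \in [pchar F].
Proof. exact: (@card_finPcharP F 3 2). Qed.

(** Any nonzero [s] satisfies s^8 = 1; if s^4 is not 1 it is -1. *)
Lemma sqrt_minus_one : exists i : F, i * i = -1.
Proof.
have [|s [s0 s4]] := @exists_fourth_power F; first by rewrite cF; right.
exists (s ^+ 2); rewrite -expr2 -exprM.
have : (s ^+ 4 - 1) * (s ^+ 4 + 1) = 0.
  rewrite -subr_sqr expr1n -exprM; apply: (mulfI s0).
  by rewrite mulr0 mulrBr -exprS -cF expf_card mulr1 subrr.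
by move/eqP; rewrite mulf_eq0 subr_eq0 (negbTE s4) addr_eq0 => /eqP.
Qed.

Section Imaginary.
Variable i : F.
Hypothesis ii : i * i = -1.

Definition nineF (x : N * N) : F := natF F x.1 + natF F x.2 * i.

Let lm : all (fun q => N.eqb (N.modulo q (N.of_nat 3)) 0%num) [:: 6; 3]%num.
Proof. by []. Qed.

Let red3 n : natF F (reduce3 n) = natF F n.
Proof. exact: (natF_reduce (p := 3) isT three_F lm). Qed.

Let opp3 n : natF F (reduce3 (N.sub 3 (reduce3 n))) = - natF F n.
Proof. exact: (natFN (p := 3) isT three_F lm). Qed.

Let eqb3 a b : N.eqb (reduce3 a) (reduce3 b) = (natF F a == natF F b).
Proof. exact: (natF_eqb (p := 3) isT three_F lm). Qed.

Let natF0 : natF F 0 = 0. Proof. by []. Qed.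
Let natF1 : natF F 1 = 1. Proof. by []. Qed.
Let natF2 : natF F 2 = -1.
Proof. by apply/eqP; rewrite -addr_eq0 -[1]natF1 -natFD -(natFp three_F). Qed.

(** The norm form u^2 + v^2 is anisotropic modulo 3. *)
Lemma nineF0 a b : nineF (a, b) = 0 -> natF F a = 0 /\ natF F b = 0.
Proof.
rewrite /nineF /= -(red3 a) -(red3 b).
have lt3 n : (N.to_nat (reduce3 n) < 3)%N := reduce_lt (p := 3) isT three_F lm n.
have := lt3 a; have := lt3 b; rewrite /natF.
move: (N.to_nat (reduce3 a)) (N.to_nat (reduce3 b)) => u v vb ua e.
have : (u * u + v * v)%:R = 0 :> F.
  have -> : (u * u + v * v)%:R = (u%:R + v%:R * i) * (u%:R - v%:R * i) :> F.
    rewrite natrD !natrM; transitivity (u%:R * u%:R - v%:R * v%:R * (i * i) : F).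
      by rewrite ii; ring.
    by ring.
  by rewrite e mul0r.
move/eqP; rewrite -(dvdn_pcharf three_F).
by case: u ua {e} => [|[|[|]]] //; case: v vb => [|[|[|]]].
Qed.

Lemma nineF_inj x y : nineF x = nineF y ->
  natF F x.1 = natF F y.1 /\ natF F x.2 = natF F y.2.
Proof.
move=> e; pose z := (N.add x.1 (reduce3 (N.sub 3 (reduce3 y.1))),
  N.add x.2 (reduce3 (N.sub 3 (reduce3 y.2)))).
have /nineF0 : nineF z = 0.
  transitivity (nineF x - nineF y); last by rewrite e subrr.
  by rewrite /nineF /= !natFD !opp3; ring.
by rewrite !natFD !opp3 => -[/eqP + /eqP]; rewrite !subr_eq0 => /eqP -> /eqP ->.
Qed.

(** The first five represent all elements up to sign, with 2 in position 1; the negatives of the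
    nonzero ones follow in the same order. *)
Definition nine_elems : seq (N * N) :=
  [:: (0, 0); (2, 0); (0, 1); (1, 1); (1, 2); (1, 0); (0, 2); (2, 2); (2, 1)]%num.

Lemma nineF_surj (x : F) : exists2 c, List.In c nine_elems & nineF c = x.
Proof.
pose e (j : 'I_9) := nineF (nth (0, 0)%num nine_elems j).
have inj : injective e.
  move=> j k /nineF_inj[].
  case: j => [[|[|[|[|[|[|[|[|[|j]]]]]]]]] j9] //;
  case: k => [[|[|[|[|[|[|[|[|[|k]]]]]]]]] k9] //= /eqP + /eqP; rewrite -!eqb3 //;
  by move=> _ _; apply: val_inj.
have := inj_card_onto inj; rewrite card_ord cF => /(_ (leqnn _) x)/codomP[[j j9] ->].
exists (nth (0, 0)%num nine_elems j) => //.
by case: j j9 => [|[|[|[|[|[|[|[|[|j]]]]]]]]] //= _; do ?[by left | right].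
Qed.

Lemma nine_interprets :
  interprets nine_arith (pFrobenius_aut three_F : {rmorphism F -> F}) nineF.
Proof.
split=> //=; rewrite /nineF /=.
- by rewrite natF0 mul0r addr0.
- by rewrite natF1 natF0 mul0r addr0.
- by move=> a b; rewrite !red3 !natFD; ring.
- move=> a b; rewrite !red3 !natFD !natFM natF2.
  transitivity (natF F a.1 * natF F b.1 + natF F a.2 * natF F b.2 * -1
    + (natF F a.1 * natF F b.2 + natF F a.2 * natF F b.1) * i); first by ring.
  by rewrite -ii; ring.
- by move=> a; rewrite !opp3; ring.
- move=> a b; rewrite !eqb3; apply/andP/eqP => [[/eqP -> /eqP ->] //|/nineF_inj[-> ->]].
  by rewrite !eqxx.
- move=> a; rewrite opp3 pFrobenius_autD_comm; last exact: mulrC.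
  rewrite pFrobenius_autM_comm; last exact: mulrC.
  rewrite /natF !pFrobenius_aut_nat pFrobenius_autE.
  by rewrite exprS expr2 ii; ring.
move=> cs /andP[c1 cb] P PD Pc.
have ex (f : pred (N * N)) : has f cs -> exists2 c, P (nineF c) & f c.
  elim: cs Pc {c1 cb} => // c s IHs Pc /orP[fc|/IHs]; first by exists c => //; apply: Pc; left.
  by apply=> d ds; apply: Pc; right.
have three c : c *+ 3 = 0 :> F by rewrite -mulr_natr (pcharf0 three_F) mulr0.
have Pn c k : P c -> P (c *+ k).
  have PS j : P c -> P (c *+ j.+1).
    by move=> Pc'; elim: j => // j IHj; rewrite mulrSr; apply: PD.
  by case: k => [/(PS 2)|k]; [rewrite three | apply: PS].
have P1 : P 1.
  have [d Pd /andP[/N.eqb_eq d1 /N.eqb_eq d2]] := ex _ c1.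
  by move: Pd; rewrite /nineF -(red3 d.1) -(red3 d.2) d1 d2 natF0 natF1 mul0r addr0.
have Pi : P i.
  have [d Pd dn] := ex _ cb.
  have {Pd} : P (natF F d.2 * i).
    have -> : natF F d.2 * i = nineF d + natF F d.1 *+ 2.
      by rewrite /nineF -[LHS]add0r -(three (natF F d.1)); ring.
    by apply: PD Pd (Pn _ _ _); apply: Pn.
  rewrite -(red3 d.2); have := reduce_lt (p := 3) isT three_F lm d.2.
  rewrite -/reduce3 /natF; move: dn; case: (reduce3 d.2) => // [[q|q|]] _ /=; first by lia.
    case: q => [q|q|]; [lia | lia | move=> _].
    move/(Pn _ 2); have -> : (Pos.to_nat 2)%:R * i *+ 2 = i *+ 3 + i.
      by rewrite (_ : Pos.to_nat 2 = 2%N) //; ring.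
    by rewrite three add0r.
  by rewrite mul1r.
move=> x; have [d _ <-] := nineF_surj x.
by apply: PD (Pn _ _ P1) _; rewrite mulr_natl; apply: Pn.
Qed.
End Imaginary.
End Nine.

Local Close Scope ring_scope.

(** One unipotent spans only a copy of the prime field; a second one in the same transvection group
    is needed, with a ratio [q] outside the prime field. *)
Definition nine_full (seen : seq (m2 (N * N) * seq bool)) (c : m2 (N * N) * seq bool) :
    option (m2 (N * N) * seq (seq bool * (N * N))) :=
  let R := nine_arith in
  if unip_part R c.1 is Some C then
    foldr (fun d r => if r is Some _ then r else
      if unip_part R d.1 is Some D then
        let q := if nzk R (m12 C) then kmul R (m12 D) (kinv R nine_elems (m12 C))
                 else kmul R (m21 D) (kinv R nine_elems (m21 C)) in
        if (if keq R D (kscale R q C) then negb (N.eqb (reduce3 q.2) 0) else false)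
        then Some (C, [:: (c.2, (1, 0)%num); (d.2, q)]) else None
      else None) None seen
  else None.

Definition nine_make :=
  make nine_arith (take 5 nine_elems) nine_elems (1, 1)%num 1 nine_full
    (* A pair of elements of orders 2 and 4: trace i means that y^2 has trace i^2 - 2 = 0. The
       product has trace 1 + i and order 5. *)
    ((0, 0), (0, 1), (1, 1))%num [:: nseq 2 false; nseq 4 true].

Definition nine_words : seq (seq nat) :=
  [seq w ++ v | v <- [:: [::]; [:: 3]; [:: 4]; [:: 3; 4]], w <- [:: [::]; [:: 0];
     [:: 1]; [:: 0; 1]; [:: 1; 0]; [:: 0; 1; 0]]].

Definition arith7 := prime_arith 7 [:: 112; 56; 28; 14; 7]%num.
(** Evaluated once, so that the checks below read stored data instead of repeating the search. The
    last argument is a nonsquare modulo the prime. *)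
Definition table7 := Eval vm_compute in prime_make 7 3.
Definition labels7 :=
  Eval vm_compute in make_labels arith7 table7.1 prime_words table7.2.

Definition arith11 := prime_arith 11 [:: 176; 88; 44; 22; 11]%num.
Definition table11 := Eval vm_compute in prime_make 11 2.
Definition labels11 :=
  Eval vm_compute in make_labels arith11 table11.1 prime_words table11.2.

Definition arith13 := prime_arith 13 [:: 208; 104; 52; 26; 13]%num.
Definition table13 := Eval vm_compute in prime_make 13 2.
Definition labels13 :=
  Eval vm_compute in make_labels arith13 table13.1 prime_words table13.2.

Definition arith17 := prime_arith 17 [:: 272; 136; 68; 34; 17]%num.
Definition table17 := Eval vm_compute in prime_make 17 3.
Definition labels17 :=
  Eval vm_compute in make_labels arith17 table17.1 prime_words table17.2.

Definition arith19 := prime_arith 19 [:: 304; 152; 76; 38; 19]%num.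
Definition table19 := Eval vm_compute in prime_make 19 2.
Definition labels19 :=
  Eval vm_compute in make_labels arith19 table19.1 prime_words table19.2.

Definition table9 := Eval vm_compute in nine_make.
Definition labels9 :=
  Eval vm_compute in make_labels nine_arith table9.1 nine_words table9.2.

(** Over a prime field the number of entries is the number of orbits of Aut G on generating pairs,
    so [Gbar] is here the 57th power of PSL2; each entry stands for two conjugacy classes of
    pairs. *)
Lemma table7_ok : check_table arith7 table7.1 57.
Proof. by vm_cast_no_check (erefl true). Qed.

Lemma labels7_ok : check_labels arith7 table7.1 labels7.1.1 57 3 2.
Proof. by vm_cast_no_check (erefl true). Qed.

Lemma table11_ok : check_table arith11 table11.1 254.
Proof. by vm_cast_no_check (erefl true). Qed.

Lemma labels11_ok : check_labels arith11 table11.1 labels11.1.1 254 27 7.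
Proof. by vm_cast_no_check (erefl true). Qed.

Lemma table13_ok : check_table arith13 table13.1 495.
Proof. by vm_cast_no_check (erefl true). Qed.

Lemma labels13_ok : check_labels arith13 table13.1 labels13.1.1 495 54 17.
Proof. by vm_cast_no_check (erefl true). Qed.

Lemma table17_ok : check_table arith17 table17.1 1132.
Proof. by vm_cast_no_check (erefl true). Qed.

Lemma labels17_ok : check_labels arith17 table17.1 labels17.1.1 1132 104 50.
Proof. by vm_cast_no_check (erefl true). Qed.

Lemma table19_ok : check_table arith19 table19.1 1570.
Proof. by vm_cast_no_check (erefl true). Qed.

Lemma labels19_ok : check_labels arith19 table19.1 labels19.1.1 1570 133 74.
Proof. by vm_cast_no_check (erefl true). Qed.

Lemma table9_ok : check_table nine_arith table9.1 106.
Proof. by vm_cast_no_check (erefl true). Qed.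

Lemma labels9_ok : check_labels nine_arith table9.1 labels9.1.1 106 12 1.
Proof. by vm_cast_no_check (erefl true). Qed.

Theorem GT1_nine (F : finFieldType) : #|F| = 9 -> GT1 (PSL2 F) \isog [set: C2D8 12 1].
Proof.
move=> cF; have [i ii] := sqrt_minus_one cF.
have el f : exists2 c, List.In c (elems table9.1) & nineF i c = f.
  by have [c cI e] := nineF_surj cF ii f; exists c.
by apply: (labels_isog (nine_interprets cF ii) el table9_ok labels9_ok); rewrite cF.
Qed.

Local Open Scope group_scope.

Theorem theorem5p2 :
  (forall F : finFieldType, #|F| = 4%N -> GT1 (PSL2 F) :=: 1) /\
  (forall F : finFieldType, #|F| = 7%N ->
     GT1 (PSL2 F) \isog [set: C2D8 3 2]) /\
  (forall F : finFieldType, #|F| = 9%N ->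
     GT1 (PSL2 F) \isog [set: C2D8 12 1]) /\
  (forall F : finFieldType, #|F| = 8%N -> GT1 (PSL2 F) :=: 1) /\
  (forall F : finFieldType, #|F| = 11%N ->
     GT1 (PSL2 F) \isog [set: C2D8 27 7]) /\
  (forall F : finFieldType, #|F| = 13%N ->
     GT1 (PSL2 F) \isog [set: C2D8 54 17]) /\
  (forall F : finFieldType, #|F| = 17%N ->
     GT1 (PSL2 F) \isog [set: C2D8 104 50]) /\
  (forall F : finFieldType, #|F| = 19%N ->
     GT1 (PSL2 F) \isog [set: C2D8 133 74]) /\
  (forall F : finFieldType, #|F| = 16%N -> GT1 (PSL2 F) :=: 1).
Proof.
do ![split]; move=> F cF.
- exact: (@GT1_even_card F 0).
- exact: (GT1_prime (p := 7%num) _ _ _ _ table7_ok labels7_ok cF).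
- exact: GT1_nine.
- exact: (@GT1_even_card F 1).
- exact: (GT1_prime (p := 11%num) _ _ _ _ table11_ok labels11_ok cF).
- exact: (GT1_prime (p := 13%num) _ _ _ _ table13_ok labels13_ok cF).
- exact: (GT1_prime (p := 17%num) _ _ _ _ table17_ok labels17_ok cF).
- exact: (GT1_prime (p := 19%num) _ _ _ _ table19_ok labels19_ok cF).
- exact: (@GT1_even_card F 2).
Qed.
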